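(* Let $r,s\in\mathbb{R}$, let $(Y,H,X)$ be a Lie triple in $\mathfrak{g}$, and let $\lambda$ be a one-parameter subgroup adapted to $(Y,H,X)$. Let $\mathcal{A}=\mathcal{A}(\mathbb{T})$ be an apartment of $\mathcal{B}(G)$ with $\lambda\in X_*(\mathbb{T})$. If $\mathcal{F}_r\subset\mathcal{A}$ is an $r$-facet corresponding to a generalized $r$-facet of maximal dimension in $\mathcal{B}_r(Y,H,X)$, then there exist $x\in\mathcal{F}_r$ and an $s$-facet $\mathcal{F}_s'$ such that $x+\frac{s-r}{2}\lambda\in\mathcal{F}'_s$ and $\mathcal{F}'_s$ corresponds to a generalized $s$-facet of maximal dimension in $\mathcal{B}_s(Y,H,X)$.
   Context: Field and group. $k$ is a non-Archimedean local field with integer ring $\mathcal{R}$, maximal ideal $\mathcal{P}$, normalized valuation $\mathrm{val}$, and finite residue field of characteristic $p_{\mathfrak f}$. $\mathbb{G}=\mathrm{SL}_n$ or $\mathbb{G}=\mathrm{Sp}_{2n}$, $n\ge2$, with Coxeter number $h$ ($h=n$ for $\mathrm{SL}_n$, $h=2n$ for $\mathrm{Sp}_{2n}$), and $p_{\mathfrak f}>3(h-1)$. $G=\mathbb{G}(k)$, $\mathfrak{g}$ is its Lie algebra over $k$. Lie triples. A Lie triple is $(Y,H,X)$ in $\mathfrak{g}$ with $[H,X]=2X$, $[H,Y]=-2Y$, $[X,Y]=H$. There is a homomorphism of algebraic groups $\varphi:\mathrm{SL}_2\to\mathbb{G}$ over $k$ whose differential sends the standard basis $(f,h,e)$ of $\mathfrak{sl}_2$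 to $(Y,H,X)$; the one-parameter subgroup $\lambda(t)=\varphi(\mathrm{diag}(t,t^{-1}))$ is said to be adapted to $(Y,H,X)$. Filtrations. $\mathcal{B}(G)$ is the Bruhat-Tits building; for a maximal $k$-split torus $\mathbb{T}$ with Lie algebra (over $k$) $\mathfrak{t}$, the apartment $\mathcal{A}(\mathbb{T})$ is the affine space underlying $X_*(\mathbb{T})\otimes\mathbb{R}$, so a real multiple $c\lambda$ of $\lambda\in X_*(\mathbb{T})$ acts on it by translation. $\Phi$ is the set of roots, $\Psi=\{\phi+m:\phi\in\Phi,m\in\mathbb{Z}\}$ the set of affine roots, functions on the apartment by $(\phi+m)(x)=\phi(x)+m$. For $\psi=\phi+m$, $\mathfrak{g}_\psi=\gamma_\phi(\mathcal{P}^m)\subset\mathfrak{g}_\phi$, where $\gamma_\phi:k\to\mathfrak{g}_\phi$ is an isomorphism with $\gamma_\phi(\mathcal{R})=\mathfrak{g}_\phi\cap\mathfrak{g}(\mathcal{R})$ (for $\mathbb{T}$ diagonal; transported to other apartments by $G$). For $x\in\mathcal{A}(\mathbb{T})$ and $r\in\mathbb{R}$, $\mathfrak{t}_r=\{H\in\mathfrak{t}:\mathrm{val}(d\chi(H))\ge r\ \forall\chi\in X^*(\mathbb{T})\}$ and $\mathfrak{g}_{x,r}=\mathfrak{t}_r\oplus\sum_{\psi(x)\ge r}\mathfrak{g}_\psi$; $\mathfrak{g}_{x,r+}$ is defined with strict inequalities. Facets. For $\psi\in\Psi$, $H_{\psi-r}=\{x\in\mathcal{A}:\psi(x)=r\}$.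 For a finite subset $\Sigma\subseteq\Psi$, let $H_\Sigma=\bigcap_{\psi\in\Sigma}H_{\psi-r}$. An $r$-facet of $\mathcal{A}$ is a connected component of $H_\Sigma\setminus\bigcup_{\psi\in\Psi\setminus\Sigma}H_{\psi-r}$ for some $\Sigma$; its dimension is that of the smallest affine subspace of $\mathcal{A}$ containing it. The generalized $r$-facet containing $x\in\mathcal{B}(G)$ is the set of $y\in\mathcal{B}(G)$ with $\mathfrak{g}_{x,r}=\mathfrak{g}_{y,r}$ and $\mathfrak{g}_{x,r+}=\mathfrak{g}_{y,r+}$; its nonempty intersections with apartments are $r$-facets all of the same dimension, which is its dimension. An $r$-facet of $\mathcal{A}$ ''corresponds to'' the generalized $r$-facet containing it. $\mathcal{B}_r(Y,H,X)=\{x\in\mathcal{B}(G):Y\in\mathfrak{g}_{x,-r},\,X\in\mathfrak{g}_{x,r}\}$, which is a nonempty closed convex union of generalized $r$-facets (and likewise with $s$ in place of $r$). *)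

(* Defs.v *)
From HB Require Import structures.
From mathcomp Require Import all_boot all_order all_algebra perm.
From mathcomp Require Import all_classical all_reals all_analysis.
Import Order.TTheory GRing.Theory Num.Theory.
Import numFieldNormedType.Exports.

Set Implicit Arguments.
Unset Strict Implicit.
Unset Printing Implicit Defensive.

Local Open Scope classical_set_scope.
Local Open Scope ring_scope.

(** * Non-Archimedean local fields *)

(* [val x] is only meaningful for [x != 0]; these two predicates read
   [val 0] as +oo. *)
Definition vge (k : fieldType) (val : k -> int) (R : numDomainType)
  (r : R) (x : k) : Prop := x = 0 \/ r <= (val x)%:~R.

Definition vgt (k : fieldType) (val : k -> int) (R : numDomainType)
  (r : R) (x : k) : Prop := x = 0 \/ r < (val x)%:~R.

Record is_local_field (k : fieldType) (val : k -> int) : Prop := {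
  valM : forall x y, x != 0 -> y != 0 -> val (x * y) = val x + val y;
  valD : forall x y, x != 0 -> y != 0 -> x + y != 0 ->
    Num.min (val x) (val y) <= val (x + y);
  val_normalized : exists pi, pi != 0 /\ val pi = 1;
  val_complete : forall u : nat -> k,
    (forall e : int, exists N, forall i j, (N <= i)%N -> (N <= j)%N ->
       vge val e (u i - u j)) ->
    exists l, forall e : int, exists N, forall i, (N <= i)%N ->
      vge val e (u i - l);
  residue_field_finite : exists reps : seq k, forall x, vge val (0 : int) x ->
    exists2 y, y \in reps & vge val (1 : int) (x - y)
}.

Definition residue_char (k : fieldType) (val : k -> int) (p : nat) : Prop :=
  prime p /\ vge val (1 : int) (p%:R : k).

(** * The groups SL_n and Sp_2n *)

Inductive group_type := SL | Sp.

(* Size of the standard representation. *)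
Definition dimG (gt : group_type) (n : nat) : nat :=
  match gt with SL => n | Sp => (n + n)%N end.

Definition coxeter_number (gt : group_type) (n : nat) : nat :=
  match gt with SL => n | Sp => (2 * n)%N end.

Definition sympl_form (A : nzRingType) (n : nat) : 'M[A]_(n + n) :=
  block_mx 0 1%:M (- 1%:M) 0.

(* The A-points of the group. *)
Definition in_group (gt : group_type) (n : nat) (A : comNzRingType) :
    set 'M[A]_(dimG gt n) :=
  match gt return set 'M[A]_(dimG gt n) with
  | SL => fun g => \det g = 1
  | Sp => fun g : 'M[A]_(n + n) =>
            g^T *m sympl_form A n *m g = sympl_form A n
  end.

Definition in_lie (gt : group_type) (n : nat) (A : comNzRingType) :
    set 'M[A]_(dimG gt n) :=
  match gt return set 'M[A]_(dimG gt n) with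
  | SL => fun M => \tr M = 0
  | Sp => fun M : 'M[A]_(n + n) =>
            M^T *m sympl_form A n + sympl_form A n *m M = 0
  end.
Arguments in_group : clear implicits.
Arguments in_lie : clear implicits.

(** * Homomorphisms SL_2 -> G and adapted one-parameter subgroups *)

(* A homomorphism of algebraic groups over k, as a natural transformation of
   group functors on commutative k-algebras.  The values of [phi] off
   [SL_2(A)] are irrelevant. *)
Record is_sl2_hom (gt : group_type) (n : nat) (k : fieldType)
    (phi : forall A : comAlgType k, 'M[A]_2 -> 'M[A]_(dimG gt n)) : Prop := {
  sl2_hom_group : forall (A : comAlgType k) (g : 'M[A]_2),
    \det g = 1 -> in_group gt n A (phi A g);
  sl2_homM : forall (A : comAlgType k) (g h : 'M[A]_2),
    \det g = 1 -> \det h = 1 -> phi A (g *m h) = phi A g *m phi A h;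
  sl2_hom_nat : forall (A B : comAlgType k) (f : {lrmorphism A -> B})
    (g : 'M[A]_2), \det g = 1 -> phi B (map_mx f g) = map_mx f (phi A g)
}.

(* d(phi)(M) = M', read off on square-zero elements eps (universally, on the
   dual numbers). *)
Definition differential_at (gt : group_type) (n : nat) (k : fieldType)
    (phi : forall A : comAlgType k, 'M[A]_2 -> 'M[A]_(dimG gt n))
    (M : 'M[k]_2) (M' : 'M[k]_(dimG gt n)) : Prop :=
  forall (A : comAlgType k) (eps : A), eps ^+ 2 = 0 ->
    phi A (1%:M + eps *: map_mx (in_alg A) M)
      = 1%:M + eps *: map_mx (in_alg A) M'.

Definition sl2_e (k : fieldType) : 'M[k]_2 := delta_mx 0 1.
Definition sl2_f (k : fieldType) : 'M[k]_2 := delta_mx 1 0.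
Definition sl2_h (k : fieldType) : 'M[k]_2 := delta_mx 0 0 - delta_mx 1 1.

Definition lie_bracket (k : fieldType) (d : nat) (A B : 'M[k]_d) : 'M[k]_d :=
  A *m B - B *m A.

Record lie_triple (gt : group_type) (n : nat) (k : fieldType)
    (Y H X : 'M[k]_(dimG gt n)) : Prop := {
  lie_triple_Y : in_lie gt n k Y;
  lie_triple_H : in_lie gt n k H;
  lie_triple_X : in_lie gt n k X;
  lie_triple_HX : lie_bracket H X = 2 *: X;
  lie_triple_HY : lie_bracket H Y = - (2 *: Y);
  lie_triple_XY : lie_bracket X Y = H
}.

(* [lambda A t] is the value at [t] in [G_m(A)], the units of [A]. *)
Definition adapted (gt : group_type) (n : nat) (k : fieldType)
    (lambda : forall A : comUnitAlgType k, A -> 'M[A]_(dimG gt n))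
    (Y H X : 'M[k]_(dimG gt n)) : Prop :=
  exists phi : forall A : comAlgType k, 'M[A]_2 -> 'M[A]_(dimG gt n),
    [/\ is_sl2_hom phi,
        [/\ differential_at phi (sl2_f k) Y,
            differential_at phi (sl2_h k) H &
            differential_at phi (sl2_e k) X] &
        forall (A : comUnitAlgType k) (t : A), t \is a GRing.unit ->
          lambda A t = phi A (t *: delta_mx 0 0 + t^-1 *: delta_mx 1 1)].

(** * The diagonal torus D: cocharacters, weights, roots *)

(* Elements of X_*(D) (for V = int) and of X_*(D) (x) R (for V = R) are row
   vectors of length n: for SL_n, [a] stands for diag(t^a_1, ..., t^a_n) with
   sum a_i = 0; for Sp_2n, for
   diag(t^a_1, ..., t^a_n, t^-a_1, ..., t^-a_n). *)
Definition in_cochar (gt : group_type) (n : nat) (V : zmodType) : set 'rV[V]_n :=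
  match gt with
  | SL => fun a => \sum_(i < n) a 0 i = 0
  | Sp => fun=> True
  end.
Arguments in_cochar : clear implicits.

Definition std_weight (gt : group_type) (n : nat) :
    'I_(dimG gt n) -> 'rV[int]_n :=
  match gt return 'I_(dimG gt n) -> 'rV[int]_n with
  | SL => fun i => delta_mx 0 i
  | Sp => fun i : 'I_(n + n) =>
      match fintype.split i with
      | inl j => delta_mx 0 j
      | inr j => - delta_mx 0 j
      end
  end.
Arguments std_weight : clear implicits.

Definition pairing (n : nat) (V : nzRingType) (w : 'rV[int]_n) (x : 'rV[V]_n) : V :=
  \sum_(i < n) (w 0 i)%:~R * x 0 i.

Definition roots (gt : group_type) (n : nat) : set 'rV[int]_n :=
  [set phi | exists i j : 'I_(dimG gt n),
     i != j /\ phi = std_weight gt n i - std_weight gt n j].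
Arguments roots : clear implicits.

(* [(phi, m)] is the affine root phi + m. *)
Definition affine_roots (gt : group_type) (n : nat) : set ('rV[int]_n * int) :=
  [set psi | roots gt n psi.1].
Arguments affine_roots : clear implicits.

Definition aff_eval (n : nat) (R : realType) (psi : 'rV[int]_n * int)
  (x : 'rV[R]_n) : R := pairing psi.1 x + psi.2%:~R.

(* lambda lies in X_*(T) for the maximal k-split torus T = g D g^-1, and is the
   cocharacter g a g^-1 with a in X_*(D). *)
Definition cochar_in_torus (gt : group_type) (n : nat) (k : fieldType)
    (lambda : forall A : comUnitAlgType k, A -> 'M[A]_(dimG gt n))
    (g : 'M[k]_(dimG gt n)) (a : 'rV[int]_n) : Prop :=
  in_cochar gt n int a /\
  forall (A : comUnitAlgType k) (t : A), t \is a GRing.unit ->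
    lambda A t =
      map_mx (in_alg A) g
      *m diag_mx (\row_i t ^ pairing (std_weight gt n i) a)
      *m map_mx (in_alg A) (invmx g).

(** * Moy-Prasad filtrations on the standard apartment *)

Section Filtrations.
Context (gt : group_type) (n : nat) (k : fieldType) (val : k -> int)
        (R : realType).
Let d := dimG gt n.

Definition root_space (phi : 'rV[int]_n) : set 'M[k]_d :=
  [set M | in_lie gt n k M /\ forall i j, M i j != 0 ->
     std_weight gt n i - std_weight gt n j = phi].

Definition integral_mx : set 'M[k]_d :=
  [set M | forall i j, vge val (0 : int) (M i j)].

Definition is_root_iso (phi : 'rV[int]_n) (gam : {linear k^o -> 'M[k]_d}) : Prop :=
  [/\ injective gam, range gam = root_space phi &
      gam @` [set c | vge val (0 : int) c] = root_space phi `&` integral_mx].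

Definition affine_root_space (psi : 'rV[int]_n * int) : set 'M[k]_d :=
  [set M | exists2 gam, is_root_iso psi.1 gam &
     (gam @` [set c | vge val psi.2 c]) M].

(* Characters of D are the restrictions of the characters
   diag(t_i) |-> prod_i t_i ^ chi_i of the full diagonal torus.
   [cl = true] is the filtration of depth r, [cl = false] that of depth r+. *)
Definition torus_filt (cl : bool) (r : R) : set 'M[k]_d :=
  [set M | [/\ in_lie gt n k M, is_diag_mx M &
     forall chi : 'rV[int]_d,
       let c := \sum_i (M i i) *~ chi 0 i in
       if cl then vge val r c else vgt val r c]].

Inductive add_closure (S : set 'M[k]_d) : set 'M[k]_d :=
| add_closure0 : add_closure S 0
| add_closureD M M' : S M -> add_closure S M' -> add_closure S (M + M').

Definition lie_filt (cl : bool) (x : 'rV[R]_n) (r : R) : set 'M[k]_d :=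
  add_closure (torus_filt cl r `|`
    \bigcup_(psi in [set psi | affine_roots gt n psi /\
                               (r < aff_eval psi x ?<= if cl)])
      affine_root_space psi).

(** * The Bruhat-Tits building *)

(* The building is G(k) x A(D) modulo
     (g, x) ~ (h, y)  iff  y = nu(m) x and g^-1 h m \in U_x
                           for some m in N(k),
   where N is the normaliser of D and U_x is generated by the affine root
   groups U_psi with psi(x) >= 0.  Points are the equivalence classes. *)

(* Root vectors of SL_n and Sp_2n square to zero in the standard
   representation, so the root group is 1 + g_psi. *)
Inductive parahoric (x : 'rV[R]_n) : set 'M[k]_d :=
| parahoric1 : parahoric x 1%:M
| parahoricM (psi : 'rV[int]_n * int) (u v : 'M[k]_d) :
    affine_roots gt n psi -> 0 <= aff_eval psi x ->
    affine_root_space psi u -> parahoric x v ->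
    parahoric x ((1%:M + u) *m v).

(* The normaliser of D consists of the monomial matrices of the group. *)
Definition torus_normaliser : set 'M[k]_d :=
  [set m | in_group gt n k m /\
     exists s : 'S_d, forall i j, (m i j != 0) = (i == s j)].

(* y = nu(m) x, normalised so that Ad(m) g_{x,r} = g_{nu(m)x,r}; a diagonal m
   translates by -val(m). *)
Definition nu_act (m : 'M[k]_d) (x y : 'rV[R]_n) : Prop :=
  forall i j, m i j != 0 ->
    pairing (std_weight gt n i) y
      = pairing (std_weight gt n j) x - (val (m i j))%:~R.

Definition building_rel (g : 'M[k]_d) (x : 'rV[R]_n)
    (h : 'M[k]_d) (y : 'rV[R]_n) : Prop :=
  exists m, [/\ torus_normaliser m, nu_act m x y &
                parahoric x (invmx g *m h *m m)].

Definition point := set ('M[k]_d * 'rV[R]_n).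

(* The point g.x; for fixed g, x |-> g.x parametrises the apartment of
   g D g^-1 by the apartment X_*(D) (x) R of D. *)
Definition pt (g : 'M[k]_d) (x : 'rV[R]_n) : point :=
  [set q | [/\ in_group gt n k q.1, in_cochar gt n R q.2 &
               building_rel g x q.1 q.2]].

Definition building : set point :=
  [set P | exists g x,
     [/\ in_group gt n k g, in_cochar gt n R x & P = pt g x]].

Definition pt_filt (cl : bool) (P : point) (r : R) : set 'M[k]_d :=
  [set M | exists g x,
     [/\ in_group gt n k g, in_cochar gt n R x, P = pt g x &
         lie_filt cl x r (invmx g *m M *m g)]].

Definition B_set (Y X : 'M[k]_d) (r : R) : set point :=
  [set P | [/\ building P, pt_filt true P (- r) Y & pt_filt true P r X]].

(** * Facets *)

Definition facet_flat (Sigma : set ('rV[int]_n * int)) (r : R) : set 'rV[R]_n :=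
  [set x | in_cochar gt n R x /\ forall psi, Sigma psi -> aff_eval psi x = r].

(* r-facets of the apartment of g D g^-1, in the coordinates x |-> g.x. *)
Definition is_facet (r : R) (F : set 'rV[R]_n) : Prop :=
  exists Sigma : set ('rV[int]_n * int),
    [/\ finite_set Sigma, Sigma `<=` affine_roots gt n &
     let Z := facet_flat Sigma r `\`
       \bigcup_(psi in affine_roots gt n `\` Sigma)
         [set x | aff_eval psi x = r] in
     exists2 x, Z x & F = connected_component Z x].

Definition affine_subspace (x : 'rV[R]_n) (V : {vspace 'rV[R]_n}) :
  set 'rV[R]_n := [set y | y - x \in V].

(* [e] is the dimension of the smallest affine subspace containing F. *)
Definition affine_dim (F : set 'rV[R]_n) (e : nat) : Prop :=
  exists x V, [/\ F `<=` affine_subspace x V,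
    forall x' V', F `<=` affine_subspace x' V' ->
      affine_subspace x V `<=` affine_subspace x' V' &
    \dim V = e].

Definition same_gen_facet (r : R) (P Q : point) : Prop :=
  pt_filt true P r = pt_filt true Q r /\
  pt_filt false P r = pt_filt false Q r.

Definition is_gen_facet (r : R) (GF : set point) : Prop :=
  exists2 P, building P & GF = [set Q | building Q /\ same_gen_facet r P Q].

Definition gen_facet_dim (GF : set point) (e : nat) : Prop :=
  exists g, in_group gt n k g /\
    let F := [set x | in_cochar gt n R x /\ GF (pt g x)] in
    F !=set0 /\ affine_dim F e.

Definition max_gen_facet (Y X : 'M[k]_d) (r : R) (GF : set point) : Prop :=
  [/\ is_gen_facet r GF, GF `<=` B_set Y X r &
   exists2 e, gen_facet_dim GF e &
     forall GF' e', is_gen_facet r GF' -> GF' `<=` B_set Y X r ->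
       gen_facet_dim GF' e' -> (e' <= e)%N].

(* The r-facet F of the apartment of g D g^-1 corresponds to a generalized
   r-facet of maximal dimension in B_r(Y, H, X). *)
Definition corresponds_max (Y X g : 'M[k]_d) (r : R) (F : set 'rV[R]_n) : Prop :=
  exists2 GF, max_gen_facet Y X r GF & pt g @` F `<=` GF.

End Filtrations.

(* Main.v *)
Require Import Defs.
From HB Require Import structures.
From mathcomp Require Import all_boot all_order all_algebra perm qpoly.
From mathcomp Require Import all_classical all_reals all_analysis.
From mathcomp Require Import ring lra zify.
Import Order.TTheory GRing.Theory Num.Theory.
Import numFieldNormedType.Exports.

(** Write c for (s - r) / 2.  In the coordinates of the torus of [g], the matrix of
X only has entries of weight 2 for [a] and that of Y only entries of weight -2
([adapted_X], [adapted_Y]).  Hence translation by c [a] turns the conditions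
defining B_r in this apartment into those defining B_s ([translate_B]).  The
translate of the given facet need not be contained in one s-facet, but moving
the base point a little inside the facet leaves every hyperplane that does not
contain all directions of the facet; the s-facet reached in this way has at
least the dimension of the given r-facet ([translate_cell]).

It remains to see that no generalised s-facet in B_s is larger.  Let Q be a
point of such a facet.  Since H = [X, Y], the matrix H has depth 0 at Q.
It is diagonalisable, its eigenvalues are images of integers, and their
differences are 0 or units: when the characteristic is 0 this uses that these differences are
smaller than p ([weight_diff_bound], [eigen_unit]).  The spectral projections
of H are therefore integral at Q, the norm attached to Q splits along the
eigenspaces, and Q lies in an apartment such that H belongs to the Lie algebra
of its torus ([diagonalize]).  In that apartment the eigenvalues of H lift to a
real coweight having weight 2 on X and -2 on Y ([potential]).  This coweight
replaces [a], which need not come from a one-parameter subgroup of the new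
torus: in positive characteristic H does not determine [a], as a Frobenius
twist of a homomorphism has differential 0.  Translating back by it gives a
generalised r-facet in B_r of at least the same dimension, so the maximality
assumed for r bounds the dimension for s.

Comparing dimensions requires that the dimension of a generalised facet does
not depend on the apartment ([gen_facet_dim_uniq]); this follows as any two
points lie in a common apartment ([common_apartment]).  Both this fact and the
description of points as norms ([pt_eqP]) come from the decomposition
G = U_x N U_y ([bruhat]), which is Gaussian elimination with the pivots chosen
by means of x and y ([col_clear]). *)

Set Implicit Arguments.
Unset Strict Implicit.
Unset Printing Implicit Defensive.

Local Open Scope classical_set_scope.
Local Open Scope ring_scope.

(** * Valuations *)

Section Valuation.
Context (k : fieldType) (val : k -> int) (R : realType).
Hypothesis hk : is_local_field val.

(** The bounds [r <= val x] and [r < val x] in one predicate, so that the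
    filtrations of depth r and r+ can be treated together. *)
Definition vb (cl : bool) (r : R) (x : k) : Prop :=
  x = 0 \/ (r < (val x)%:~R ?<= if cl).

Lemma val1 : val 1 = 0.
Proof.
have := Defs.valM hk (oner_neq0 k) (oner_neq0 k); rewrite mulr1 => h.
by apply: (addrI (val 1)); rewrite -h addr0.
Qed.

Lemma valN1 : val (-1) = 0.
Proof.
have n1 : (-1 : k) != 0 by rewrite oppr_eq0 oner_neq0.
have := Defs.valM hk n1 n1; rewrite mulrNN mulr1 val1; lia.
Qed.

Lemma valN x : val (- x) = val x.
Proof.
have [->|x0] := eqVneq x 0; first by rewrite oppr0.
by rewrite -mulN1r (Defs.valM hk) ?oppr_eq0 ?oner_neq0 // valN1 add0r.
Qed.

Lemma valV x : x != 0 -> val x^-1 = - val x.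
Proof.
move=> x0; have := Defs.valM hk x0 (_ : x^-1 != 0); rewrite invr_neq0 // mulfV // val1.
by move=> /(_ isT); lia.
Qed.

Lemma valX x m : x != 0 -> val (x ^+ m) = val x *+ m.
Proof.
move=> x0; elim: m => [|m IH]; first by rewrite expr0 val1 mulr0n.
by rewrite exprS (Defs.valM hk) ?expf_neq0 // IH mulrS.
Qed.

Lemma valXz x (m : int) : x != 0 -> val (x ^ m) = val x * m.
Proof.
move=> x0; case: m => m; first by rewrite -exprnP valX // -mulr_natr natz.
by rewrite NegzE -exprnN valV ?expf_neq0 // valX // mulrN -mulr_natr natz.
Qed.

Lemma vb_neq0 cl r x : x != 0 -> vb cl r x <-> (r < (val x)%:~R ?<= if cl).
Proof. by move=> x0; split=> [[xx|//]|]; [rewrite xx eqxx in x0 | right]. Qed.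

Lemma vb_cst (c : int) : exists x, x != 0 /\ val x = c.
Proof.
have [pi [pi0 vpi]] := val_normalized hk.
by exists (pi ^ c); rewrite expfz_neq0 // valXz // vpi mul1r.
Qed.

Lemma vbN cl r x : vb cl r x -> vb cl r (- x).
Proof. by case=> [->|h]; [left; rewrite oppr0|right; rewrite valN]. Qed.

Lemma vbW cl cl' r r' x : (r' < r ?<= if cl ==> cl') -> vb cl r x -> vb cl' r' x.
Proof.
move=> h [->|h']; [by left|right].
by move: cl cl' h h' => [] [] /=; lra.
Qed.

Lemma vbD cl r x y : vb cl r x -> vb cl r y -> vb cl r (x + y).
Proof.
move=> [->|hx]; first by rewrite add0r.
move=> [->|hy]; first by rewrite addr0; right.
have [->|x0] := eqVneq x 0; first by rewrite add0r; right.
have [->|y0] := eqVneq y 0; first by rewrite addr0; right.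
have [->|xy0] := eqVneq (x + y) 0; first by left.
right; have := Defs.valD hk x0 y0 xy0; rewrite ge_min => /orP[] h.
  by move: h hx; rewrite -(ler_int R); case: cl {hy} => /=; lra.
by move: h hy; rewrite -(ler_int R); case: cl {hx} => /=; lra.
Qed.

Lemma vb_sum cl r I (s : seq I) (P : pred I) (f : I -> k) :
  (forall i, P i -> vb cl r (f i)) -> vb cl r (\sum_(i <- s | P i) f i).
Proof. by move=> h; apply: big_ind => //; [left|move=> ? ? ? ?; exact: vbD]. Qed.

Lemma vbM cl r s x y : vb true r x -> vb cl s y -> vb cl (r + s) (x * y).
Proof.
have [->|x0] := eqVneq x 0; first by rewrite mul0r; left.
have [->|y0] := eqVneq y 0; first by rewrite mulr0; left.
move=> [xx|hx]; first by rewrite xx eqxx in x0.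
move=> [yy|hy]; first by rewrite yy eqxx in y0.
right; rewrite (Defs.valM hk) // intrD.
by case: cl hy => /=; move: hx => /=; lra.
Qed.

Lemma vb1 r : r <= 0 -> vb true r 1.
Proof. by right; rewrite val1. Qed.

Lemma vgeP (m : int) x : vge val m x <-> vb true (m%:~R) x.
Proof. by rewrite /vge /vb /= intz ler_int. Qed.

Lemma vb_nat (m : nat) : vb true 0 m%:R.
Proof.
elim: m => [|m IH]; first by left.
by rewrite mulrS; apply: vbD => //; apply: vb1.
Qed.

Lemma vb_int (m : int) : vb true 0 m%:~R.
Proof.
case: m => m; first exact: vb_nat.
by rewrite NegzE mulrNz; apply: vbN; exact: vb_nat.
Qed.

End Valuation.

(** * Weights of the standard representation *)

Section Weights.
Context (gt : group_type) (n : nat).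
Local Notation d := (dimG gt n).
Local Notation w := (std_weight gt n).

Definition wt (V : nzRingType) (i : 'I_d) (x : 'rV[V]_n) : V := pairing (w i) x.

(** The index of the opposite weight.  Taking it to be the identity for SL lets
    the elimination arguments below be stated once for both groups. *)
Definition star : 'I_d -> 'I_d :=
  match gt return 'I_(dimG gt n) -> 'I_(dimG gt n) with
  | SL => id
  | Sp => fun i : 'I_(n + n) =>
      match fintype.split i with
      | inl j => rshift n j
      | inr j => lshift n j
      end
  end.

(** The entry of the symplectic form in row [i] and column [star i]. *)
Definition sg (A : nzRingType) : 'I_d -> A :=
  match gt return 'I_(dimG gt n) -> A with
  | SL => fun=> 1
  | Sp => fun i : 'I_(n + n) =>
      match fintype.split i with inl _ => 1 | inr _ => -1 end
  end.

Lemma pairingD (V : comNzRingType) (v : 'rV[int]_n) (x y : 'rV[V]_n) :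
  pairing v (x + y) = pairing v x + pairing v y.
Proof. by rewrite /pairing -big_split; apply: eq_bigr => i _; rewrite mxE mulrDr. Qed.

Lemma pairingZ (V : comNzRingType) (v : 'rV[int]_n) c (x : 'rV[V]_n) :
  pairing v (c *: x) = c * pairing v x.
Proof. by rewrite /pairing mulr_sumr; apply: eq_bigr => i _; rewrite mxE mulrCA. Qed.

Lemma pairingBl (V : comNzRingType) (v v' : 'rV[int]_n) (x : 'rV[V]_n) :
  pairing (v - v') x = pairing v x - pairing v' x.
Proof.
by rewrite /pairing -sumrB; apply: eq_bigr => i _; rewrite !mxE intrD intrN mulrBl.
Qed.

Lemma pairing_intr (V : comNzRingType) (v : 'rV[int]_n) (x : 'rV[int]_n) :
  pairing v (map_mx intr x : 'rV[V]_n) = (pairing v x)%:~R.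
Proof.
rewrite /pairing rmorph_sum; apply: eq_bigr => i _.
by rewrite mxE [RHS]rmorphM /= intz.
Qed.

Lemma wtD (V : comNzRingType) i (x y : 'rV[V]_n) : wt i (x + y) = wt i x + wt i y.
Proof. exact: pairingD. Qed.

Lemma wtZ (V : comNzRingType) i c (x : 'rV[V]_n) : wt i (c *: x) = c * wt i x.
Proof. exact: pairingZ. Qed.

Lemma wtN (V : comNzRingType) i (x : 'rV[V]_n) : wt i (- x) = - wt i x.
Proof. by rewrite -scaleN1r wtZ mulN1r. Qed.

Lemma starK : involutive star.
Proof.
rewrite /star; move: gt => [] // i /=.
by case: (splitP i) => j /= e; [rewrite (unsplitK (inr j)) | rewrite (unsplitK (inl j))];
  apply: val_inj; rewrite /= e.
Qed.

End Weights.

Arguments star {gt n} i : simpl never.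
Arguments sg {gt n A} i : simpl never.

Section WeightsCases.
Context (n : nat).

Lemma wtSL (V : nzRingType) (i : 'I_n) (x : 'rV[V]_n) : @wt SL n V i x = x 0 i.
Proof.
rewrite /wt /pairing (bigD1 i) //= big1 ?addr0 => [|j ji]; rewrite !mxE eqxx /=.
  by rewrite eqxx mul1r.
by rewrite (negPf ji) mul0r.
Qed.

Lemma wtSp_l (V : comNzRingType) (i : 'I_n) (x : 'rV[V]_n) : @wt Sp n V (lshift n i) x =
  x 0 i.
Proof.
by rewrite /wt /= (unsplitK (inl i)) -(@wtSL V i x).
Qed.

Lemma wtSp_r (V : comNzRingType) (i : 'I_n) (x : 'rV[V]_n) : @wt Sp n V (rshift n i) x =
  - x 0 i.
Proof.
rewrite /wt /= (unsplitK (inr i)) -(@wtSL V i x) /wt -[- delta_mx 0 i]add0r pairingBl.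
by rewrite {1}/pairing big1 ?sub0r // => j _; rewrite mxE mul0r.
Qed.

Lemma star_l (i : 'I_n) : @star Sp n (lshift n i) = rshift n i.
Proof. by rewrite /star (unsplitK (inl i)). Qed.
Lemma star_r (i : 'I_n) : @star Sp n (rshift n i) = lshift n i.
Proof. by rewrite /star (unsplitK (inr i)). Qed.
Lemma sg_l (A : nzRingType) (i : 'I_n) : @sg Sp n A (lshift n i) = 1.
Proof. by rewrite /sg (unsplitK (inl i)). Qed.
Lemma sg_r (A : nzRingType) (i : 'I_n) : @sg Sp n A (rshift n i) = -1.
Proof. by rewrite /sg (unsplitK (inr i)). Qed.

Lemma lr_case (P : 'I_(n + n) -> Prop) :
  (forall j, P (lshift n j)) -> (forall j, P (rshift n j)) -> forall i, P i.
Proof.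
by move=> hl hr i; rewrite -(splitK i); case: (fintype.split i) => j /=.
Qed.

Lemma wt_star (V : comNzRingType) (i : 'I_(dimG Sp n)) (x : 'rV[V]_n) :
  wt (star i) x = - wt i x.
Proof.
move: i; apply: lr_case => i; first by rewrite star_l wtSp_l wtSp_r.
by rewrite star_r wtSp_l wtSp_r opprK.
Qed.

Lemma star_neq (i : 'I_(dimG Sp n)) : star i != i.
Proof.
move: i; apply: lr_case => i; rewrite ?star_l ?star_r -(inj_eq val_inj) /=;
  have := ltn_ord i; lia.
Qed.

Lemma sg_star (A : nzRingType) (i : 'I_(dimG Sp n)) : sg (star i) = - sg i :> A.
Proof. by move: i; apply: lr_case => i; rewrite ?star_l ?star_r ?sg_l ?sg_r ?opprK. Qed.

End WeightsCases.

Section Sign.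
Context (gt : group_type) (n : nat).
Lemma sg_sq (A : nzRingType) (i : 'I_(dimG gt n)) : sg i * sg i = 1 :> A.
Proof.
move: i; case: gt => [i|]; first by rewrite mulr1.
by apply: lr_case => i; rewrite ?sg_l ?sg_r ?mulrNN mulr1.
Qed.

Lemma sg_pm (A : nzRingType) (i : 'I_(dimG gt n)) : sg i = 1 :> A \/ sg i = -1 :> A.
Proof.
move: i; case: gt => [i|]; first by left.
by apply: lr_case => i; rewrite ?sg_l ?sg_r; [left|right].
Qed.

(** The inner product of two weights for the standard scalar product.  Weights
    have norm 1 and distinct weights have inner product at most 0; this is what
    separates the roots. *)
Definition ipw (i j : 'I_(dimG gt n)) : int := wt i (std_weight gt n j).

End Sign.

Lemma ipSL n (i j : 'I_(dimG SL n)) : ipw i j = (i == j)%:R.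
Proof. by rewrite /ipw wtSL /= mxE eqxx. Qed.

Lemma ipSp n (i j : 'I_(dimG Sp n)) : ipw i j = (i == j)%:R - (i == star j)%:R.
Proof.
rewrite /ipw; move: i j; apply: lr_case => i; apply: lr_case => j;
  rewrite ?wtSp_l ?wtSp_r ?star_l ?star_r /= ?(unsplitK (inl _)) ?(unsplitK (inr _)) !mxE
    /=.
- by rewrite (inj_eq (@lshift_inj _ _)) eq_lrshift subr0.
- by rewrite (inj_eq (@lshift_inj _ _)) eq_lrshift sub0r.
- by rewrite (inj_eq (@rshift_inj _ _)) eq_rlshift sub0r.
- by rewrite (inj_eq (@rshift_inj _ _)) eq_rlshift subr0 opprK.
Qed.

Section IpTheory.
Context (gt : group_type) (n : nat).
Implicit Types i j a b l : 'I_(dimG gt n).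

Lemma ipBr a i j : pairing (std_weight gt n a) (std_weight gt n i - std_weight gt n j) =
  ipw a i - ipw a j.
Proof. by rewrite pairingD -[in X in _ + X]scaleN1r pairingZ mulN1r. Qed.

Lemma ipii i : ipw i i = 1.
Proof.
move: i; case: gt => [i|i]; first by rewrite ipSL eqxx.
by rewrite ipSp eqxx eq_sym (negPf (star_neq i)).
Qed.

Lemma ip_ge0 i j : j != star i \/ gt = SL -> 0 <= ipw i j.
Proof.
move: i j; case: gt => i j; first by rewrite ipSL ler0n.
rewrite ipSp => -[|//]; rewrite -(inj_eq (inv_inj (@starK Sp n))) starK eq_sym => /negPf->.
by rewrite subr0 ler0n.
Qed.

Lemma ip_le0 i j : i != j -> ipw i j <= 0.
Proof.
move: i j; case: gt => i j ij; first by rewrite ipSL (negPf ij).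
by rewrite ipSp (negPf ij) sub0r oppr_le0 ler0n.
Qed.

Lemma weight_inj : injective (std_weight gt n).
Proof.
move=> i j e; apply/eqP/negPn/negP => ij.
have := ip_le0 ij; rewrite -[ipw i j]/(wt i (std_weight gt n j)) -e -[wt _ _]/(ipw i i)
  ipii.
by [].
Qed.

End IpTheory.

Section WeightDiff.
Context (gt : group_type) (n : nat).
Implicit Types i j a b l : 'I_(dimG gt n).

(** Pair both sides with the weight of [a]: the left side gives at least 1 unless
    [a = b], and the right side is positive only if [a = l] or [a = star i]. *)
Lemma weight_diff a b l i : l != i ->
  std_weight gt n a - std_weight gt n b = std_weight gt n l - std_weight gt n i ->
  (a = l /\ b = i) \/ (gt = Sp /\ a = star i /\ b = star l).
Proof.
move=> li e; have ea := congr1 (pairing (std_weight gt n a)) e; rewrite !ipBr ipii in ea.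
have [al|al] := eqVneq a l.
  left; split=> //; apply: weight_inj; move: e; rewrite al => /addrI /oppr_inj. by [].
have [ai|ai] := boolP ((a == star i) && (if gt is Sp then true else false)).
  move/andP: ai => [/eqP ai hSp]; right.
  move: hSp ai e {ea al}; case: gt a b l i li => // a b l i li _ ai e; split=> //;
    split=> //.
  apply: weight_inj; apply/rowP => j.
  have wst z : std_weight Sp n (star z) 0 j = - std_weight Sp n z 0 j.
    move: z; apply: lr_case => z; rewrite ?star_l ?star_r /= ?(unsplitK (inl _))
      ?(unsplitK (inr _)) !mxE ?opprK //.
  have /rowP/(_ j) := e; rewrite ai !mxE !wst => e1; apply: oppr_inj; rewrite opprK;
    move: e1; rewrite [LHS]addrC => /addIr ->; by [].
have ab : a = b.
  apply/eqP/negPn/negP => ab; have := ip_le0 ab; have := ip_le0 al.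
  have : 0 <= ipw a i.
    move: a b l i ai {li e ea al ab}; case: gt => a b l i.
      by move=> _; apply: ip_ge0; right.
    rewrite andbT => h; apply: ip_ge0; left.
    by apply: contraNneq h => ->; rewrite starK.
  lia.
move: e; rewrite ab subrr => /esym/eqP; rewrite subr_eq0 => /eqP/weight_inj li'.
by rewrite li' eqxx in li.
Qed.

End WeightDiff.

(** * The groups and their Lie algebras, entry by entry *)

Lemma symplE (A : nzRingType) n (i j : 'I_(dimG Sp n)) :
  sympl_form A n i j = (j == star i)%:R * sg i.
Proof.
move: i j; apply: lr_case => i; apply: lr_case => j; rewrite /sympl_form.
- by rewrite block_mxEul mxE star_l eq_lrshift mul0r.
- by rewrite block_mxEur mxE star_l sg_l mulr1 (inj_eq (@rshift_inj _ _)) eq_sym.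
- by rewrite block_mxEdl !mxE star_r sg_r mulrN1 (inj_eq (@lshift_inj _ _)) eq_sym.
- by rewrite block_mxEdr mxE star_r eq_rlshift mul0r.
Qed.

Lemma mul_sympl_l (A : comNzRingType) n (M : 'M[A]_(dimG Sp n)) (i j : 'I_(dimG Sp n)) :
  (sympl_form A n *m M) i j = sg i * M (star i) j.
Proof.
rewrite mxE (bigD1 (star i)) //= big1 ?addr0; first by rewrite symplE eqxx mul1r.
by move=> l li; rewrite symplE (negPf li) !mul0r.
Qed.

Lemma mul_sympl_r (A : comNzRingType) n (M : 'M[A]_(dimG Sp n)) (i j : 'I_(dimG Sp n)) :
  (M *m sympl_form A n) i j = - (sg j * M i (star j)).
Proof.
rewrite mxE (bigD1 (star j)) //= big1 ?addr0.
  by rewrite symplE starK eqxx mul1r sg_star mulrN mulrC.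
move=> l li; rewrite [sympl_form _ _ _ _](@symplE A n l j).
have [e|_] := eqVneq j (star (l : 'I_(dimG Sp n))); last by rewrite mul0r mulr0.
by move: li; rewrite e -[X in _ != X]/(star (star (l : 'I_(dimG Sp n)))) starK eqxx.
Qed.

Lemma in_lieSpP (A : comNzRingType) n (M : 'M[A]_(dimG Sp n)) :
  in_lie Sp n A M <-> forall i j, M i j = - (sg i * sg j * M (star j) (star i)).
Proof.
have E (i j : 'I_(dimG Sp n)) : (M^T *m sympl_form A n + sympl_form A n *m M) i j =
   - (sg j * M (star j) i) + sg i * M (star i) j.
  by rewrite mxE mul_sympl_l mul_sympl_r mxE.
split=> [h i j|h].
  have := E (star i) j; have -> : M^T *m sympl_form A n + sympl_form A n *m M = 0 by
    exact: h.
  rewrite mxE starK sg_star => /eqP; rewrite eq_sym addr_eq0 => /eqP/oppr_inj e.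
  have : sg i * (sg j * M (star j) (star i)) = sg i * (- sg i * M i j) by rewrite e.
  by rewrite mulNr mulrN !mulrA sg_sq mul1r => ->; rewrite opprK.
rewrite /in_lie; apply/matrixP => i j; rewrite E (h (@star Sp n i) j) starK sg_star mxE.
by rewrite !mulNr opprK !mulrA sg_sq mul1r addNr.
Qed.

Section Group.
Context (gt : group_type) (n : nat) (k : fieldType).
Local Notation d := (dimG gt n).
Local Notation G := (in_group gt n k).
Local Notation g_ := (in_lie gt n k).

Lemma in_group1 : G 1%:M.
Proof.
rewrite /in_group; case: gt; first exact: det1.
by rewrite trmx1 mul1mx mulmx1.
Qed.

Lemma in_group_unit (g : 'M[k]_d) : G g -> g \in unitmx.
Proof.
move: g; rewrite /in_group; case: gt => g; first by rewrite unitmxE => ->; rewrite unitr1.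
move=> h; have JJ : sympl_form k n *m sympl_form k n = - 1%:M.
  by rewrite /sympl_form mulmx_block !mul0mx !mulmx0 !mul1mx !mulmx1 !addr0 !add0r
    scalar_mx_block opp_block_mx oppr0.
have : (- (sympl_form k n *m g^T *m sympl_form k n)) *m g = 1%:M.
  by rewrite mulNmx -!mulmxA [X in _ *m X]mulmxA h JJ opprK.
by case/mulmx1_unit.
Qed.

Lemma in_groupM (g h : 'M[k]_d) : G g -> G h -> G (g *m h).
Proof.
move: g h; rewrite /in_group; case: gt => g h; first by rewrite det_mulmx => -> ->;
  rewrite mulr1.
move=> eg eh; rewrite trmx_mul -!mulmxA (mulmxA g^T) (mulmxA (g^T *m _)) eg.
by rewrite mulmxA eh.
Qed.

Lemma in_groupV (g : 'M[k]_d) : G g -> G (invmx g).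
Proof.
move=> gG; have gu := in_group_unit gG; move: g gG gu; rewrite /in_group; case: gt => g.
  by rewrite det_inv => -> _; rewrite invr1.
move=> eg gu; rewrite -{1}eg trmx_inv -!mulmxA mulmxV // mulmx1 !mulmxA.
by rewrite mulVmx ?unitmx_tr // mul1mx.
Qed.

End Group.

(** Inversion in Sp only permutes the entries up to sign; this is why patterns of
    zeros in elements of Sp are stable under [star]. *)
Lemma invSpE n (k : fieldType) (g : 'M[k]_(dimG Sp n)) : in_group Sp n k g ->
  forall i j, invmx g i j = sg i * sg j * g (star j) (star i).
Proof.
move=> gG i j; have gu := in_group_unit gG.
have e : g^T *m sympl_form k n = sympl_form k n *m invmx g.
  have <- : (g^T *m sympl_form k n *m g) *m invmx g = sympl_form k n *m invmx g.
    by congr (_ *m _); exact: gG.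
  by rewrite mulmxK.
have := congr1 (fun M : 'M[k]_(dimG Sp n) => M (star i) j) e.
rewrite mul_sympl_l mul_sympl_r mxE starK sg_star => h.
have : sg i * (sg j * g (star j) (star i)) = sg i * (sg i * invmx g i j).
  by rewrite -[sg j * _]opprK h mulNr opprK.
by rewrite !mulrA sg_sq mul1r.
Qed.

Section Group2.
Context (gt : group_type) (n : nat) (k : fieldType).
Local Notation d := (dimG gt n).
Local Notation G := (in_group gt n k).
Local Notation g_ := (in_lie gt n k).

Lemma in_lieJ (g M : 'M[k]_d) : G g -> g_ M -> g_ (invmx g *m M *m g).
Proof.
move=> gG; have gu := in_group_unit gG; move: g M gG gu; rewrite /in_group /in_lie;
  case: gt => g M.
  by move=> _ gu; rewrite mxtrace_mulC mulKVmx.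
set J := sympl_form k n => eg gu eM.
have e1 : J *m invmx g = g^T *m J by rewrite -[in LHS]eg mulmxK.
have e2 : (invmx g)^T *m J = J *m g.
  have := congr1 trmx e1; rewrite !trmx_mul trmxK /J /sympl_form tr_block_mx !trmx0 trmx1
    linearN /= trmx1 -/J.
  have -> : block_mx (0 : 'M[k]_n) (- 1%:M) 1%:M (0 : 'M[k]_n) = - J by rewrite /J
    /sympl_form opp_block_mx !oppr0 opprK.
  by rewrite mulmxN mulNmx => /oppr_inj.
by rewrite !trmx_mul -!mulmxA e2 !mulmxA e1 -!mulmxA -mulmxDr (mulmxA M^T) (mulmxA J)
  -mulmxDl eM mul0mx mulmx0.
Qed.

Lemma in_lieJV (g M : 'M[k]_d) : G g -> g_ M -> g_ (g *m M *m invmx g).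
Proof. by move=> gG; have := @in_lieJ (invmx g) M (in_groupV gG); rewrite invmxK. Qed.

Lemma in_lieT (M : 'M[k]_d) : g_ M -> g_ M^T.
Proof.
move: M; case: gt => M; first by rewrite /in_lie mxtrace_tr.
by rewrite !in_lieSpP => h i j; rewrite !mxE (h j i) [sg j * _]mulrC.
Qed.

Lemma in_lieD (M N : 'M[k]_d) : g_ M -> g_ N -> g_ (M + N).
Proof.
move: M N; case: gt => M N; first by rewrite /in_lie mxtraceD => -> ->; rewrite addr0.
by rewrite !in_lieSpP => hM hN i j; rewrite !mxE hM hN mulrDr opprD.
Qed.

Lemma in_lieZ c (M : 'M[k]_d) : g_ M -> g_ (c *: M).
Proof.
move: M; case: gt => M; first by rewrite /in_lie mxtraceZ => ->; rewrite mulr0.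
by rewrite !in_lieSpP => hM i j; rewrite !mxE hM mulrN mulrCA.
Qed.

Lemma in_lie0 : g_ 0.
Proof.
case: gt; first by rewrite /in_lie mxtrace0.
by apply/in_lieSpP => i j; rewrite !mxE mulr0 oppr0.
Qed.

End Group2.

(** * Root vectors and the Moy-Prasad filtration *)

Section RootSpaces.
Context (gt : group_type) (n : nat) (k : fieldType).
Local Notation d := (dimG gt n).
Local Notation w := (std_weight gt n).
Local Notation g_ := (in_lie gt n k).

Lemma root_spaceD phi (M N : 'M[k]_d) :
  root_space phi M -> root_space phi N -> root_space phi (M + N).
Proof.
move=> [gM hM] [gN hN]; split; first exact: in_lieD.
move=> i j; rewrite mxE; have [M0|/hM //] := eqVneq (M i j) 0.
by rewrite M0 add0r => /hN.
Qed.

Lemma root_spaceZ phi c (M : 'M[k]_d) : root_space phi M -> root_space phi (c *: M).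
Proof.
move=> [gM hM]; split; first exact: in_lieZ.
by move=> i j; rewrite mxE mulf_eq0 negb_or => /andP[_ /hM].
Qed.

Lemma root_space_entry0 (l i : 'I_d) (N : 'M[k]_d) : l != i ->
  root_space (w l - w i) N -> N l i = 0 -> N = 0.
Proof.
move=> li [gN hN] N0; apply/matrixP => a b; rewrite mxE; apply/eqP/negPn/negP => Nab.
have [[ea eb]|[e [ea eb]]] := weight_diff li (hN _ _ Nab).
  by move: Nab; rewrite ea eb N0 eqxx.
move: l i N li gN hN N0 a b Nab ea eb; rewrite e => l i N li gN hN N0 a b Nab ea eb.
move: Nab; rewrite ea eb; have /in_lieSpP -> := gN.
by rewrite !starK N0 mulr0 oppr0 eqxx.
Qed.
End RootSpaces.

(** The root vector of [w l - w i], normalised by its entry in position [(l, i)]. *)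
Definition rvec (gt : group_type) (n : nat) (k : fieldType) :
    'I_(dimG gt n) -> 'I_(dimG gt n) -> 'M[k]_(dimG gt n) :=
  match gt return 'I_(dimG gt n) -> 'I_(dimG gt n) -> 'M[k]_(dimG gt n) with
  | SL => fun l i => delta_mx l i
  | Sp => fun l i : 'I_(dimG Sp n) =>
      if i == star l then delta_mx l i
      else delta_mx l i - (sg l * sg i) *: delta_mx (star i) (star l)
  end.

Section RootVectors.
Context (gt : group_type) (n : nat) (k : fieldType).
Local Notation d := (dimG gt n).
Local Notation w := (std_weight gt n).
Local Notation g_ := (in_lie gt n k).

Lemma rvec_id (l i : 'I_d) : @rvec gt n k l i l i = 1.
Proof.
move: l i; case: gt => l i; rewrite /rvec; first by rewrite mxE !eqxx.
have [e|e] := eqVneq i (star l); first by rewrite mxE !eqxx.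
rewrite !mxE !eqxx /= [l == _](_ : _ = false) ?mulr0 ?subr0 //.
by apply: contra_neqF e => /eqP ->; rewrite starK.
Qed.

Lemma rvec_entry (l i a b : 'I_d) :
  [\/ @rvec gt n k l i a b = 0, @rvec gt n k l i a b = 1 | @rvec gt n k l i a b = -1].
Proof.
move: l i a b; case: gt => l i a b; rewrite /rvec.
  by rewrite mxE; case: (_ && _); [apply: Or32|apply: Or31].
have [e|e] := eqVneq i (star l).
  by rewrite mxE; case: (_ && _); [apply: Or32|apply: Or31].
rewrite !mxE.
have [/andP[/eqP ea /eqP eb]|_] := boolP ((a == l) && (b == i)).
  rewrite [_ && _](_ : _ = false) ?mulr0 ?subr0; first by apply: Or32.
  by apply: contra_neqF e => /andP[/eqP ea' _]; rewrite -(starK i) -ea' ea.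
case: (_ && _); rewrite ?mulr0 ?subr0; last by apply: Or31.
rewrite mulr1 sub0r; have [->|->] := @sg_pm Sp n k l; have [->|->] := @sg_pm Sp n k i;
  rewrite ?mulr1 ?mulrN1 ?opprK; by [apply: Or33|apply: Or32].
Qed.

Lemma std_weight_star (i : 'I_(dimG Sp n)) : std_weight Sp n (star i) = - std_weight Sp n i.
Proof.
by move: i; apply: lr_case => z;
  rewrite ?star_l ?star_r /= ?(unsplitK (inl _)) ?(unsplitK (inr _)) ?opprK.
Qed.

Lemma rvec_root_space (l i : 'I_d) : l != i -> root_space (w l - w i) (@rvec gt n k l i).
Proof.
split; last first.
  move=> a b; move: l i H a b; case: gt => l i li a b; rewrite /rvec.
    by rewrite mxE; case: andP => [[/eqP-> /eqP->]|]; rewrite ?eqxx.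
  have [e|e] := eqVneq i (star l).
    by rewrite mxE; case: andP => [[/eqP-> /eqP->]|]; rewrite ?eqxx.
  rewrite !mxE; case: andP => [[/eqP-> /eqP->]//|_].
  case: andP => [[/eqP-> /eqP->]|]; last by rewrite mulr0 subr0 eqxx.
  by move=> _; rewrite !std_weight_star opprK addrC.
move: l i H; case: gt => l i li; rewrite /rvec.
  rewrite /in_lie /mxtrace big1 // => j _; rewrite mxE.
  by case: eqVneq => // ->; rewrite (negPf li).
apply/in_lieSpP => a b.
have S (x y : 'I_(dimG Sp n)) : (star x == y) = (x == star y).
  by apply/eqP/eqP => [<-|->]; rewrite starK.
have [e|e] := eqVneq i (star l).
  rewrite !mxE e !S starK andbC.
  case: andP => [[/eqP-> /eqP->]|_]; last by rewrite mulr0 oppr0.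
  by rewrite sg_star mulr1 mulrN opprK sg_sq.
rewrite !mxE !S !starK ![(b == _) && _]andbC.
case: andP => [[/eqP-> /eqP->]|_].
  rewrite [(l == _)](_ : _ = false) ?mulr0 ?subr0 ?mulr1 ?sub0r ?mulrN ?opprK /=.
    by rewrite mulrACA !sg_sq mulr1.
  by apply: contra_neqF e => /eqP ->; rewrite starK.
case: andP => [[/eqP-> /eqP->]|_]; last by rewrite !mulr0 subr0 mulr0 oppr0.
by rewrite mulr0 subr0 mulr1 sub0r !sg_star mulrNN mulr1 [sg i * _]mulrC.
Qed.

(** Root spaces are lines: a root determines the pair [(l, i)] up to [star], and
    membership in the Lie algebra relates the two corresponding entries. *)
Lemma root_spaceE (l i : 'I_d) (M : 'M[k]_d) : l != i ->
  root_space (w l - w i) M -> M = M l i *: @rvec gt n k l i.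
Proof.
move=> li hM; apply/eqP; rewrite -subr_eq0; apply/eqP.
apply: (root_space_entry0 li); last by rewrite !mxE rvec_id mulr1 subrr.
by rewrite -[- (_ *: _)]scaleN1r; apply: root_spaceD => //; do 2!apply: root_spaceZ;
  exact: rvec_root_space.
Qed.

End RootVectors.

Definition root_map (gt : group_type) (n : nat) (k : fieldType) (l i : 'I_(dimG gt n))
  (c : k^o) : 'M[k]_(dimG gt n) := (c : k) *: @rvec gt n k l i.

Lemma root_map_linear gt n k l i : linear (@root_map gt n k l i).
Proof. by move=> a u v; rewrite /root_map scalerDl scalerA. Qed.

HB.instance Definition _ gt n (k : fieldType) (l i : 'I_(dimG gt n)) :=
  GRing.isLinear.Build k k^o 'M[k]_(dimG gt n) *:%R (@root_map gt n k l i)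
    (@root_map_linear gt n k l i).

Section Filt.
Context (gt : group_type) (n : nat) (k : fieldType) (val : k -> int) (R : realType).
Hypothesis hk : is_local_field val.
Local Notation d := (dimG gt n).
Local Notation w := (std_weight gt n).
Local Notation g_ := (in_lie gt n k).

Lemma vge_rvec (l i a b : 'I_d) (m : int) c : vge val m c ->
  vge val m (c * @rvec gt n k l i a b).
Proof.
move=> /(vgeP _ R) h; apply/(vgeP _ R); have [->|->|->] := rvec_entry k l i a b.
- by rewrite mulr0; left.
- by rewrite mulr1.
- by rewrite mulrN1; apply: vbN.
Qed.

(** All isomorphisms [gam] allowed in the definition differ by units, so only the
    valuations of the entries matter. *)
Lemma affine_root_spaceP psi (u : 'M[k]_d) : Defs.roots gt n psi.1 ->
  affine_root_space val psi u <->
  root_space psi.1 u /\ forall i j, vge val psi.2 (u i j).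
Proof.
case: psi => phi m /= [l [i [li ->]]]; split.
  move=> [gam [_ rg ri] [c hc <-]]; split; first by rewrite -rg; exists c.
  have ig : (root_space (w l - w i) `&` integral_mx val) (gam 1).
    by rewrite -ri; exists 1 => //=; apply/(vgeP _ R); apply: vb1.
  have -> : gam c = c *: gam 1 by rewrite -linearZ /= [_ *: _]mulr1.
  move=> a b; rewrite mxE; apply/(vgeP _ R); rewrite -[_%:~R]addr0.
  have /(vgeP _ R) h0 := ig.2 a b; rewrite mulr0z in h0.
  by apply: vbM h0 => //; apply/(vgeP _ R).
move=> [hu iu]; exists (root_map l i : {linear k^o -> 'M[k]_d}); last first.
  by exists (u l i); [exact: iu | rewrite /= {2}(root_spaceE li hu)].
split.
- move=> c c' /(congr1 (fun M : 'M[k]_d => M l i)).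
  by rewrite /root_map !mxE rvec_id !mulr1.
- apply/seteqP; split=> [M [c _ <-]|M hM].
    by apply: root_spaceZ; apply: rvec_root_space.
  by exists (M l i) => //; rewrite /= {2}(root_spaceE li hM).
- apply/seteqP; split=> [M [c hc <-]|M [hM iM]].
    split; first by apply: root_spaceZ; apply: rvec_root_space.
    by move=> a b; rewrite /root_map mxE; apply: vge_rvec.
  by exists (M l i); [exact: iM | rewrite /= {2}(root_spaceE li hM)].
Qed.

(** A point [x] of the apartment defines the norm on k^d that splits along the
    standard basis and takes the value [wt i x] on the i-th basis vector.  The
    matrices in [filt cl x y r] raise values by at least [r] (by more than [r] when
    [cl] is false) from the norm of [y] to that of [x]. *)
Definition filt (cl : bool) (x y : 'rV[R]_n) (r : R) (M : 'M[k]_d) : Prop :=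
  forall i j, vb val cl (r + wt j y - wt i x) (M i j).

Lemma filtM cl x y z r s (M N : 'M[k]_d) : filt true x y r M -> filt cl y z s N ->
  filt cl x z (r + s) (M *m N).
Proof.
move=> hM hN i j; rewrite mxE; apply: vb_sum => // l _.
have -> : r + s + wt j z - wt i x = (r + wt l y - wt i x) + (s + wt j z - wt l y) by ring.
exact: vbM.
Qed.

Lemma filtMr cl x y z r s (M N : 'M[k]_d) : filt cl x y r M -> filt true y z s N ->
  filt cl x z (r + s) (M *m N).
Proof.
move=> hM hN i j; rewrite mxE; apply: vb_sum => // l _.
have -> : r + s + wt j z - wt i x = (s + wt j z - wt l y) + (r + wt l y - wt i x) by ring.
by rewrite mulrC; apply: vbM.
Qed.

Lemma filtD cl x y r (M N : 'M[k]_d) : filt cl x y r M -> filt cl x y r N ->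
  filt cl x y r (M + N).
Proof. by move=> hM hN i j; rewrite mxE; apply: vbD. Qed.

Lemma filtN cl x y r (M : 'M[k]_d) : filt cl x y r M -> filt cl x y r (- M).
Proof. by move=> hM i j; rewrite mxE; apply: vbN. Qed.

Lemma filt1 x : filt true x x 0 1%:M.
Proof.
move=> i j; rewrite mxE; have [->|_] := eqVneq i j; last by left.
by rewrite add0r subrr; apply: vb1.
Qed.

(** For SL the diagonal is dropped, so the trace becomes 0; for Sp the entries
    related by the symplectic form have equal weight. *)
Lemma weight_part_lie phi (M : 'M[k]_d) : Defs.roots gt n phi -> g_ M ->
  root_space phi (\matrix_(a, b) (if w a - w b == phi then M a b else 0)).
Proof.
move=> [l [i [li ->]]] gM; split; last first.
  by move=> a b; rewrite mxE; case: (eqVneq (w a - w b)) => // _ /eqP.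
move: l i M li gM; case: gt => l i M li gM.
  rewrite /in_lie /mxtrace big1 // => a _; rewrite mxE subrr.
  case: eqP => // /esym/eqP; rewrite subr_eq0 => /eqP/weight_inj e.
  by rewrite e eqxx in li.
apply/in_lieSpP => a b; rewrite !mxE !std_weight_star opprK addrC.
by case: eqP => _; [have /in_lieSpP <- := gM | rewrite mulr0 oppr0].
Qed.

(** Generators satisfy the entrywise bounds.  Conversely, splitting off one root
    component at a time reduces to a diagonal matrix, all of whose characters are
    bounded by the bounds on the entries. *)
Lemma lie_filtP cl x r (M : 'M[k]_d) : lie_filt val cl x r M <-> g_ M /\ filt cl x x r M.
Proof.
split.
  elim=> [|N N' hN _ [gN' fN']]; first by split; [exact: in_lie0|move=> i j;
    rewrite mxE; left].
  suff [gN fN] : g_ N /\ filt cl x x r N by split; [exact: in_lieD|exact: filtD].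
  case: hN => [[gN dN hN]|[psi [ps hpsi] hN]].
    split=> // i j; have [<-|ij] := eqVneq i j; last by left; apply/(is_diag_mxP dN).
    have := hN (delta_mx 0 i); rewrite (bigD1 i) //= big1 ?addr0; last first.
      by move=> b bi; rewrite mxE (negPf bi) andbF mulr0z.
    by rewrite mxE !eqxx mulr1z addrK; case: (cl).
  have /affine_root_spaceP[//|[gN wN] vN] := hN.
  split=> // i j; have [->|Nij] := eqVneq (N i j) 0; first by left.
  have /(vgeP _ R)[e|/= h] := vN i j; first by rewrite e eqxx in Nij.
  right; move: hpsi; rewrite /aff_eval -(wN _ _ Nij) pairingBl -/(wt _ _) -/(wt _ _).
  by case: (cl) => /= hp; lra.
move=> [gM fM].
have [m] := ubnP #|[pred p : 'I_d * 'I_d | (p.1 != p.2) && (M p.1 p.2 != 0)]|.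
elim: m M gM fM => // m IH M gM fM hm.
(* Induction on the number of nonzero entries off the diagonal. *)
have [[l i] /andP[/= li Mli]|h0] := pickP (fun p : 'I_d * 'I_d =>
  (p.1 != p.2) && (M p.1 p.2 != 0)); last first.
  rewrite -[M]addr0; apply: add_closureD; last exact: add_closure0.
  left; split=> //.
    apply/is_diag_mxP => i j ij; apply/eqP/negPn/negP => Mij.
    by have := h0 (i, j); rewrite /= Mij andbT; move: ij; rewrite -(inj_eq val_inj) => ->.
  move=> chi /=.
  have H : vb val cl r (\sum_i M i i *~ chi 0 i).
    apply: vb_sum => // i _; rewrite -mulrzr -[r]add0r mulrC; apply: vbM => //;
      first exact: vb_int.
    by have := fM i i; rewrite addrK.
  by case: (cl) H.
set phi := w l - w i.
have rphi : Defs.roots gt n phi by exists l, i.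
pose N := \matrix_(a, b) (if w a - w b == phi then M a b else 0).
have rN : root_space phi N by apply: weight_part_lie.
have -> : M = N + (M - N) by rewrite addrC subrK.
apply: add_closureD.
  right; exists (phi, val (M l i)).
    split=> //; have := fM l i; rewrite vb_neq0 // /aff_eval /= /phi pairingBl -/(wt _ _)
      -/(wt _ _).
    by case: (cl) => /=; lra.
  apply/affine_root_spaceP => //; split=> // a b.
  rewrite (root_spaceE li rN) mxE; apply: vge_rvec; rewrite mxE eqxx; right;
    rewrite intz. by [].
apply: IH.
- by apply: in_lieD => //; rewrite -scaleN1r; apply: in_lieZ; case: rN.
- move=> a b; rewrite !mxE; case: eqP => _; last by rewrite subr0.
  by rewrite subrr; left.
- rewrite ltnS in hm; apply: leq_trans hm; apply: proper_card; apply/properP; split.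
    apply/fintype.subsetP => -[a b]; rewrite !inE /= !mxE => /andP[->] /=.
    by case: (w a - w b == phi); rewrite ?subrr ?eqxx ?subr0.
  exists (l, i); rewrite !inE /= ?li ?Mli // !mxE eqxx subrr eqxx.
  by rewrite andbF.
Qed.

End Filt.

(** * Parahoric subgroups and Gaussian elimination *)

Lemma invmx_mul (k : fieldType) m (A B : 'M[k]_m) : A \in unitmx -> B \in unitmx ->
  invmx (A *m B) = invmx B *m invmx A.
Proof.
move=> uA uB; have uAB : A *m B \in unitmx by rewrite unitmx_mul uA.
apply: (can_inj (mulKmx uAB)); rewrite mulmxV // -mulmxA (mulmxA B) mulmxV //.
by rewrite mul1mx mulmxV.
Qed.

Lemma star_neqSp (gt : group_type) (n : nat) (i : 'I_(dimG gt n)) : gt = Sp -> star i != i.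
Proof. by move: i; case: gt => i // _; exact: star_neq. Qed.

Lemma rvec_supp (gt : group_type) (n : nat) (k : fieldType) (l i a b : 'I_(dimG gt n)) :
  l != i -> @rvec gt n k l i a b != 0 ->
    (a = l /\ b = i) \/ (gt = Sp /\ a = star i /\ b = star l).
Proof. by move=> li h; apply: (weight_diff li);
  have [_] := @rvec_root_space gt n k l i li; apply. Qed.

Section Trivial.
Context (k : fieldType) (d : nat).

Definition trivial_at (p : 'M[k]_d) a :=
  (forall b, p a b = (a == b)%:R) /\ (forall b, p b a = (b == a)%:R).

Lemma trivial_atM p q a : trivial_at p a -> trivial_at q a -> trivial_at (p *m q) a.
Proof.
move=> [pr pc] [qr qc]; split=> b; rewrite mxE (bigD1 a) //= big1 ?addr0.
- by rewrite pr eqxx mul1r.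
- by move=> c ca; rewrite pr eq_sym (negPf ca) mul0r.
- by rewrite qc eqxx mulr1.
- by move=> c ca; rewrite qc (negPf ca) mulr0.
Qed.

Lemma trivial_at1 a : trivial_at 1%:M a.
Proof. by split=> b; rewrite mxE. Qed.

Lemma trivial_atT (p : 'M[k]_d) a : trivial_at p a -> trivial_at p^T a.
Proof. by move=> [h1 h2]; split=> b; rewrite mxE ?h1 ?h2 eq_sym. Qed.

End Trivial.

(** Expansion along the i-th row, which is that of the identity. *)
Lemma det_transvection (A : comNzRingType) m (l i : 'I_m) (c : A) : l != i ->
  \det (1%:M + c *: delta_mx l i) = 1.
Proof.
move=> li; rewrite (expand_det_row _ i) (bigD1 i) //= big1 ?addr0.
  rewrite !mxE eqxx [i == l]eq_sym (negPf li) mulr0 addr0 mul1r /cofactor addnn -mul2n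
    exprM sqrrN !expr1n mul1r.
  rewrite (_ : row' i (col' i _) = 1%:M) ?det1 //; apply/matrixP => a b.
  by rewrite !mxE [lift i b == i]eq_sym (negPf (neq_lift _ _)) andbF mulr0 addr0
    (inj_eq lift_inj).
by move=> j ji; rewrite !mxE [i == l]eq_sym (negPf li) mulr0 addr0 eq_sym (negPf ji) mul0r.
Qed.

Section Parahoric.
Context (gt : group_type) (n : nat) (k : fieldType) (val : k -> int) (R : realType).
Hypothesis hk : is_local_field val.
Local Notation d := (dimG gt n).
Local Notation w := (std_weight gt n).
Local Notation G := (in_group gt n k).
Local Notation g_ := (in_lie gt n k).
Local Notation para := (@parahoric gt n k val R).
Local Notation filt := (@filt gt n k val R).

(** The elements [u] for which [1 + u] lies in a root group contained in U_x, with
    the condition on the affine root expressed by the norm of [x]. *)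
Definition root_elt (x : 'rV[R]_n) (u : 'M[k]_d) : Prop :=
  exists phi, [/\ Defs.roots gt n phi, root_space phi u & filt true x x 0 u].

Lemma affine_root_elt x psi u : affine_roots gt n psi -> 0 <= aff_eval psi x ->
  affine_root_space val psi u -> root_elt x u.
Proof.
move=> hpsi h0 /(affine_root_spaceP R hk _ hpsi) [ru iu]; exists psi.1; split=> // i j.
have [->|uij] := eqVneq (u i j) 0; first by left.
have /(vgeP _ R)[e|/= h] := iu i j; first by rewrite e eqxx in uij.
right; move: h0; have [_ /(_ _ _ uij) e] := ru.
by rewrite /aff_eval -e pairingBl -/(wt _ _) -/(wt _ _) /=; lra.
Qed.

Lemma root_eltP x u : root_elt x u -> u = 0 \/
  exists2 psi, affine_roots gt n psi /\ 0 <= aff_eval psi x & affine_root_space val psi u.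
Proof.
move=> [_ [[l [i [li ->]]] ru fu]]; have ue := root_spaceE li ru.
have [u0|u0] := eqVneq (u l i) 0; first by left; rewrite ue u0 scale0r.
right; exists (w l - w i, val (u l i)); last first.
  apply/(affine_root_spaceP R hk); first by exists l, i.
  split=> // a b; rewrite (_ : u a b = u l i * rvec k l i a b); last by rewrite {1}ue mxE.
  by apply: (vge_rvec R hk); right; rewrite intz.
split; first by exists l, i.
have := fu l i; rewrite vb_neq0 // /aff_eval /= pairingBl -/(wt _ _) -/(wt _ _); lra.
Qed.

Lemma root_elt_sq x u : root_elt x u -> u *m u = 0.
Proof.
move=> [phi [[l [i [li ->]]] [_ hu] _]]; apply/matrixP => a b; rewrite !mxE.
apply: big1 => c _; apply/eqP/negPn/negP; rewrite mulf_eq0 negb_or => /andP[uac ucb].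
have ac : a != c.
  apply: contraNneq li => e; have := hu _ _ uac; rewrite e subrr => /esym/eqP.
  by rewrite subr_eq0 => /eqP/weight_inj ->.
have e : w c - w b = w a - w c by rewrite (hu _ _ uac) (hu _ _ ucb).
have [[ca _]|[e1 [e2 _]]] := weight_diff ac e; first by rewrite ca eqxx in ac.
by have := star_neqSp c e1; rewrite -e2 eqxx.
Qed.

Lemma root_eltN x u : root_elt x u -> root_elt x (- u).
Proof.
move=> [phi [h1 h2 h3]]; exists phi; split=> //; last exact: filtN.
by rewrite -scaleN1r; apply: root_spaceZ.
Qed.

Lemma root_elt_group x u : root_elt x u -> G (1%:M + u).
Proof.
move=> hu; have u2 := root_elt_sq hu; case: hu => phi [[l [i [li ->]]] ru _].
have ue := root_spaceE li ru; have [lu _] := ru.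
move: l i li u u2 ru ue lu; rewrite /in_group; case: gt => l i li u u2 ru ue lu.
  by rewrite ue /rvec; apply: det_transvection.
have -> : (1%:M + u)^T = 1%:M + u^T by rewrite linearD /= trmx1.
rewrite mulmxDl mulmxDr mulmx1 mul1mx.
have e : u^T *m sympl_form k n = - (sympl_form k n *m u) by apply/eqP;
  rewrite -addr_eq0; apply/eqP; exact: lu.
by rewrite e mulmxBl -mulmxA u2 mulmx0 subr0 subrK.
Qed.

Lemma para_ind x (P : 'M[k]_d -> Prop) : P 1%:M ->
  (forall u v, root_elt x u -> para x v -> P v -> P ((1%:M + u) *m v)) ->
  forall v, para x v -> P v.
Proof.
move=> h1 hM v; elim=> // psi u v' h0 h2 h3 h4 h5.
by apply: hM => //; exact: affine_root_elt h2 h3.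
Qed.

Lemma para_cons x u v : root_elt x u -> para x v -> para x ((1%:M + u) *m v).
Proof.
move=> /root_eltP[->|[psi [h1 h2] h3]] hv; first by rewrite addr0 mul1mx.
exact: parahoricM h1 h2 h3 hv.
Qed.

Lemma para_root x u : root_elt x u -> para x (1%:M + u).
Proof. by move=> hu; rewrite -[1%:M + u]mulmx1; apply: para_cons => //; constructor. Qed.

Lemma paraM x u v : para x u -> para x v -> para x (u *m v).
Proof.
move=> hu hv; elim/para_ind: u / hu => [|u u' hu _ IH]; first by rewrite mul1mx.
by rewrite -mulmxA; apply: para_cons.
Qed.

Lemma para_group x v : para x v -> G v.
Proof.
elim/para_ind => [|u v' /root_elt_group hu _ hv]; first exact: in_group1.
exact: in_groupM.
Qed.

Lemma para_filt x v : para x v -> filt true x x 0 v.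
Proof.
elim/para_ind => [|u v' [phi [_ _ hu]] _ hv]; first exact: filt1.
rewrite -[0]addr0; apply: filtM hv => //; apply: filtD => //; exact: filt1.
Qed.

Lemma paraV x v : para x v -> para x (invmx v).
Proof.
elim/para_ind => [|u v' hu pv' hv]; first by rewrite invmx1; constructor.
have u1 : 1%:M + u \in unitmx := in_group_unit (root_elt_group hu).
have v1 : v' \in unitmx := in_group_unit (para_group pv').
rewrite invmx_mul //; apply: paraM => //.
rewrite (_ : invmx (1%:M + u) = 1%:M - u); first by apply: para_root; apply: root_eltN.
apply: (can_inj (mulKmx u1)); rewrite mulmxV // mulmxDl mul1mx mulmxBr mulmx1
  (root_elt_sq hu).
by rewrite subr0 subrK.
Qed.

Lemma paraT x v : para x v -> para (- x) v^T.
Proof.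
elim/para_ind => [|u v' [phi [rphi ru fu]] _ hv]; first by rewrite trmx1; constructor.
rewrite trmx_mul linearD /= trmx1; apply: paraM => //; apply: para_root.
exists (- phi); split.
- by case: rphi => l [i [li ->]]; exists i, l; rewrite eq_sym opprB.
- case: ru => lu hu; split; first exact: in_lieT.
  by move=> a b; rewrite mxE => /hu <-; rewrite opprB.
- move=> a b; rewrite mxE !wtN; have := fu b a.
  by congr (vb _ _ _); ring.
Qed.

Lemma para_rvec x l i t : l != i -> vb val true (wt i x - wt l x) t ->
  para x (1%:M + t *: @rvec gt n k l i).
Proof.
move=> li ht; apply: para_root; exists (w l - w i); split; first by exists l, i.
  by apply: root_spaceZ; exact: rvec_root_space.
move=> a b; rewrite mxE.
have [->|nz] := eqVneq (@rvec gt n k l i a b) 0; first by rewrite mulr0; left.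
have [_ /(_ _ _ nz) /(congr1 (fun v => pairing v x))] := rvec_root_space k li.
rewrite !pairingBl -!/(wt _ _) => e.
have {}ht : vb val true (0 + wt b x - wt a x) t by apply: vbW ht => /=; lra.
by have [->|->|->] := rvec_entry k l i a b; rewrite ?mulr0 ?mulr1 ?mulrN1;
  [left| |exact: vbN].
Qed.

(** The norm of the vector [v] at [x] is at least [c]. *)
Definition col_bounded (c : R) (x : 'rV[R]_n) (v : 'cV[k]_d) : Prop :=
  forall l, vb val true (c - wt l x) (v l 0).

Lemma col_boundedM c x p v : filt true x x 0 p -> col_bounded c x v ->
  col_bounded c x (p *m v).
Proof.
move=> hp hv a; rewrite mxE; apply: vb_sum => // b _.
have -> : c - wt a x = (0 + wt b x - wt a x) + (c - wt b x) by ring.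
exact: vbM.
Qed.

Lemma trivial_at_elt l i t a : l != i -> a != l -> a != i -> a != star l -> a != star i ->
  trivial_at (1%:M + t *: @rvec gt n k l i) a.
Proof.
move=> li al ai asl asi; split=> b; rewrite !mxE.
  have [->|nz] := eqVneq (@rvec gt n k l i a b) 0; first by rewrite mulr0 addr0.
  by have [[e _]|[_ [e _]]] := rvec_supp li nz; rewrite e eqxx in al asi.
have [->|nz] := eqVneq (@rvec gt n k l i b a) 0; first by rewrite mulr0 addr0.
by have [[_ e]|[_ [_ e]]] := rvec_supp li nz; rewrite e eqxx in ai asl.
Qed.

Lemma elt_col l i t (v : 'cV[k]_d) a : l != i ->
  ((1%:M + t *: @rvec gt n k l i) *m v) a 0 = v a 0 + t * \sum_b @rvec gt n k l i a b * v
    b 0.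
Proof. by move=> li; rewrite mulmxDl mul1mx -scalemxAl !mxE. Qed.

(** Gaussian elimination inside U_x.  If the entry [v i] realises the norm of [v] at
    [x], each multiplier needed to clear another entry belongs to a root group of
    U_x.  For Sp, clearing entry [l] by a short root also changes entry [star i], so
    that entry is cleared last, by a long root.  The two final properties say that
    nothing outside the support of [v] is disturbed, so eliminations can be chained. *)
Lemma col_clear x (v : 'cV[k]_d) i : v i 0 != 0 ->
  col_bounded ((val (v i 0))%:~R + wt i x) x v ->
  exists p, [/\ para x p, p *m v = v i 0 *: delta_mx i 0,
    forall b, p i b = (i == b)%:R &
    forall a, v a 0 = 0 -> v (star a) 0 = 0 -> a != i -> a != star i -> trivial_at p a].
Proof.
have [m] := ubnP #|[pred l : 'I_d | [&& l != i, l != star i & v l 0 != 0]]|.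
elim: m v => // m IH v hm vi0 hv.
have tb l : vb val true (wt i x - wt l x) (- (v l 0 / v i 0)).
  apply: vbN => //; have -> : wt i x - wt l x = ((val (v i 0))%:~R + wt i x - wt l x) + -
    (val (v i 0))%:~R by ring.
  by apply: vbM; [exact: hk|exact: hv|right; rewrite (valV hk) //= intrN].
have [l /and3P[li lsi vl]|h0] := pickP (fun l : 'I_d => [&& l != i,
  l != star i & v l 0 != 0]).
  pose t := - (v l 0 / v i 0); pose e := 1%:M + t *: @rvec gt n k l i.
  have pe : para x e by apply: para_rvec.
  have ea a : a != l -> (gt = Sp -> a != star i) -> (e *m v) a 0 = v a 0.
    move=> al asi; rewrite elt_col // big1 ?mulr0 ?addr0 // => b _.
    have [->|nz] := eqVneq (@rvec gt n k l i a b) 0; first by rewrite mul0r.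
    have [[e1 _]|[e0 [e1 _]]] := rvec_supp li nz; first by rewrite e1 eqxx in al.
    by have := asi e0; rewrite e1 eqxx.
  have ei : (e *m v) i 0 = v i 0.
    by apply: ea; [rewrite eq_sym | move=> h; rewrite eq_sym; exact: star_neqSp].
  have el : (e *m v) l 0 = 0.
    rewrite elt_col // (bigD1 i) //= big1 => [|b bi].
      by rewrite rvec_id mul1r addr0 /t mulNr mulfVK // subrr.
    have [->|nz] := eqVneq (@rvec gt n k l i l b) 0; first by rewrite mul0r.
    have [[_ e1]|[_ [e1 _]]] := rvec_supp li nz; first by rewrite e1 eqxx in bi.
    by rewrite e1 eqxx in lsi.
  have [|||p [pp pv pi pt]] := IH (e *m v).
  - rewrite ltnS in hm; apply: leq_trans hm; apply: proper_card; apply/properP; split.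
      apply/fintype.subsetP => a; rewrite !inE => /and3P[ai asi].
      rewrite ai asi /=; have [->|al] := eqVneq a l; first by rewrite el eqxx.
      by rewrite ea.
    by exists l; rewrite inE ?li ?lsi ?vl // el eqxx.
  - by rewrite ei.
  - by rewrite ei; apply: col_boundedM => //; exact: para_filt.
  exists (p *m e); split.
  - exact: paraM.
  - by rewrite -mulmxA pv ei.
  - move=> b; rewrite mxE (bigD1 i) //= big1 ?addr0 => [|c ci]; last first.
      by rewrite pi eq_sym (negPf ci) mul0r.
    rewrite pi eqxx mul1r !mxE.
    have [->|nz] := eqVneq (@rvec gt n k l i i b) 0; first by rewrite mulr0 addr0.
    have [[e1 _]|[e0 [e1 _]]] := rvec_supp li nz; first by rewrite e1 eqxx in li.
    by have := star_neqSp i e0; rewrite -e1 eqxx.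
  - move=> a va vsa ai asi.
    have al : a != l by apply: contraNneq vl => <-; rewrite va.
    have asl : star a != l by apply: contraNneq vl => <-; rewrite vsa.
    have asl' : a != star l by apply: contraNneq asl => ->; rewrite starK.
    apply: trivial_atM; last exact: trivial_at_elt.
    apply: pt => //; first by rewrite ea.
    by rewrite ea // => _; rewrite (inj_eq (inv_inj (@starK gt n))).
have v0 l : l != i -> l != star i -> v l 0 = 0.
  by move=> li lsi; apply/eqP; have := h0 l; rewrite li lsi /= => /negbFE.
have [si|si] := eqVneq (star i) i.
  exists 1%:M; split.
  - constructor.
  - rewrite mul1mx; apply/colP => l; rewrite !mxE eqxx andbT.
    by case: eqVneq => [->|li]; rewrite ?mulr1 // mulr0 v0 // si.
  - by move=> b; rewrite mxE.
  - by move=> *; exact: trivial_at1.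
pose t := - (v (star i) 0 / v i 0).
have supp a b : @rvec gt n k (star i) i a b != 0 -> a = star i /\ b = i.
  by move=> /(rvec_supp si) [//|[_ [-> ->]]]; rewrite starK.
exists (1%:M + t *: @rvec gt n k (star i) i); split.
- exact: para_rvec.
- apply/colP => l; rewrite elt_col // !mxE eqxx andbT.
  have [->|li] := eqVneq l i.
    rewrite mulr1 big1 ?mulr0 ?addr0 // => b _.
    have [->|/supp[e _]] := eqVneq (@rvec gt n k (star i) i i b) 0; first by rewrite mul0r.
    by rewrite -e eqxx in si.
  have [->|lsi] := eqVneq l (star i).
    rewrite mulr0 (bigD1 i) //= rvec_id mul1r big1 ?addr0;
      first by rewrite /t mulNr mulfVK // subrr.
    move=> b bi; have [->|/supp[_ e]] := eqVneq (@rvec gt n k (star i) i (star i) b) 0;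
      first by rewrite mul0r.
    by rewrite e eqxx in bi.
  rewrite v0 // add0r mulr0 big1 ?mulr0 // => b _.
  have [->|/supp[e _]] := eqVneq (@rvec gt n k (star i) i l b) 0; first by rewrite mul0r.
  by rewrite e eqxx in lsi.
- move=> b; rewrite !mxE.
  have [->|/supp[e _]] := eqVneq (@rvec gt n k (star i) i i b) 0;
    first by rewrite mulr0 addr0.
  by rewrite -e eqxx in si.
- by move=> a _ _ ai asi; apply: trivial_at_elt; rewrite ?starK.
Qed.

(** Transposition exchanges U_x and U_(-x). *)
Lemma row_clear (x : 'rV[R]_n) (f : 'rV[k]_d) i : f 0 i != 0 ->
  (forall l, vb val true ((val (f 0 i))%:~R - wt i x + wt l x) (f 0 l)) ->
  exists q, [/\ para x q, f *m q = f 0 i *: delta_mx 0 i,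
    forall b, q b i = (b == i)%:R &
    forall a, f 0 a = 0 -> f 0 (star a) = 0 -> a != i -> a != star i -> trivial_at q a].
Proof.
move=> fi hf.
have h1 : f^T i 0 != 0 by rewrite mxE.
have h2 : col_bounded ((val (f^T i 0))%:~R + wt i (- x)) (- x) f^T.
  by move=> l; rewrite !mxE !wtN opprK; exact: hf.
have [p [pp pv pi pt]] := col_clear h1 h2; rewrite mxE in pv.
exists p^T; split.
- by have := paraT pp; rewrite opprK.
- by have := congr1 trmx pv; rewrite trmx_mul trmxK linearZ /= trmx_delta.
- by move=> b; rewrite mxE pi eq_sym.
- by move=> a fa fsa ai asi; apply: trivial_atT; apply: pt; rewrite ?mxE.
Qed.

End Parahoric.

(** * Bruhat decomposition and points of the building as norms *)

Lemma std_weight_starE (gt : group_type) n (i : 'I_(dimG gt n)) : gt = Sp ->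
  std_weight gt n (star i) = - std_weight gt n i.
Proof. by move: i; case: gt => i // _; exact: std_weight_star. Qed.

Lemma mulmx_neq0 (A : pzRingType) m n p (M : 'M[A]_(m, n)) (N : 'M[A]_(n, p)) i j :
  (M *m N) i j != 0 -> exists l, M i l != 0 /\ N l j != 0.
Proof.
rewrite mxE => h; have [l hl|h0] := pickP (fun l => M i l * N l j != 0).
  by exists l; split; apply: contraNneq hl => ->; rewrite ?mul0r ?mulr0.
by move: h; rewrite big1 ?eqxx // => l _; apply/eqP/negPn; rewrite h0.
Qed.

Lemma mono_inv (k : fieldType) (d : nat) (m : 'M[k]_d) (s : 'S_d) : (forall i j,
  (m i j != 0) = (i == s j)) ->
  m \in unitmx -> forall i j, invmx m j i = if i == s j then (m i j)^-1 else 0.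
Proof.
move=> hs mu.
have e : (\matrix_(j, i) if i == s j then (m i j)^-1 else 0) *m m = 1%:M.
  apply/matrixP => a b; rewrite mxE (bigD1 (s a)) //= big1 ?addr0; last first.
    by move=> i ia; rewrite mxE (negPf ia) mul0r.
  rewrite !mxE eqxx; have [<-|ab] := eqVneq a b; first by rewrite mulVf // hs.
  have := hs (s a) b; rewrite (inj_eq perm_inj) (negPf ab) => /negbFE/eqP ->.
  by rewrite mulr0.
move=> i j; have <- : (\matrix_(j, i) if i == s j then (m i j)^-1 else 0) = invmx m.
  by rewrite -[LHS](mulmxK mu) e mul1mx.
by rewrite mxE.
Qed.

Section Iso.
Context (k : fieldType) (d : nat).

Definition isolated_entry (u : 'M[k]_d) (i j : 'I_d) : Prop :=
  [/\ u i j != 0, forall a, a != i -> u a j = 0 & forall b, b != j -> u i b = 0].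

Lemma isolated_mull p u i j : trivial_at p i -> isolated_entry u i j ->
  isolated_entry (p *m u) i j.
Proof.
move=> [pr pc] [h1 h2 h3].
have er b : (p *m u) i b = u i b.
  rewrite mxE (bigD1 i) //= big1 ?addr0; first by rewrite pr eqxx mul1r.
  by move=> c ci; rewrite pr eq_sym (negPf ci) mul0r.
split; [by rewrite er| |by move=> b bj; rewrite er h3].
move=> a ai; rewrite mxE (bigD1 i) //= big1 ?addr0; first by rewrite pc (negPf ai) mul0r.
by move=> c ci; rewrite h2 ?mulr0.
Qed.

Lemma isolated_mulr p u i j : trivial_at p j -> isolated_entry u i j ->
  isolated_entry (u *m p) i j.
Proof.
move=> [pr pc] [h1 h2 h3].
have er b : (u *m p) b j = u b j.
  rewrite mxE (bigD1 j) //= big1 ?addr0; first by rewrite pc eqxx mulr1.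
  by move=> c ci; rewrite pc (negPf ci) mulr0.
split; [by rewrite er|by move=> b bj; rewrite er h2|].
move=> a ai; rewrite mxE (bigD1 j) //= big1 ?addr0;
  first by rewrite pr eq_sym (negPf ai) mulr0.
by move=> c ci; rewrite h3 ?mul0r.
Qed.

Lemma isolated_inv u i j : u \in unitmx -> isolated_entry u i j ->
  isolated_entry (invmx u) j i.
Proof.
move=> uu [h1 h2 h3].
have er b : invmx u j b = (u i j)^-1 * (i == b)%:R.
  have := congr1 (fun M : 'M[k]_d => M i b) (mulmxV uu).
  rewrite !mxE (bigD1 j) //= big1 ?addr0; last by move=> c cj; rewrite h3 ?mul0r.
  by move=> <-; rewrite mulKf.
have ec a : invmx u a i = (u i j)^-1 * (a == j)%:R.
  have := congr1 (fun M : 'M[k]_d => M a j) (mulVmx uu).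
  rewrite !mxE (bigD1 i) //= big1 ?addr0; last by move=> c cj; rewrite h2 ?mulr0.
  by move=> <-; rewrite mulrCA mulVf ?mulr1.
split=> [|a aj|b bi]; first by rewrite er eqxx mulr1 invr_eq0.
  by rewrite ec (negPf aj) mulr0.
by rewrite er eq_sym (negPf bi) mulr0.
Qed.

End Iso.

Section Monomial.
Context (gt : group_type) (n : nat) (k : fieldType) (val : k -> int) (R : realType).
Hypothesis hk : is_local_field val.
Local Notation d := (dimG gt n).
Local Notation w := (std_weight gt n).
Local Notation G := (in_group gt n k).
Local Notation g_ := (in_lie gt n k).
Local Notation para := (@parahoric gt n k val R).
Local Notation filt := (@filt gt n k val R).
Local Notation Nm := (@torus_normaliser gt n k).
Local Notation nu := (@nu_act gt n k val R).

Lemma mono_invE m : Nm m -> forall i j, m i j != 0 -> invmx m j i = (m i j)^-1.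
Proof.
move=> [mG [s hs]] i j hij; rewrite (mono_inv hs (in_group_unit mG)).
by rewrite -hs hij.
Qed.

Lemma NmV m : Nm m -> Nm (invmx m).
Proof.
move=> [mG [s hs]]; split; first exact: in_groupV.
exists (s^-1)%g => i j; rewrite (mono_inv hs (in_group_unit mG)).
rewrite -[RHS](inj_eq (@perm_inj _ s)) permKV [s i == j]eq_sym;
  case: (j =P s i) => [->|_]; rewrite ?eqxx //.
by rewrite invr_eq0 hs eqxx.
Qed.

Lemma nuV m x y : Nm m -> nu m x y -> nu (invmx m) y x.
Proof.
move=> hm hnu i j; have [mG [s hs]] := hm.
rewrite (mono_inv hs (in_group_unit mG)); case: (j =P s i) => [e|]; last by rewrite eqxx.
have mji : m j i != 0 by rewrite hs e.
by move=> _; rewrite valV // -!/(wt _ _) /wt (hnu _ _ mji) intrN opprK subrK.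
Qed.

(** Multiplication by [u] carries the norm of [y] to the norm of [x]. *)
Definition norm_iso (x y : 'rV[R]_n) (u : 'M[k]_d) : Prop :=
  filt true x y 0 u /\ filt true y x 0 (invmx u).

Lemma norm_iso_refl x : norm_iso x x 1%:M.
Proof. by split; rewrite ?invmx1; exact: filt1. Qed.

Lemma norm_iso_sym x y u : norm_iso x y u -> norm_iso y x (invmx u).
Proof. by move=> [h1 h2]; split; rewrite ?invmxK. Qed.

Lemma norm_iso_trans x y z u v : u \in unitmx -> v \in unitmx ->
  norm_iso x y u -> norm_iso y z v -> norm_iso x z (u *m v).
Proof.
move=> uu uv [h1 h2] [h3 h4]; split; rewrite ?invmx_mul // -[0]addr0; exact: filtM.
Qed.

Lemma para_norm_iso x p : para x p -> norm_iso x x p.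
Proof. by move=> hp; split; apply: para_filt => //; apply: paraV. Qed.

Lemma nu_norm_iso m x y : Nm m -> nu m x y <-> norm_iso y x m.
Proof.
move=> hm; split=> [h|[h1 h2] i j mij].
  have E m' x' y' : nu m' x' y' -> filt true y' x' 0 m'.
    move=> h' i j; have [->|mij] := eqVneq (m' i j) 0; first by left.
    by right; have := h' i j mij; rewrite -!/(wt _ _) => -> /=; lra.
  by split; apply: E => //; exact: nuV.
have := h1 i j; have := h2 j i; rewrite (mono_invE hm mij) !vb_neq0 ?invr_eq0 // valV //.
by rewrite -!/(wt _ _) intrN /=; lra.
Qed.

(** Compare the nonzero entries of the matrix and of its inverse. *)
Lemma mono_star m (s : 'S_d) : G m -> (forall i j, (m i j != 0) = (i == s j)) ->
  forall j, s (star j) = star (s j).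
Proof.
move: m s; case: gt => // m s mG hs j.
have mu := in_group_unit mG.
have sj : m (s j) j != 0 by rewrite hs.
have : invmx m j (s j) != 0 by rewrite (mono_inv hs mu) eqxx invr_eq0.
by rewrite (invSpE mG) !mulf_eq0 !negb_or => /andP[_]; rewrite hs => /eqP.
Qed.

Lemma root_elt_conj m x y u : Nm m -> nu m y x -> root_elt val y u ->
  root_elt val x (m *m u *m invmx m).
Proof.
move=> hm hnu [phi [[l [i [li ->]]] [lu hu] fu]]; have [mG [s hs]] := hm.
have [n1 n2] := (nu_norm_iso _ _ hm).1 hnu.
exists (w (s l) - w (s i)); split.
- by exists (s l), (s i); rewrite (inj_eq perm_inj).
- split; first exact: in_lieJV.
  move=> a b /mulmx_neq0[f [/mulmx_neq0[e [h1 h2]] h3]].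
  move: h1; rewrite hs => /eqP ->.
  move: h3; rewrite (mono_inv hs (in_group_unit mG)); case: (b =P s f) => [->|];
    last by rewrite eqxx.
  move=> _; have [[-> ->]//|[e0 [-> ->]]] := weight_diff li (hu _ _ h2).
  by rewrite !(mono_star mG hs) !(std_weight_starE _ e0) opprK addrC.
- rewrite -[0]addr0; apply: filtM n2 => //; rewrite -[0]addr0; exact: filtM fu.
Qed.

Lemma para_conj m x y q : Nm m -> nu m y x -> para y q -> para x (m *m q *m invmx m).
Proof.
move=> hm hnu; have mu := in_group_unit hm.1.
elim/(@para_ind gt n k val R hk) => [|u v hu _ hv]; first by rewrite mulmx1 mulmxV //;
  constructor.
have -> : m *m ((1%:M + u) *m v) *m invmx m = (1%:M + m *m u *m invmx m) *m
  (m *m v *m invmx m).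
  by rewrite !mulmxA mulmxDl mul1mx mulmxDr mulmx1 mulmxDl [in RHS]mulmxDl mulmxKV //
    !mulmxA mulmxDl.
exact: para_cons (root_elt_conj hm hnu hu) hv.
Qed.

End Monomial.

Section Bruhat.
Context (gt : group_type) (n : nat) (k : fieldType) (val : k -> int) (R : realType).
Hypothesis hk : is_local_field val.
Local Notation d := (dimG gt n).
Local Notation G := (in_group gt n k).
Local Notation para := (@parahoric gt n k val R).
Local Notation Nm := (@torus_normaliser gt n k).

(** The inverse of [u] has an isolated entry at [(j, i)], and for Sp its entries are
    those of [u] moved by [star]. *)
Lemma isolated_star u i j : G u -> isolated_entry u i j ->
  isolated_entry u (star i) (star j).
Proof.
move: u i j; rewrite /isolated_entry; case: gt => // u i j uG h.
have [h1 h2 h3] := isolated_inv (in_group_unit uG) h.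
have e a b : u a b = sg (star b) * sg (star a) * invmx u (star b) (star a).
  by rewrite (invSpE uG) !starK mulrA mulrACA !sg_sq !mul1r.
have S (x y : 'I_(dimG Sp n)) : (star x == y) = (x == star y).
  by apply/eqP/eqP => [<-|->]; rewrite starK.
split=> [|a ai|b bj]; rewrite e ?starK.
- rewrite !mulf_neq0 //; [have [->|->] := @sg_pm Sp n k j|have [->|->] :=
  @sg_pm Sp n k i]; rewrite ?oppr_eq0 oner_neq0 //.
- by rewrite h3 ?mulr0 // S.
- by rewrite h2 ?mulr0 // S.
Qed.

(** Choose the pivot so that [val (u a b) + wt a x - wt b y] is minimal among the
    columns that are not yet finished.  Its column can then be cleared inside U_x and
    its row inside U_y, and the entries already isolated survive, since the
    eliminations act trivially on the corresponding coordinates. *)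
Theorem bruhat u x y : G u -> exists p q, [/\ para x p, para y q & Nm (p *m u *m q)].
Proof.
have [m] := ubnP #|[pred j : 'I_d | ~~ `[< exists i, isolated_entry u i j >]]|.
elim: m u => // m IH u hm uG.
have uu := in_group_unit uG.
have [j0 hj0|h0] := pickP (fun j : 'I_d => ~~ `[< exists i, isolated_entry u i j >]);
  last first.
  have h j : exists i, isolated_entry u i j by apply/asboolP; have := h0 j => /negbFE.
  pose f j := projT1 (cid (h j)).
  have hf j : isolated_entry u (f j) j by rewrite /f; case: cid.
  have finj : injective f.
    move=> a b ab; have [_ _ ha] := hf a; have [hb _ _] := hf b.
    by apply/eqP/negPn/negP => nab; move: hb; rewrite -ab ha ?eqxx // eq_sym.
  exists 1%:M, 1%:M; split; [by constructor|by constructor|].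
  rewrite mul1mx mulmx1; split=> //; exists (perm finj) => i j; rewrite permE.
  have [hb hc _] := hf j; have [->//|ne] := eqVneq i (f j).
  by rewrite hc ?eqxx.
have [i0 hi0] : exists i, u i j0 != 0.
  have [i|hz] := pickP (fun i => u i j0 != 0); first by exists i.
  have := congr1 (fun M : 'M[k]_d => M j0 j0) (mulVmx uu).
  rewrite !mxE eqxx big1 ?eqxx; first by move/esym/eqP; rewrite oner_eq0.
  by move=> i _; have := hz i => /negbFE/eqP ->; rewrite mulr0.
(* Unfinished columns and the quantity minimised by the pivot. *)
pose P (z : 'I_d * 'I_d) := (u z.1 z.2 != 0) && ~~ `[< exists i, isolated_entry u i z.2 >].
pose F (z : 'I_d * 'I_d) := (val (u z.1 z.2))%:~R + wt z.1 x - wt z.2 y : R.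
have P0 : P (i0, j0) by rewrite /P /= hi0.
have [[i j] /andP[/= uij nj] hmin] := arg_minP F P0.
have {}hmin a b : u a b != 0 -> ~ (exists i, isolated_entry u i b) -> F (i, j) <= F (a, b).
  by move=> hab hb; apply: hmin; rewrite /P /= hab; apply/asboolPn.
move/asboolPn in nj.
have b1 : col_bounded val ((val (col j u i 0))%:~R + wt i x) x (col j u).
  move=> l; rewrite !mxE; have [->|nz] := eqVneq (u l j) 0; first by left.
  by right; have := hmin _ _ nz nj; rewrite /F /=; lra.
have v1 : col j u i 0 != 0 by rewrite mxE.
have [p [pp pv pi pt]] := col_clear hk v1 b1.
rewrite mxE in pv.
have b2 l : vb val true ((val (row i u 0 j))%:~R - wt j y + wt l y) (row i u 0 l).
  rewrite !mxE; have [->|nz] := eqVneq (u i l) 0; first by left.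
  right; have [[i' [_ h' h'']]|nl] := pselect (exists i, isolated_entry u i l); last first.
    by have := hmin _ _ nz nl; rewrite /F /=; lra.
  have [e|ne] := eqVneq i i'; last by rewrite h' ?eqxx in nz.
  subst i'.
  have jl : j != l by apply: contra_notN nj => /eqP ->; exists i.
  by rewrite h'' ?eqxx in uij.
have v2 : row i u 0 j != 0 by rewrite mxE.
have [q [pq qv qj qt]] := row_clear hk v2 b2.
rewrite mxE in qv.
have rowp b : (p *m u) i b = u i b.
  rewrite mxE (bigD1 i) //= big1 ?addr0; first by rewrite pi eqxx mul1r.
  by move=> c ci; rewrite pi eq_sym (negPf ci) mul0r.
have colq (M : 'M[k]_d) a : (M *m q) a j = M a j.
  rewrite mxE (bigD1 j) //= big1 ?addr0; first by rewrite qj eqxx mulr1.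
  by move=> c ci; rewrite qj (negPf ci) mulr0.
have colj a : (p *m u *m q) a j = u i j * (a == i)%:R.
  rewrite colq; have /colP/(_ a) := pv; rewrite !mxE eqxx andbT => <-.
  by apply: eq_bigr => c _; rewrite !mxE.
have rowi b : (p *m u *m q) i b = u i j * (b == j)%:R.
  have /rowP/(_ b) := qv; rewrite !mxE eqxx /= => <-.
  by apply: eq_bigr => c _; rewrite rowp !mxE.
have new : isolated_entry (p *m u *m q) i j.
  split=> [|a ai|b bj]; rewrite ?colj ?rowi ?eqxx ?mulr1 // ?(negPf ai) ?(negPf bj) mulr0
    //.
have old i' j' : isolated_entry u i' j' -> isolated_entry (p *m u *m q) i' j'.
  move=> h; have hs := isolated_star uG h.
  have [h1 h2 h3] := h; have [hs1 hs2 hs3] := hs.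
  have jj : j != j' by apply: contra_notN nj => /eqP ->; exists i'.
  have jsj : j != star j' by apply: contra_notN nj => /eqP ->; exists (star i').
  have ii : i' != i by apply: contraNneq uij => <-; rewrite h3.
  have sii : star i' != i by apply: contraNneq uij => <-; rewrite hs3.
  apply: isolated_mulr; last first.
    apply: isolated_mull h; apply: pt; rewrite ?mxE ?h3 ?hs3 //.
    by apply: contra_neq sii => ->; rewrite starK.
  apply: qt; rewrite ?mxE ?h2 ?hs2 // 1?eq_sym //.
  by apply: contra_neq jsj => <-; rewrite starK.
have [||p' [q' [pp' pq' hN]]] := IH (p *m u *m q).
- rewrite ltnS in hm; apply: leq_trans hm; apply: proper_card; apply/properP; split.
    apply/fintype.subsetP => b; rewrite !inE => /asboolPn h; apply/asboolPn.
    by apply: contra_not h => -[a ha]; exists a; apply: old.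
  exists j; rewrite !inE; first exact/asboolPn.
  by rewrite negbK; apply/asboolP; exists i.
- by apply: in_groupM => //; [apply: in_groupM => //|]; apply: para_group;
  [exact: hk|exact: pp|exact: hk|exact: pq].
exists (p' *m p), (q *m q'); split; [exact: paraM|exact: paraM|].
by rewrite !mulmxA in hN *.
Qed.

End Bruhat.

Section Points.
Context (gt : group_type) (n : nat) (k : fieldType) (val : k -> int) (R : realType).
Hypothesis hk : is_local_field val.
Local Notation d := (dimG gt n).
Local Notation G := (in_group gt n k).
Local Notation para := (@parahoric gt n k val R).
Local Notation Nm := (@torus_normaliser gt n k).
Local Notation nu := (@nu_act gt n k val R).

(** Points of the building are norms.  For the converse, the decomposition of
    [invmx g *m h] reduces to a monomial isometry, and a monomial matrix is an
    isometry exactly when it acts on the apartment as [nu_act] prescribes. *)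
Lemma building_relP g x h y : G g -> G h ->
  building_rel val g x h y <-> @norm_iso gt n k val R x y (invmx g *m h).
Proof.
move=> gG hG; set u := invmx g *m h.
have uG : G u by apply: in_groupM => //; apply: in_groupV.
have uu := in_group_unit uG.
split=> [[m [hm hnu hp]]|hu].
  have mu := in_group_unit hm.1.
  rewrite -/u in hp; rewrite -[u](mulmxK mu).
  apply: (norm_iso_trans hk _ _ (para_norm_iso hk hp)).
  - by rewrite unitmx_mul uu.
  - by rewrite unitmx_inv.
  - by apply: norm_iso_sym; apply/(nu_norm_iso hk).
have [p [q [pp pq hm]]] := bruhat hk x y uG.
have pu := in_group_unit (para_group hk pp); have qu := in_group_unit (para_group hk pq).
set m := p *m u *m q in hm; have mu := in_group_unit hm.1.
have nm : norm_iso val x y m.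
  apply: (norm_iso_trans hk _ _ (norm_iso_trans hk _ _ (para_norm_iso hk pp) hu)
    (para_norm_iso hk pq)) => //.
  by rewrite unitmx_mul pu.
have hnu : nu m y x by apply/(nu_norm_iso hk).
exists (invmx m); split; [exact: NmV hm|exact: (nuV hk hm hnu)|].
rewrite -/u; have -> : u *m invmx m = invmx p *m (m *m invmx q *m invmx m).
  by rewrite /m -!mulmxA (mulmxA q) mulmxV // mul1mx mulKmx.
apply: paraM => //; first exact: paraV.
by apply: (para_conj hk hm hnu); exact: paraV.
Qed.

Lemma pt_eqP g x h y : G g -> G h -> in_cochar gt n R x -> in_cochar gt n R y ->
  pt val g x = pt val h y <-> norm_iso val x y (invmx g *m h).
Proof.
move=> gG hG xC yC; split=> [e|hu].
  have : pt val h y (h, y).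
    split=> //; apply/building_relP => //=; rewrite mulVmx; first exact: norm_iso_refl.
    exact: in_group_unit.
  by rewrite -e => -[_ _ /building_relP]; apply.
have gu := in_group_unit gG; have hhu := in_group_unit hG.
apply/seteqP; split=> -[f z] [/= fG zC /building_relP h1]; split=> //=;
  apply/building_relP => //; have fu := in_group_unit fG.
  have -> : invmx h *m f = invmx (invmx g *m h) *m (invmx g *m f).
    by rewrite invmx_mul ?unitmx_inv // invmxK -!mulmxA (mulmxA g) mulmxV // mul1mx.
  apply: (norm_iso_trans hk _ _ (norm_iso_sym hu));
    rewrite ?unitmx_inv ?unitmx_mul ?unitmx_inv ?gu //.
  exact: h1.
have -> : invmx g *m f = (invmx g *m h) *m (invmx h *m f) by rewrite -!mulmxA (mulmxA h)
  mulmxV // mul1mx.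
apply: (norm_iso_trans hk _ _ hu); rewrite ?unitmx_mul ?unitmx_inv ?gu ?hhu //.
exact: h1.
Qed.

Lemma pt_filtP cl g x r M : G g -> in_cochar gt n R x ->
  pt_filt val cl (pt val g x) r M <-> lie_filt val cl x r (invmx g *m M *m g).
Proof.
move=> gG xC; split=> [[h [y [hG yC e]]]|hM]; last by exists g, x.
have [n1 n2] := (pt_eqP gG hG xC yC).1 e.
have gu := in_group_unit gG; have hu := in_group_unit hG.
move=> /(lie_filtP hk)[lM fM]; apply/(lie_filtP hk).
have -> : invmx g *m M *m g = (invmx g *m h) *m (invmx h *m M *m h) *m invmx (invmx g *m h).
  by rewrite invmx_mul ?unitmx_inv // invmxK -!mulmxA !(mulKVmx hu).
split; first by apply: in_lieJV => //; apply: in_groupM => //; apply: in_groupV.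
by rewrite -[r]addr0; apply: filtMr n2 => //; rewrite -[r]add0r; exact: filtM fM.
Qed.

End Points.

(** * Common apartments *)

Section NuExists.
Context (gt : group_type) (n : nat) (k : fieldType) (val : k -> int) (R : realType).
Hypothesis hk : is_local_field val.
Local Notation d := (dimG gt n).
Local Notation G := (in_group gt n k).
Local Notation Nm := (@torus_normaliser gt n k).
Local Notation nu := (@nu_act gt n k val R).

Lemma val_prod (I : finType) (f : I -> k) : (forall i, f i != 0) ->
  val (\prod_i f i) = \sum_i val (f i).
Proof.
move=> hf; suff [] : \prod_i f i != 0 /\ val (\prod_i f i) = \sum_i val (f i) by [].
apply: (big_ind2 (fun a b => a != 0 /\ val a = b)) => [|a b c e [a0 <-] [c0 <-]|i _].
- by rewrite oner_neq0 (val1 hk).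
- by rewrite mulf_neq0 // (Defs.valM hk).
- by rewrite hf.
Qed.

End NuExists.

Lemma det_mono (k : fieldType) d (m : 'M[k]_d) (s : 'S_d) :
  (forall i j, (m i j != 0) = (i == s j)) ->
  \det m = (-1) ^+ s * \prod_j m (s j) j.
Proof.
move=> hs; have -> : m = (perm_mx s)^T *m diag_mx (\row_j m (s j) j).
  apply/matrixP => i j; rewrite mxE (bigD1 j) //= big1 ?addr0.
    rewrite !mxE eqxx mulr1n [s j == i]eq_sym; case: eqVneq => [->|ne];
      first by rewrite mul1r.
    by rewrite mul0r; apply/eqP; have := hs i j; rewrite (negPf ne) => /negbFE.
  by move=> l lj; rewrite !mxE (negPf lj) mulr0n mulr0.
rewrite det_mulmx det_tr det_perm det_diag; congr (_ * _).
apply: eq_bigr => j _; rewrite !mxE (bigD1 j) //= big1 ?addr0.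
  by rewrite !mxE !eqxx mul1r mulr1n.
by move=> l lj; rewrite !mxE (negPf lj) mulr0n mulr0.
Qed.

Section CommonApartment.
Context (gt : group_type) (n : nat) (k : fieldType) (val : k -> int) (R : realType).
Hypothesis hk : is_local_field val.
Local Notation d := (dimG gt n).
Local Notation G := (in_group gt n k).
Local Notation Nm := (@torus_normaliser gt n k).
Local Notation nu := (@nu_act gt n k val R).
Local Notation C := (in_cochar gt n R).

(** For SL the sum of the coordinates is preserved because the product of the
    nonzero entries of [m] is a sign; for Sp opposite coordinates remain opposite
    because the corresponding entries of [m] are inverse up to sign. *)
Lemma nu_exists (m : 'M[k]_d) x : Nm m -> C x -> exists2 y, C y & nu m x y.
Proof.
move=> hm; have mu := in_group_unit hm.1; have hinv := mono_invE hm; case: hm => mG [s hs].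
move: m s mG hs mu hinv x; rewrite /in_cochar /nu_act; case: gt => m s mG hs mu hinv x hx.
  exists (\row_i (x 0 ((s^-1)%g i) - (val (m i ((s^-1)%g i)))%:~R)).
    under eq_bigr do rewrite mxE.
    rewrite (reindex_inj (@perm_inj _ s)) /=; under eq_bigr do rewrite permK.
    rewrite sumrB hx sub0r; apply/eqP; rewrite oppr_eq0; apply/eqP.
    have -> : \sum_(i < n) (val (m (s i) i))%:~R = (\sum_(i < n) val (m (s i) i))%:~R :>
      R by rewrite rmorph_sum.
    rewrite -(val_prod hk) => [|i]; last by rewrite hs.
    suff -> : \prod_j m (s j) j = (-1) ^+ s by case: (s : bool);
      rewrite ?expr1 ?expr0 ?(valN1 hk) ?(val1 hk).
    have := det_mono hs; rewrite mG => e.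
    by rewrite -[LHS](signrMK s) -e mulr1.
  move=> i j; rewrite hs => /eqP ->; rewrite -!/(wt _ _) !wtSL mxE permK //.
pose y := \row_l (@wt Sp n R ((s^-1)%g (lshift n l)) x -
  (val (m (lshift n l) ((s^-1)%g (lshift n l))))%:~R) : 'rV[R]_n.
exists y => //; apply: lr_case => i j; rewrite hs => /eqP e; rewrite -!/(wt _ _).
  by rewrite wtSp_l mxE e permK.
have hsl : s (star j) = lshift n i by rewrite (mono_star mG hs) -e star_r.
have mji : m (rshift n i) j != 0 by rewrite hs e.
rewrite wtSp_r mxE -hsl permK wt_star hsl.
have -> : val (m (lshift n i) (star j)) = - val (m (rshift n i) j).
  rewrite -(valV hk mji) -(hinv _ _ mji) (invSpE mG) star_r.
  by have [->|->] := @sg_pm Sp n k j; have [->|->] := @sg_pm Sp n k (rshift n i);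
    rewrite ?mulN1r ?opprK ?mulN1r ?mul1r ?mulN1r ?(valN hk).
by rewrite intrN; ring.
Qed.

(** If [invmx g1 *m g2 = p^-1 *m m *m q^-1] with [m] monomial, then the torus of
    [g1 *m p^-1] serves both points. *)
Theorem common_apartment g1 g2 x1 x2 : G g1 -> G g2 -> C x1 -> C x2 ->
  exists g3 y2, [/\ G g3, C y2, pt val g1 x1 = pt val g3 x1 & pt val g2 x2 = pt val g3 y2].
Proof.
move=> G1 G2 C1 C2; have u1 := in_group_unit G1; have u2 := in_group_unit G2.
have uG : G (invmx g1 *m g2) by apply: in_groupM => //; apply: in_groupV.
have [p [q [pp pq hm]]] := bruhat hk x1 x2 uG.
have [y2 C3 hnu] := nu_exists hm C2.
have pG := para_group hk pp; have qG := para_group hk pq.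
have pu := in_group_unit pG; have qu := in_group_unit qG.
have mu := in_group_unit hm.1.
have G3 : G (g1 *m invmx p) by apply: in_groupM => //; apply: in_groupV.
exists (g1 *m invmx p), y2; split=> //; apply/(pt_eqP hk) => //.
  by rewrite mulKmx //; apply: norm_iso_sym; exact: para_norm_iso.
have -> : invmx g2 *m (g1 *m invmx p) = q *m invmx (p *m (invmx g1 *m g2) *m q).
  rewrite !invmx_mul ?unitmx_mul ?unitmx_inv ?pu ?u1 ?u2 // invmxK.
  by rewrite !mulmxA mulmxV // mul1mx.
apply: (norm_iso_trans hk _ _ (para_norm_iso hk pq)); rewrite ?unitmx_inv //.
by apply: norm_iso_sym; apply/(nu_norm_iso hk).
Qed.

End CommonApartment.

(** * Facets of an apartment *)

Section Perturb.
Context (R : realType).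

Lemma fin_eps (I : finType) (P : I -> R -> Prop) :
  (forall i, exists2 e, 0 < e & forall t, 0 < t <= e -> P i t) ->
  exists2 e, 0 < e & forall i t, 0 < t <= e -> P i t.
Proof.
move=> h; suff [e e0 he] : exists2 e, 0 < e & forall i, i \in enum I ->
  forall t, 0 < t <= e -> P i t.
  by exists e => // i t ht; apply: he => //; rewrite mem_enum.
elim: (enum I) => [|i s [e e0 he]]; first by exists 1.
have [e' e'0 he'] := h i; exists (Num.min e e'); first by rewrite lt_min e0.
move=> j; rewrite in_cons => /predU1P[->|js] t /andP[t0]; rewrite le_min => /andP[t1 t2].
  by apply: he'; rewrite t0.
by apply: he => //; rewrite t0.
Qed.

Definition is_integer (a : R) := exists m : int, a = m%:~R.

Lemma nonint_floor a : ~ is_integer a -> (Num.floor a)%:~R < a < (Num.floor a + 1)%:~R.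
Proof.
move=> na; have /andP[h1 ->] := floor_itv a; rewrite andbT lt_neqAle h1 andbT.
by apply: contra_notN na => /eqP <-; exists (Num.floor a).
Qed.

Lemma itv_sign (f m : int) (z : R) : f%:~R < z < (f + 1)%:~R ->
  (z + m%:~R < 0) = (f + m < 0) /\ (0 < z + m%:~R) = (0 <= f + m).
Proof.
move=> /andP[h1 h2]; rewrite intrD in h2.
have [fm|fm] := ltP (f + m) 0.
  have h3 : f + 1 + m <= 0 by lia.
  move: h3; rewrite -(ler_int R) !intrD => h3.
  by split; [|apply/negbTE; rewrite -leNgt]; lra.
move: fm; rewrite -(ler_int R) !intrD => h3.
by split; [apply/negbTE; rewrite -leNgt|]; lra.
Qed.

(** An affine function a + t b of the small parameter t crosses an integer only if
    it starts at one. *)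
Lemma perturb_sign (a b : R) : (is_integer a -> b = 0) ->
  exists2 e, 0 < e & forall t, 0 < t <= e -> forall m : int,
    (a + t * b + m%:~R < 0) = (a + m%:~R < 0) /\ (0 < a + t * b + m%:~R) = (0 < a + m%:~R).
Proof.
move=> hab; have [->|b0] := eqVneq b 0.
  by exists 1 => // t _ m; rewrite mulr0 addr0.
have na : ~ is_integer a by move=> /hab e; rewrite e eqxx in b0.
have fa := nonint_floor na; set f := Num.floor a in fa.
pose g := Num.min (a - f%:~R) ((f + 1)%:~R - a).
have g0 : 0 < g by rewrite lt_min; move: fa => /andP[]; lra.
have nb : 0 < `|b| by rewrite normr_gt0.
exists (g / (2 * `|b|)); first by rewrite divr_gt0 // mulr_gt0.
move=> t /andP[t0 te] m.
have tb : `|t * b| < g.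
  rewrite normrM (gtr0_norm t0).
  have : t * `|b| <= g / 2.
    rewrite -(ler_pM2r nb) in te; apply: le_trans te _.
    by rewrite invfM mulrA mulfVK // gt_eqF.
  by lra.
have fb : f%:~R < a + t * b < (f + 1)%:~R.
  have g1 : g <= a - f%:~R by rewrite ge_min lexx.
  have g2 : g <= (f + 1)%:~R - a by rewrite ge_min lexx orbT.
  by move: tb; rewrite ltr_norml => /andP[h1 h2]; apply/andP; split; lra.
by have [-> ->] := itv_sign m fa; have [-> ->] := itv_sign m fb.
Qed.

Lemma perturb_int (a b : R) : b != 0 ->
  exists2 e, 0 < e & forall t, 0 < t <= e -> ~ is_integer (a + t * b).
Proof.
move=> b0; have [[m am]|na] := pselect (is_integer a); last first.
  have [e e0 he] := @perturb_sign a b (fun h => False_ind _ (na h)).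
  exists e => // t /he ht [m hm]; have [h1 h2] := ht (- m); apply: na; exists m.
  move: h1 h2; rewrite hm intrN subrr ltxx => /esym/negbT; rewrite -leNgt => h1 /esym/negbT.
  by rewrite -leNgt; lra.
have nb : 0 < `|b| by rewrite normr_gt0.
exists ((2 * `|b|)^-1); first by rewrite invr_gt0 mulr_gt0.
move=> t /andP[t0 te] [m' hm'].
have tb : `|t * b| = `|m' - m|%:~R by rewrite intr_norm intrB -am -hm' addrC addKr.
have h1 : 0 < `|t * b| by rewrite normr_gt0 mulf_neq0 // gt_eqF.
have h2 : `|t * b| < 1.
  rewrite normrM (gtr0_norm t0); rewrite -(ler_pM2r nb) in te; apply: le_lt_trans te _.
  by rewrite invfM mulfVK ?gt_eqF // invf_lt1 // ltr1n.
by move: h1 h2; rewrite tb ltr0z ltrz1; lia.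
Qed.

End Perturb.

Section VspaceOf.
Context (K : fieldType) (vT : vectType K).

(** A subspace of maximal dimension among those contained in [S] is all of [S]. *)
Lemma vspace_of (S : vT -> Prop) : S 0 -> (forall a u v, S u -> S v -> S (a *: u + v)) ->
  exists U : {vspace vT}, forall v, v \in U <-> S v.
Proof.
move=> S0 Slin.
pose P m := `[< exists2 U : {vspace vT}, \dim U = m & forall v, v \in U -> S v >].
have exP : exists m, P m.
  exists 0%N; apply/asboolP; exists 0%VS; first exact: dimv0.
  by move=> v; rewrite memv0 => /eqP ->.
have ub m : P m -> (m <= \dim {:vT})%N.
  by move=> /asboolP[U <- _]; apply: dimvS; apply: subvf.
case: (ex_maxnP exP ub) => m /asboolP[U dU hU] hmax; exists U => v; split; first exact: hU.
move=> Sv; apply/negPn/negP => vU.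
have hP : P (\dim (U + <[v]>)).
  apply/asboolP; exists (U + <[v]>)%VS => // z /memv_addP[u uU [u' /vlineP[c ->] ->]].
  by rewrite addrC; apply: Slin => //; exact: hU.
have := hmax _ hP; rewrite -dU => h.
have := dimv_leqif_sup (addvSl U <[v]>) => -[h1 h2].
have e : \dim U = \dim (U + <[v]>) by apply/eqP; rewrite eqn_leq h1.
move: h2; rewrite e eqxx => /esym /subvP hs.
by move/negP: vU; apply; apply: hs; apply: (subvP (addvSr U _)); exact: memv_line.
Qed.

End VspaceOf.

Lemma continuous_affine (R : realType) (T : topologicalType) (I : finType) (c : I -> R)
  (f : I -> T -> R) (m : R) : (forall i, continuous (f i)) ->
  continuous (fun x => \sum_i c i * f i x + m).
Proof.
move=> hf x; apply: cvgD; last exact: cvg_cst.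
elim: (index_enum I) => [|i s IH].
  under eq_fun do rewrite big_nil.
  by rewrite big_nil; exact: cvg_cst.
under eq_fun do rewrite big_cons.
rewrite big_cons; apply: cvgD => //; apply: cvgM; first exact: cvg_cst.
exact: hf.
Qed.

Section Cells.
Context (gt : group_type) (n : nat) (R : realType).
Local Notation w := (std_weight gt n).
Local Notation C := (in_cochar gt n R).
Implicit Types (x y v : 'rV[R]_n) (r : R).

Lemma in_cochar_lin a u v : C u -> C v -> C (a *: u + v).
Proof.
rewrite /in_cochar; case: gt => // hu hv; under eq_bigr do rewrite !mxE.
by rewrite big_split /= -mulr_sumr hu hv mulr0 addr0.
Qed.

Lemma in_cochar0 : C 0.
Proof. by rewrite /in_cochar; case: gt => //; rewrite big1 // => i _; rewrite mxE. Qed.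

Lemma in_cocharDZ a u v : C u -> C v -> C (u + a *: v).
Proof. by move=> hu hv; rewrite addrC; apply: in_cochar_lin. Qed.

Lemma in_cocharB u v : C u -> C v -> C (u - v).
Proof. by move=> hu hv; rewrite -scaleN1r; apply: in_cocharDZ. Qed.

Definition same_side r x y := forall psi, affine_roots gt n psi ->
  (aff_eval psi y < r) = (aff_eval psi x < r) /\ (r < aff_eval psi y) =
    (r < aff_eval psi x).

(** The r-facet of [x], described by the sides of all hyperplanes. *)
Definition cell r x : set 'rV[R]_n := [set y | C y /\ same_side r x y].

Lemma same_side_eq r x y psi : same_side r x y -> affine_roots gt n psi ->
  aff_eval psi y = r <-> aff_eval psi x = r.
Proof.
move=> h /h [h1 h2]; split=> e; move: h1 h2; rewrite e ltxx.
  by move=> /esym/negbT; rewrite -leNgt => h1 /esym/negbT; rewrite -leNgt => h2; lra.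
by move=> /negbT; rewrite -leNgt => h1 /negbT; rewrite -leNgt => h2; lra.
Qed.

Lemma same_side_lteif cl r x y psi : same_side r x y -> affine_roots gt n psi ->
  (r < aff_eval psi y ?<= if cl) = (r < aff_eval psi x ?<= if cl).
Proof. by move=> h /h [h1 h2]; case: cl => /=; rewrite // !leNgt h1. Qed.

Lemma cell_refl r x : C x -> cell r x x. Proof. by []. Qed.

Lemma cell_eq r x y : cell r x y -> C x -> cell r y = cell r x.
Proof.
move=> [Cy h] Cx; apply/seteqP; split=> z [Cz hz]; split=> // psi hp;
  have [h1 h2] := h psi hp; have [h3 h4] := hz psi hp; by rewrite h3 h4 h1 h2.
Qed.

Lemma aff_eval_lin psi x t v : aff_eval psi (x + t *: v) = aff_eval psi x + t * pairing
  psi.1 v.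
Proof. by rewrite /aff_eval pairingD pairingZ; ring. Qed.

Lemma aff_eval_continuous psi : continuous (aff_eval psi : 'rV[R]_n -> R).
Proof.
apply: (@continuous_affine R ('rV[R]_n) 'I_n (fun i =>
  (psi.1 0 i)%:~R) (fun i (x : 'rV[R]_n) => x 0 i)) => i.
exact: coord_continuous.
Qed.

Lemma segment_continuous x v : continuous ((fun t : R => x + t *: v) : R -> 'rV[R]_n).
Proof.
by move=> t; apply: cvgD; [exact: cvg_cst|apply: cvgZ; [exact: cvg_id|exact: cvg_cst]].
Qed.

Lemma conv_lt (a b t r : R) : 0 <= t -> t <= 1 -> a < r -> b < r -> a + t * (b - a) < r.
Proof.
move=> t0 t1 ha hb; have [t1'|t1'] := ltP t 1; first nra.
by have -> : t = 1 by [lra]; rewrite mul1r; lra.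
Qed.

Lemma conv_gt (a b t r : R) : 0 <= t -> t <= 1 -> r < a -> r < b -> r < a + t * (b - a).
Proof.
move=> t0 t1 ha hb; have := @conv_lt (- a) (- b) t (- r) t0 t1;
  rewrite !ltrN2 => /(_ ha hb).
by lra.
Qed.

Lemma same_side_segment r x y t : 0 <= t <= 1 -> same_side r x y ->
  same_side r x (x + t *: (y - x)).
Proof.
move=> /andP[t0 t1] h psi /h.
have -> : aff_eval psi (x + t *: (y - x)) = aff_eval psi x + t *
  (aff_eval psi y - aff_eval psi x).
  by rewrite aff_eval_lin /aff_eval pairingD -scaleN1r pairingZ; ring.
set a := aff_eval psi x; set b := aff_eval psi y.
case: (ltgtP a r) => ha; case: (ltgtP b r) => hb [] // _ _; split.
- by apply/idP; apply: conv_lt.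
- by apply/negbTE; rewrite -leNgt; apply/ltW/conv_lt.
- by apply/negbTE; rewrite -leNgt; apply/ltW/conv_gt.
- by apply/idP; apply: conv_gt.
- by rewrite ha hb subrr mulr0 addr0 ltxx.
- by rewrite ha hb subrr mulr0 addr0 ltxx.
Qed.

(** An affine root minus r has no zero on a connected set missing its hyperplane,
    hence has constant sign there; conversely a segment inside a cell does not leave
    the set of which it is a component. *)
Lemma component_cell (Sigma : set ('rV[int]_n * int)) r x :
  let Z := facet_flat gt Sigma r `\` \bigcup_(psi in affine_roots gt n `\` Sigma)
         [set x | aff_eval psi x = r] in
  Sigma `<=` affine_roots gt n -> Z x -> connected_component Z x = cell r x.
Proof.
move=> Z hS [[Cx hx] nx].
have nx' psi : affine_roots gt n psi -> ~ Sigma psi -> aff_eval psi x != r.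
  by move=> h1 h2; apply: contra_notN nx => /eqP e; exists psi.
apply/seteqP; split=> y.
  move=> [B [Bx BZ Bc] By]; have [[Cy hy] ny] := BZ _ By; split=> // psi hp.
  have [hs|hs] := pselect (Sigma psi); first by rewrite hx // hy.
  have nB z : B z -> aff_eval psi z != r.
    by move=> /BZ[_ nz]; apply: contra_notN nz => /eqP e; exists psi.
  have /connected_intervalP hI : connected (aff_eval psi @` B).
    apply: connected_continuous_connected => //.
    by apply: continuous_subspaceT; exact: aff_eval_continuous.
  have ix : (aff_eval psi @` B) (aff_eval psi x) by exists x.
  have iy : (aff_eval psi @` B) (aff_eval psi y) by exists y.
  have nr : ~ (aff_eval psi @` B) r by move=> [z /nB + e]; rewrite e eqxx.
  have := nB _ Bx; have := nB _ By.
  case: (ltgtP (aff_eval psi y) r) => // hy' _;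
    case: (ltgtP (aff_eval psi x) r) => // hx' _.
    by case: nr; apply: (hI _ _ iy ix); rewrite !ltW.
  by case: nr; apply: (hI _ _ ix iy); rewrite !ltW.
move=> [Cy hy].
pose f := (fun t : R => x + t *: (y - x)) : R -> 'rV[R]_n.
have fy : (f @` `[0, 1]) y.
  by exists 1; rewrite /f ?scale1r ?subrKC //= in_itv /= ler01 lexx.
apply: (@connected_component_max _ Z (f @` `[0, 1])) fy.
- by exists 0; rewrite /f ?scale0r ?addr0 //= in_itv /= ler01 lexx.
- move=> _ [t /= ht <-]; rewrite in_itv /= in ht; rewrite /f.
  have hside := same_side_segment ht hy.
  split; first split.
  + by apply: in_cocharDZ => //; apply: in_cocharB.
  + by move=> psi hs; apply/(same_side_eq hside (hS _ hs)); apply: hx.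
  + by move=> [psi [h1 h2]] /= /(same_side_eq hside h1); apply/eqP; exact: nx'.
- apply: connected_continuous_connected; first exact: segment_connected.
  by apply: continuous_subspaceT; exact: segment_continuous.
Qed.

Lemma facet_cell r F : is_facet gt r F -> exists2 x, C x & F = cell r x.
Proof.
move=> [Sigma [_ hS [x Zx ->]]]; exists x; first by case: Zx => -[].
by rewrite component_cell.
Qed.

Lemma cell_facet r x : C x -> is_facet gt r (cell r x).
Proof.
move=> Cx; exists [set psi | affine_roots gt n psi /\ aff_eval psi x = r]; split.
- pose f (p : 'I_(dimG gt n) * 'I_(dimG gt n)) :=
    (w p.1 - w p.2, Num.floor (r - pairing (w p.1 - w p.2) x)).
  apply: (@sub_finite_set _ _ (f @` setT)); last exact: finite_image.
  move=> [phi m] [/= [i [j [ij /= ->]]] e]; exists (i, j) => //; rewrite /f /=.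
  by rewrite -e /aff_eval /= [pairing _ _ + _]addrC addrK intrKfloor.
- by move=> psi [].
- move=> Z; have Zx : Z x.
    by split; [split=> // psi []|move=> [psi [h1 h2] /= e]; apply: h2].
  by exists x => //; rewrite /Z component_cell // => psi [].
Qed.

Definition wall r x (phi : 'rV[int]_n) := exists m : int, pairing phi x + m%:~R = r.

(** The directions of the affine span of the cell of [x]: those parallel to every
    hyperplane through [x]. *)
Definition dirs r x v := C v /\ forall phi, Defs.roots gt n phi -> wall r x phi ->
  pairing phi v = 0.

Lemma dirs_vspace r x : exists U : {vspace 'rV[R]_n}, forall v, v \in U <-> dirs r x v.
Proof.
apply: vspace_of; first by split; [exact: in_cochar0|move=> phi _ _;
  rewrite /pairing big1 // => i _; rewrite mxE mulr0].
move=> a u v [Cu hu] [Cv hv]; split; first exact: in_cochar_lin.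
by move=> phi h1 h2; rewrite pairingD pairingZ hu // hv // mulr0 addr0.
Qed.

Definition dirspace r x : {vspace 'rV[R]_n} := projT1 (cid (dirs_vspace r x)).
Lemma dirspaceP r x v : v \in dirspace r x <-> dirs r x v.
Proof. by rewrite /dirspace; case: cid. Qed.

Lemma wall_isint r x phi : wall r x phi <-> is_integer (pairing phi x - r).
Proof.
by split=> [[m <-]|[m e]]; [exists (- m)|exists (- m)]; rewrite intrN; [ring|rewrite -e;
  ring].
Qed.

Lemma dirs_cell r x y : cell r x y -> dirspace r x = dirspace r y.
Proof.
move=> [Cy h]; apply/eqP; rewrite eqEsubv; apply/andP; split;
  apply/subvP => v /dirspaceP[Cv hv]; apply/dirspaceP; split=> // phi hp [m hm];
  apply: hv => //; exists m; have := same_side_eq (psi := (phi, m)) h hp;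
    rewrite /aff_eval /= => e; by apply/e.
Qed.

Lemma cell_perturb r x v : C x -> dirs r x v ->
  exists2 e, 0 < e & forall t, 0 < t <= e -> cell r x (x + t *: v).
Proof.
move=> Cx [Cv hv].
have [|e e0 he] := @fin_eps R ('I_(dimG gt n) * 'I_(dimG gt n))%type
  (fun p t => p.1 != p.2 -> forall m : int, let psi := (w p.1 - w p.2, m) in
    (aff_eval psi (x + t *: v) < r) = (aff_eval psi x < r) /\
      (r < aff_eval psi (x + t *: v)) = (r < aff_eval psi x)).
  move=> [i j] /=; have [ij|ij] := eqVneq i j; first by exists 1.
  have [|e e0 he] := @perturb_sign R (pairing (w i - w j) x - r) (pairing (w i - w j) v).
    by move=> /wall_isint; apply: hv; exists i, j.
  exists e => // t /he ht _ m; have [h1 h2] := ht m; rewrite !aff_eval_lin /aff_eval /=.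
  set a := pairing (w i - w j) x in h1 h2 *; set b := pairing _ v in h1 h2 *.
  have e1 : a + m%:~R + t * b - r = a - r + t * b + m%:~R by ring.
  have e2 : a + m%:~R - r = a - r + m%:~R by ring.
  rewrite -[a + _ + _ < r]subr_lt0 -[a + _ < r]subr_lt0 -[r < a + _ + _]subr_gt0
    -[r < a + _]subr_gt0.
  by rewrite e1 e2 h1 h2.
exists e => // t ht; split; first exact: in_cocharDZ.
by move=> [phi m] [i [j [ij /= ->]]]; exact: (he (i, j) t ht ij m).
Qed.

(** A cell contains a short segment from [x] in each direction parallel to the
    hyperplanes through [x]. *)
Lemma affine_dim_cell r x : C x -> affine_dim (cell r x) (\dim (dirspace r x)).
Proof.
move=> Cx; exists x, (dirspace r x); split=> //.
  move=> y [Cy h]; apply/dirspaceP; split; first exact: in_cocharB.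
  move=> phi hp [m hm]; have := same_side_eq (psi := (phi, m)) h hp;
    rewrite /aff_eval /= => -[_ /(_ hm)] e.
  by rewrite -scaleN1r pairingD pairingZ; lra.
move=> x' V' sub y /dirspaceP hv.
have [e e0 he] := cell_perturb Cx hv.
have /= h1 := sub _ (cell_refl r Cx).
have /= h2 := sub _ (he e _); rewrite e0 lexx in h2; have {}h2 := h2 isT.
rewrite /affine_subspace /= in h1 h2 *.
have h3 : e *: (y - x) \in V'.
  by have := rpredB h2 h1; rewrite opprB addrA subrK addrAC subrr add0r.
have h4 : y - x \in V' by have := rpredZ e^-1 h3; rewrite scalerA mulVf ?scale1r // gt_eqF.
by have := rpredD h4 h1; rewrite addrA subrK.
Qed.

Lemma affine_dim_uniq (F : set 'rV[R]_n) e e' : affine_dim F e -> affine_dim F e' -> e = e'.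
Proof.
have K x V x' V' : affine_subspace x V `<=` affine_subspace x' V' -> (V <= V')%VS.
  move=> h; apply/subvP => v vV.
  have h1 : affine_subspace x V (v + x) by rewrite /affine_subspace /= addrK.
  have h2 : affine_subspace x V x by rewrite /affine_subspace /= subrr mem0v.
  have := rpredB (h _ h1) (h _ h2); rewrite opprB addrA subrK addrK. by [].
move=> [x [V [h1 h2 <-]]] [x' [V' [h1' h2' <-]]].
by congr (\dim _); apply/eqP; rewrite eqEsubv (K _ _ _ _ (h2 _ _ h1'))
  (K _ _ _ _ (h2' _ _ h1)).
Qed.

Lemma cell_dim r x e : C x -> affine_dim (cell r x) e -> e = \dim (dirspace r x).
Proof. by move=> Cx h; apply: affine_dim_uniq h _; apply: affine_dim_cell. Qed.

(** Let [x] move inside its r-facet.  If some hyperplane through [x + c] is not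
    parallel to a direction [v] of this facet, a small displacement along [v] leaves
    it without meeting new hyperplanes.  After finitely many steps every hyperplane
    through [x + c] is parallel to the whole facet. *)
Lemma translate_cell r s x0 c : C x0 -> C c ->
  exists x, [/\ cell r x0 x, C (x + c) &
    (\dim (dirspace r x0) <= \dim (dirspace s (x + c)%R))%N].
Proof.
move=> Cx0 Cc.
(* Induction on the number of hyperplanes through [x + c], counted by pairs of
   weights. *)
pose bad x (p : 'I_(dimG gt n) * 'I_(dimG gt n)) := `[< wall s (x + c) (w p.1 - w p.2) >].
suff : forall N x, (#|bad x| < N)%N -> cell r x0 x ->
  exists x, [/\ cell r x0 x, C (x + c) & (dirspace r x0 <= dirspace s (x + c)%R)%VS].
  move=> /(_ _ x0 (ltnSn _) (cell_refl r Cx0)) [x [h1 h2 h3]]; exists x; split=> //.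
  exact: dimvS.
elim=> // N IH x hN hx; have Cx := hx.1.
have [sub|nsub] := boolP (dirspace r x0 <= dirspace s (x + c)%R)%VS.
  by exists x; split=> //; rewrite -[c]scale1r; apply: in_cocharDZ.
move/subvPn: nsub => [v vin nv]; have hv : dirs r x v by apply/dirspaceP;
  rewrite -(dirs_cell hx).
have [i [j [ij hw nz]]] : exists i j, [/\ i != j,
  wall s (x + c) (w i - w j) & pairing (w i - w j) v != 0].
  apply: contrapT => hn; move/negP: nv; apply; apply/dirspaceP; split; first by case: hv.
  move=> phi [i [j [ij ->]]] hw; apply/eqP/negPn/negP => nz; apply: hn; by exists i, j.
have [e1 e10 he1] := cell_perturb Cx hv.
have [|e2 e20 he2] := @fin_eps R ('I_(dimG gt n) * 'I_(dimG gt n))%type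
  (fun p t => bad (x + t *: v) p -> bad x p /\ p != (i, j)).
  move=> [a b]; have [z|z] := eqVneq (pairing (w a - w b) v) 0.
    exists 1 => // t _; rewrite /bad /= => /asboolP[m hm]; split.
      by apply/asboolP; exists m; rewrite -hm addrAC [in RHS]pairingD pairingZ z mulr0
        addr0.
    by apply: contraNneq nz => -[<- <-]; rewrite z.
  have [e e0 he] := perturb_int (pairing (w a - w b) (x + c) - s) z.
  exists e => // t /he ht; rewrite /bad => /asboolP/wall_isint/= hi; exfalso; apply: ht.
  by move: hi; rewrite addrAC pairingD pairingZ addrAC.
pose t := Num.min e1 e2.
have t0 : 0 < t by rewrite lt_min e10.
have t1 : 0 < t <= e1 by rewrite t0 ge_min lexx.
have t2 : 0 < t <= e2 by rewrite t0 ge_min lexx orbT.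
apply: (IH (x + t *: v)).
  rewrite ltnS in hN; apply: leq_trans hN; apply: proper_card; apply/properP; split.
    by apply/fintype.subsetP => p; rewrite !unfold_in => /(he2 _ _ t2)[].
  exists (i, j); rewrite !unfold_in; first exact/asboolP.
  by apply/negP => /(he2 _ _ t2)[_]; rewrite eqxx.
by rewrite -(cell_eq hx Cx0); exact: he1.
Qed.

End Cells.

(** * Weights of the adapted one-parameter subgroup *)

Lemma dual_numbers (k : fieldType) : exists (A : comUnitAlgType k) (eps : A),
  eps ^+ 2 = 0 /\ eps != 0.
Proof.
have mX : mk_monic ('X^2 : {poly k}) = 'X^2.
  by rewrite /mk_monic size_polyXn monicXn.
exists {poly %/ ('X^2 : {poly k})}, (in_qpoly 'X^2 'X); split.
  rewrite -rmorphXn /=; apply: val_inj; rewrite /= mX.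
  by rewrite Pdiv.Ring.rmodpp //; exact: mulrC.
apply/eqP => /(congr1 (fun q : {poly %/ ('X^2 : {poly k})} => (polyn q)`_1)).
rewrite in_qpoly_small; last by rewrite mX size_polyX size_polyXn.
by rewrite coefX coef0 => /eqP; rewrite oner_eq0.
Qed.

Section Dual.
Context (k : fieldType) (A : comUnitAlgType k) (eps : A).
Hypothesis eps2 : eps ^+ 2 = 0.
Hypothesis eps0 : eps != 0.

Lemma eps_inj (c c' : k) : eps * c%:A = eps * c'%:A -> c = c'.
Proof.
rewrite !mulr_algr => /eqP; rewrite -subr_eq0 -scalerBl scaler_eq0 (negPf eps0) orbF
  subr_eq0.
by move=> /eqP.
Qed.

Lemma dual_inv (c : A) : (1 + eps * c) * (1 - eps * c) = 1.
Proof.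
have e : eps * c * (eps * c) = 0 by rewrite mulrACA -expr2 eps2 mul0r.
by rewrite mulrBr mulr1 mulrDl mul1r e addr0 addrK.
Qed.

Lemma dual_unit (c : A) : 1 + eps * c \is a GRing.unit.
Proof. by apply/unitrPr; exists (1 - eps * c); exact: dual_inv. Qed.

Lemma dual_invE (c : A) : (1 + eps * c)^-1 = 1 - eps * c.
Proof. by apply: (mulrI (dual_unit c)); rewrite divrr ?dual_unit // dual_inv. Qed.

Lemma dual_exp (m : int) : (1 + eps) ^ m = 1 + eps * (m%:~R)%:A.
Proof.
have N (m' : nat) : (1 + eps) ^+ m' = 1 + eps * (m'%:R)%:A.
  elim: m' => [|m' IH]; first by rewrite expr0 scale0r mulr0 addr0.
  rewrite exprS IH mulrDr mulr1 mulrDl mul1r mulrA -expr2 eps2 mul0r addr0.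
  by rewrite -addrA mulrS scalerDl scale1r mulrDr mulr1.
case: m => m; first by rewrite -exprnP N.
by rewrite NegzE -exprnN N dual_invE mulrNz scaleNr mulrN.
Qed.

End Dual.

Section Torus.
Context (k : fieldType) (A : comUnitAlgType k).

Definition torw (t : A) : 'rV[A]_2 := \row_i (if i == 0 then t else t^-1).
Definition tor (t : A) : 'M[A]_2 := diag_mx (torw t).

Lemma torE (t : A) : t *: delta_mx 0 0 + t^-1 *: delta_mx 1 1 = tor t.
Proof.
apply/matrixP => i j; rewrite !mxE.
by case: i => [[|[|//]]] hi; case: j => [[|[|//]]] hj;
  rewrite /= !(mulr1, mulr0, addr0, add0r, mulr1n, mulr0n).
Qed.

Lemma det_tor (t : A) : t \is a GRing.unit -> \det (tor t) = 1.
Proof. by move=> tu; rewrite det_diag !big_ord_recl big_ord0 !mxE /= mulr1 divrr. Qed.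

(** The matrix unit [delta_mx i j] is an eigenvector for conjugation by [tor t]. *)
Lemma tor_conj (t c s : A) (i j : 'I_2) : torw t 0 i = s * torw t 0 j ->
  tor t *m (1%:M + c *: delta_mx i j) = (1%:M + (s * c) *: delta_mx i j) *m tor t.
Proof.
move=> h; rewrite mulmxDr mulmxDl mulmx1 mul1mx; congr (_ + _).
apply/matrixP => a b; rewrite mul_diag_mx mul_mx_diag ![in LHS]mxE ![in RHS]mxE.
case: andP => [[/eqP -> /eqP ->]|]; last by rewrite !mulr0 mul0r.
by move: h; rewrite !mxE !mulr1 => ->; ring.
Qed.

End Torus.

Section Adapted.
Context (gt : group_type) (n : nat) (k : fieldType) (val : k -> int).
Hypothesis hk : is_local_field val.
Local Notation d := (dimG gt n).
Local Notation w := (std_weight gt n).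
Context (Y H X : 'M[k]_d).
Context (lambda : forall A : comUnitAlgType k, A -> 'M[A]_d).
Context (g : 'M[k]_d) (gG : in_group gt n k g) (a : 'rV[int]_n).
Context (ha : cochar_in_torus lambda g a).
Context (phi : forall A : comAlgType k, 'M[A]_2 -> 'M[A]_d) (hphi : is_sl2_hom phi).
Hypothesis hlam : forall (A : comUnitAlgType k) (t : A), t \is a GRing.unit ->
          lambda t = phi (t *: delta_mx 0 0 + t^-1 *: delta_mx 1 1).

(** Apply the homomorphism over the dual numbers to the relation expressing that
    the torus of SL_2 normalises a root group, and compare the coefficients of [eps]. *)
Lemma lambda_scaled (A : comUnitAlgType k) (eps : A) (t : k) (Z : 'M[k]_d) (i j : 'I_2)
  (m : int) :
  eps ^+ 2 = 0 -> eps != 0 -> t != 0 -> i != j ->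
  torw (t%:A : A) 0 i = (t ^ m)%:A * torw (t%:A : A) 0 j ->
  differential_at phi (delta_mx i j) Z ->
  forall b c, t ^ wt b a * (invmx g *m Z *m g) b c = t ^ m *
    ((invmx g *m Z *m g) b c * t ^ wt c a).
Proof.
move=> e2 e0 t0 ij htor hZ b c.
have gu := in_group_unit gG.
pose f := @map_mx k A (in_alg A) d d.
have ta : (t%:A : A) \is a GRing.unit by apply: (rmorph_unit (in_alg A)); rewrite unitfE.
have D1 (ep : A) : ep ^+ 2 = 0 -> phi (1%:M + ep *: delta_mx i j) = 1%:M + ep *: f Z.
  by move=> /hZ; rewrite /f map_delta_mx.
have L := hlam ta; rewrite torE in L.
pose s : A := (t ^ m)%:A.
have eq1 : lambda (t%:A : A) *m (1%:M + eps *: f Z) = (1%:M + (s * eps) *: f Z) *m lambda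
  (t%:A : A).
  rewrite L -D1 // -D1; last by rewrite exprMn e2 mulr0.
  have dt := det_tor ta.
  have dd c' := @det_transvection A 2 i j c' ij.
  by rewrite -!(sl2_homM hphi) // (tor_conj eps htor).
have eq2 : lambda (t%:A : A) *m (eps *: f Z) = ((s * eps) *: f Z) *m lambda (t%:A : A).
  by move: eq1; rewrite mulmxDr mulmxDl mulmx1 mul1mx => /addrI.
set D := diag_mx (\row_l (t%:A : A) ^ pairing (w l) a).
have lE : lambda (t%:A : A) = f g *m D *m f (invmx g) by have [_ /(_ A _ ta)] := ha.
have gg : f (invmx g) *m f g = 1%:M by rewrite /f -map_mxM mulVmx // map_mx1.
have fZ : f (invmx g *m Z *m g) = f (invmx g) *m f Z *m f g by rewrite /f !map_mxM.
have eq2' : eps *: (lambda (t%:A : A) *m f Z) = (s * eps) *: (f Z *m lambda (t%:A : A)).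
  by rewrite scalemxAr eq2 scalemxAl.
have e5 : f (invmx g) *m (lambda (t%:A : A) *m f Z) *m f g = D *m f (invmx g *m Z *m g).
  by rewrite lE fZ -!mulmxA (mulmxA (f (invmx g)) (f g)) gg mul1mx.
have e6 : f (invmx g) *m (f Z *m lambda (t%:A : A)) *m f g = f (invmx g *m Z *m g) *m D.
  by rewrite lE fZ -!mulmxA gg mulmx1.
have eq3 : D *m (eps *: f (invmx g *m Z *m g)) = ((s * eps) *: f (invmx g *m Z *m g)) *m D.
  by rewrite -scalemxAr -scalemxAl -e5 -e6 [LHS]scalemxAl scalemxAr eq2' -scalemxAr
    -scalemxAl.
move: eq3; clear fZ e5 e6; move: (invmx g *m Z *m g) => z eq3.
have /matrixP/(_ b c) := eq3; rewrite mul_diag_mx mul_mx_diag ![in LHS]mxE ![in RHS]mxE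
  -!/(wt _ _).
have hx q : (t%:A : A) ^ q = (t ^ q)%:A by rewrite -[_ %:A]/(in_alg A t)
  -[RHS]/(in_alg A _) rmorphXz // unitfE.
rewrite !hx /s => h5; apply: (eps_inj e0).
rewrite /= in h5; rewrite -![_ %:A]/(in_alg A _) !rmorphM /=.
by rewrite mulrCA h5; ring.
Qed.

(** Take for [t] a uniformiser: its powers are told apart by their valuations. *)
Lemma adapted_support (Z : 'M[k]_d) (i j : 'I_2) (m : int) : i != j ->
  (forall (A : comUnitAlgType k) (t : k), t != 0 ->
    torw (t%:A : A) 0 i = (t ^ m)%:A * torw (t%:A : A) 0 j) ->
  differential_at phi (delta_mx i j) Z ->
  forall b c, (invmx g *m Z *m g) b c != 0 -> wt b a = wt c a + m.
Proof.
move=> ij htor hZ b c nz; have [A [eps [e2 e0]]] := dual_numbers k.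
have [pi [pi0 vpi]] := val_normalized hk.
have h := lambda_scaled e2 e0 pi0 ij (htor A pi pi0) hZ b c.
have := congr1 val h; rewrite !(Defs.valM hk) ?mulf_neq0 ?expfz_neq0 // !(valXz hk) //
  vpi !mul1r.
lia.
Qed.

Lemma adapted_X : differential_at phi (sl2_e k) X ->
  forall b c, (invmx g *m X *m g) b c != 0 -> wt b a = wt c a + 2.
Proof.
apply: adapted_support => // A t t0; rewrite !mxE /=.
have tu : in_alg A t \is a GRing.unit by apply: (rmorph_unit (in_alg A)); rewrite unitfE.
by rewrite -exprnP -![_ %:A]/(in_alg A _) rmorphXn /= expr2 mulrK.
Qed.

Lemma adapted_Y : differential_at phi (sl2_f k) Y ->
  forall b c, (invmx g *m Y *m g) b c != 0 -> wt b a = wt c a - 2.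
Proof.
apply: adapted_support => // A t t0; rewrite !mxE /=.
have tu : in_alg A t \is a GRing.unit by apply: (rmorph_unit (in_alg A)); rewrite unitfE.
have -> : (t ^ (-2))%:A = ((t%:A : A) ^+ 2)^-1.
  by rewrite (_ : t ^ (-2) = (t ^+ 2)^-1) // -![_ %:A]/(in_alg A _) rmorphV ?unitfE
    ?expf_neq0 // rmorphXn.
by rewrite expr2 invrM // mulrVK.
Qed.

(** The differential of the one-parameter subgroup is read off at [1 + eps]. *)
Lemma adapted_H : differential_at phi (sl2_h k) H ->
  invmx g *m H *m g = diag_mx (\row_i (wt i a)%:~R).
Proof.
move=> hH; have [A [eps [e2 e0]]] := dual_numbers k.
have gu := in_group_unit gG.
pose f := @map_mx k A (in_alg A) d d.
have tu : 1 + eps \is a GRing.unit by rewrite -[eps]mulr1; exact: dual_unit.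
have L := hlam tu.
have tE : (1 + eps) *: delta_mx 0 0 + (1 + eps)^-1 *: delta_mx 1 1 = 1%:M + eps *: map_mx
  (in_alg A) (sl2_h k) :> 'M[A]_2.
  rewrite torE; apply/matrixP => i j; rewrite !mxE.
  have -> : (1 + eps)^-1 = 1 - eps by rewrite -{1}[eps]mulr1 dual_invE // mulr1.
  case: i => [[|[|//]]] hi; case: j => [[|[|//]]] hj;
    rewrite /= ?subr0 ?sub0r ?mulr0n ?mulr1n ?subrr ?scale0r ?mulr0 ?addr0 ?scaleN1r
    ?scale1r ?mulr1 ?mulrN1 //.
rewrite tE hH // in L.
set D := diag_mx (\row_l (1 + eps) ^ pairing (w l) a).
have lE : lambda (1 + eps) = f g *m D *m f (invmx g) by have [_ /(_ A _ tu)] := ha.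
have gg : f (invmx g) *m f g = 1%:M by rewrite /f -map_mxM mulVmx // map_mx1.
have eq3 : D = 1%:M + eps *: f (invmx g *m H *m g).
  have := congr1 (fun M => f (invmx g) *m M *m f g) L; rewrite lE.
  rewrite -!mulmxA gg mulmx1 mulmxA gg mul1mx => ->.
  by rewrite mulmxDl mulmxDr mul1mx gg -scalemxAl -scalemxAr /f !map_mxM !mulmxA.
apply/matrixP => i j; apply: (eps_inj e0).
have /matrixP/(_ i j) := eq3; rewrite [in X in X -> _]mxE [in X in _ = X -> _]mxE => h.
rewrite mxE mxE; move: h; rewrite !mxE -/(wt _ _).
have [->|ij] := eqVneq i j; last by rewrite !mulr0n add0r scale0r mulr0 => <-.
by rewrite !mulr1n (dual_exp e2) => /addrI ->.
Qed.

End Adapted.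

(** * Diagonalisation inside a parahoric subgroup *)

Section Pol.
Context (k : fieldType) (d : nat).
Implicit Types (M : 'M[k]_d) (es : seq k).

(** This vanishes when [M] is diagonalisable with eigenvalues in [es], and then
    omitting one factor gives a multiple of a spectral projection. *)
Definition prod_sub es M : 'M[k]_d := foldr (fun al P => (M - al%:M) *m P) 1%:M es.

Lemma prod_sub_comm es M : M *m prod_sub es M = prod_sub es M *m M.
Proof.
elim: es => [|al es IH]; first by rewrite mul1mx mulmx1.
rewrite /= -mulmxA -IH !mulmxA; congr (_ *m _).
by rewrite mulmxBr mulmxBl scalar_mxC.
Qed.

Lemma prod_sub_rem al es M : al \in es ->
  prod_sub es M = (M - al%:M) *m prod_sub (rem al es) M.
Proof.
elim: es => // be es IH; rewrite in_cons /=; have [->|ne] := eqVneq be al; first by [].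
rewrite /= => /IH ->; rewrite !mulmxA; congr (_ *m _).
rewrite !mulmxBl !mulmxBr -!scalar_mxM [al * be]mulrC !scalar_mxC.
by rewrite !opprB addrACA [RHS]addrACA; congr (_ + _); rewrite addrC.
Qed.

Lemma prod_sub_conj es M u : u \in unitmx ->
  prod_sub es (invmx u *m M *m u) = invmx u *m prod_sub es M *m u.
Proof.
move=> uu; elim: es => [|al es IH] /=; first by rewrite mulmx1 mulVmx.
have -> : invmx u *m M *m u - al%:M = invmx u *m (M - al%:M) *m u.
  by rewrite mulmxBr mulmxBl -[_ *m al%:M *m u]mulmxA -scalar_mxC mulKmx.
by rewrite IH -!mulmxA mulKVmx.
Qed.

Lemma prod_sub_col es M (v : 'cV[k]_d) al : M *m v = al *: v ->
  prod_sub es M *m v = (\prod_(be <- es) (al - be)) *: v.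
Proof.
move=> h; elim: es => [|be es IH] /=; first by rewrite big_nil mul1mx scale1r.
rewrite big_cons -mulmxA IH -scalemxAr mulmxBl h mul_scalar_mx -scalerBl scalerA mulrC.
  by [].
Qed.

Lemma prod_sub_row es M (f : 'rV[k]_d) al : f *m M = al *: f ->
  f *m prod_sub es M = (\prod_(be <- es) (al - be)) *: f.
Proof.
move=> h; elim: es => [|be es IH] /=; first by rewrite big_nil mulmx1 scale1r.
by rewrite big_cons mulmxA mulmxBr h mul_mx_scalar -scalerBl -scalemxAl IH scalerA.
Qed.

(** The last nonzero partial product applied to [v] is an eigenvector.  It lies in
    every hyperplane that is stable under [M] and contains [v]. *)
Lemma prod_sub_eigenvector es M (v : 'cV[k]_d) : v != 0 -> prod_sub es M *m v = 0 ->
  exists al (u : 'cV[k]_d), [/\ al \in es, u != 0, M *m u = al *: u &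
    forall (f : 'rV[k]_d) ga, f *m M = ga *: f -> f *m v = 0 -> f *m u = 0].
Proof.
elim: es => [|al es IH] v0 /=; first by rewrite mul1mx => e; rewrite e eqxx in v0.
have [e _|ne h] := eqVneq (prod_sub es M *m v) 0.
  by have [be [u [h1 h2 h3 h4]]] := IH v0 e; exists be, u; split=> //;
    rewrite in_cons h1 orbT.
exists al, (prod_sub es M *m v); split=> //; first by rewrite in_cons eqxx.
  apply/eqP; rewrite -subr_eq0 -mul_scalar_mx -mulmxBl; apply/eqP.
  by rewrite mulmxA.
by move=> f ga h1 h2; rewrite mulmxA (prod_sub_row _ h1) -scalemxAl h2 scaler0.
Qed.

(** The i-th coordinate vector is an eigenvector of [M] and of its transpose. *)
Definition eigen_coord M i := forall b, b != i -> M i b = 0 /\ M b i = 0.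

Lemma eigen_coord_row M i : eigen_coord M i ->
  (delta_mx 0 i : 'rV[k]_d) *m M = M i i *: delta_mx 0 i.
Proof.
move=> h; apply/rowP => b; rewrite -rowE !mxE eqxx /=.
by have [->|/h[-> _]] := eqVneq b i; rewrite ?mulr1 // mulr0.
Qed.

Lemma eigen_coord_col M i : eigen_coord M i ->
  M *m (delta_mx i 0 : 'cV[k]_d) = M i i *: delta_mx i 0.
Proof.
move=> h; apply/colP => b; rewrite -colE !mxE eqxx andbT.
by have [->|/h[_ ->]] := eqVneq b i; rewrite ?mulr1 // mulr0.
Qed.

Lemma eigen_coordM M N i : eigen_coord M i -> eigen_coord N i -> eigen_coord (M *m N) i.
Proof.
move=> hM hN b bi; split; rewrite mxE (bigD1 i) //= big1 ?addr0.
- by rewrite (hN _ bi).1 mulr0.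
- by move=> c ci; rewrite (hM _ ci).1 mul0r.
- by rewrite (hM _ bi).2 mul0r.
- by move=> c ci; rewrite (hN _ ci).2 mulr0.
Qed.

Lemma trivial_eigen_coord p i : trivial_at p i -> eigen_coord p i.
Proof. by move=> [h1 h2] b bi; rewrite h1 h2 eq_sym (negPf bi). Qed.

Lemma trivial_eigen_coordV p i : p \in unitmx -> trivial_at p i -> eigen_coord (invmx p) i.
Proof.
move=> pu [h1 h2].
have : isolated_entry (invmx p) i i.
  apply: isolated_inv => //; split; first by rewrite h1 eqxx oner_neq0.
    by move=> a ai; rewrite h2 (negPf ai).
  by move=> a ai; rewrite h1 eq_sym (negPf ai).
by move=> [_ h3 h4] b bi; rewrite h3 ?h4.
Qed.

End Pol.

Section Diagonalize.
Context (gt : group_type) (n : nat) (k : fieldType) (val : k -> int) (R : realType).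
Hypothesis hk : is_local_field val.
Local Notation d := (dimG gt n).
Local Notation G := (in_group gt n k).
Local Notation g_ := (in_lie gt n k).
Local Notation para := (@parahoric gt n k val R).

Lemma eigen_coord_star (M : 'M[k]_d) i : g_ M -> eigen_coord M i -> eigen_coord M (star i).
Proof.
move: M i; rewrite /eigen_coord; case: gt => // M i /in_lieSpP gM h b bi.
have bi' : star b != i by apply: contra_neq bi => <-; rewrite starK.
by rewrite (gM (star i) b) (gM b (star i)) !starK (h _ bi').1 (h _ bi').2 !mulr0 !oppr0.
Qed.

Lemma filt_prod_sub (x : 'rV[R]_n) es (M : 'M[k]_d) : filt val true x x 0 M ->
  (forall al, al \in es -> vb val true (0 : R) al) -> filt val true x x 0 (prod_sub es M).
Proof.
move=> hM; elim: es => [|al es IH] h /=; first exact: filt1.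
rewrite -[0]addr0; apply: filtM => //; last by apply: IH => be hb; apply: h;
  rewrite in_cons hb orbT.
apply: filtD => // i j; rewrite !mxE; have [->|_] := eqVneq i j; last by left;
  rewrite mulr0n oppr0.
by rewrite mulr1n add0r subrr; apply: vbN => //; apply: h; rewrite in_cons eqxx.
Qed.

Lemma para_filt_conj (x : 'rV[R]_n) (u M : 'M[k]_d) : para x u -> filt val true x x 0 M ->
  filt val true x x 0 (invmx u *m M *m u).
Proof.
move=> hu hM; rewrite -[0]addr0; apply: filtM => //; last exact: para_filt.
by rewrite -[0]addr0; apply: filtM => //; apply: para_filt => //; exact: paraV.
Qed.

(** Take an eigenvector [v] orthogonal to the coordinates already treated, and move
    it to a coordinate vector by [col_clear].  The spectral projection for its
    eigenvalue is integral at [x] because differences of eigenvalues are units; its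
    i-th row is a left eigenvector, which [row_clear] moves to a coordinate form. *)
Theorem diagonalize (x : 'rV[R]_n) (M : 'M[k]_d) es : g_ M -> filt val true x x 0 M ->
  uniq es -> (forall al, al \in es -> vb val true (0 : R) al) ->
  (forall al be, al \in es -> be \in es -> al != be -> val (al - be) = 0) ->
  prod_sub es M = 0 ->
  exists2 u, para x u & is_diag_mx (invmx u *m M *m u).
Proof.
move=> + + ues ies des.
have [m] := ubnP #|[pred i : 'I_d | ~~ `[< eigen_coord M i >]]|.
elim: m M => // m IH M hm gM fM pM.
have [i0 hi0|h0] := pickP (fun i : 'I_d => ~~ `[< eigen_coord M i >]); last first.
  exists 1%:M; first by constructor.
  rewrite invmx1 mul1mx mulmx1; apply/is_diag_mxP => i j ij.
  have /negbFE/asboolP h := h0 i; apply: (h j _).1.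
  by rewrite eq_sym -(inj_eq val_inj).
move/asboolPn in hi0.
have e0 : (delta_mx i0 0 : 'cV[k]_d) != 0.
  by apply/eqP => /colP/(_ i0); rewrite !mxE !eqxx => /eqP; rewrite oner_eq0.
have [|al [v [ale v0 Mv hv]]] := prod_sub_eigenvector (es := es) (M := M) e0;
  first by rewrite pM mul0mx.
(* The eigenvector vanishes at the coordinates already treated, as the coordinate
   vector from which it was produced does. *)
have vdone a : eigen_coord M a -> v a 0 = 0.
  move=> ha; have aid : i0 != a by apply: contra_notN hi0 => /eqP ->.
  have := hv _ _ (eigen_coord_row ha); rewrite mul_delta_mx_0 1?eq_sym // => /(_ erefl).
  by rewrite -rowE => /matrixP/(_ 0 0); rewrite !mxE.
have [j0 vj0] : exists j, v j 0 != 0.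
  have [j hj|hz] := pickP (fun j => v j 0 != 0); first by exists j.
  by move: v0; rewrite (_ : v = 0) ?eqxx //; apply/colP => j; rewrite mxE; apply/eqP;
    have := hz j => /negbFE.
have [i vi hmin] := @arg_minP _ _ _ j0 (fun l => v l 0 != 0) (fun l =>
  (val (v l 0))%:~R + wt l x : R) vj0.
have b1 : col_bounded val ((val (v i 0))%:~R + wt i x) x v.
  move=> l; have [->|nz] := eqVneq (v l 0) 0; first by left.
  by right; have := hmin _ nz; rewrite /=; lra.
have [p [pp pv pi pt]] := col_clear hk vi b1.
have pG := para_group hk pp; have pu := in_group_unit pG.
pose M1 := p *m M *m invmx p.
have M1E : M1 = invmx (invmx p) *m M *m invmx p by rewrite invmxK.
have gM1 : g_ M1 by apply: in_lieJV.
have fM1 : filt val true x x 0 M1 by rewrite M1E; apply: para_filt_conj => //; exact: paraV.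
have pM1 : prod_sub es M1 = 0 by rewrite M1E prod_sub_conj ?unitmx_inv // pM mulmx0 mul0mx.
have M1i : M1 *m delta_mx i 0 = al *: (delta_mx i 0 : 'cV[k]_d).
  have -> : (delta_mx i 0 : 'cV[k]_d) = (v i 0)^-1 *: (p *m v) by rewrite pv scalerA
    mulVf // scale1r.
  by rewrite /M1 -scalemxAr -!mulmxA (mulmxA (invmx p)) mulVmx // mul1mx Mv -!scalemxAr
    scalerA mulrC -scalerA.
have ndone a : eigen_coord M a -> [/\ a != i, star a != i & v (star a) 0 = 0].
  move=> ha; have hsa := eigen_coord_star gM ha; split; last exact: vdone.
    by apply: contraNneq vi => <-; rewrite vdone.
  by apply: contraNneq vi => <-; rewrite vdone.
have done1 a : eigen_coord M a -> eigen_coord M1 a.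
  move=> ha; have [n1 n2 n3] := ndone a ha.
  have ta : trivial_at p a by apply: pt => //;
    [exact: vdone | apply: contra_neq n2 => ->; rewrite starK].
  by apply: eigen_coordM; [apply: eigen_coordM => //;
    exact: trivial_eigen_coord|exact: trivial_eigen_coordV].
clearbody M1.
pose P := prod_sub (rem al es) M1.
pose f : 'rV[k]_d := row i P.
have fE : f = delta_mx 0 i *m P by rewrite /f rowE.
pose c := \prod_(be <- rem al es) (al - be).
have Pcol : P *m delta_mx i 0 = c *: (delta_mx i 0 : 'cV[k]_d) by exact: prod_sub_col.
have cprop : c != 0 /\ val c = 0.
  have : forall be, be \in rem al es -> be \in es /\ be != al.
    by move=> be; rewrite (mem_rem_uniq _ ues) inE => /andP[-> ->].
  rewrite /c; elim: (rem al es) => [|be s IHs] hs;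
    first by rewrite big_nil oner_neq0 (val1 hk).
  have [|c0 vc] := IHs; first by move=> z hz; apply: hs; rewrite in_cons hz orbT.
  have [be1 be2] := hs be (mem_head _ _).
  have n0 : al - be != 0 by rewrite subr_eq0 eq_sym.
  by rewrite big_cons mulf_neq0 // (Defs.valM hk) // vc des // eq_sym.
have [c0 vc] := cprop.
have fi : f 0 i = c.
  have /colP/(_ i) := Pcol; rewrite -colE !mxE !eqxx mulr1 => <-. by [].
(* The remaining factor [M1 - al] kills the product. *)
have fM1' : f *m M1 = al *: f.
  apply/eqP; rewrite -subr_eq0 -mul_mx_scalar -mulmxBr fE -mulmxA; apply/eqP.
  suff -> : P *m (M1 - al%:M) = 0 by rewrite mulmx0.
  by rewrite mulmxBr -prod_sub_comm scalar_mxC -mulmxBl -prod_sub_rem.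
have fdone a : eigen_coord M1 a -> a != i -> f 0 a = 0.
  move=> ha ai; have := prod_sub_col (rem al es) (eigen_coord_col ha);
    rewrite -/P -colE => /colP/(_ i).
  by rewrite !mxE eqxx andbT [i == a]eq_sym (negPf ai) mulr0 => <-.
have [||q [pq qv qi qt]] := @row_clear gt n k val R hk x f i.
- by rewrite fi.
- move=> l; rewrite fi vc mxE.
  have -> : 0%:~R - wt i x + wt l x = 0 + wt l x - wt i x by ring.
  by apply: filt_prod_sub => // be /mem_rem; exact: ies.
rewrite fi in qv.
have qG := para_group hk pq; have qu := in_group_unit qG.
pose M2 := invmx q *m M1 *m q.
have gM2 : g_ M2 by apply: in_lieJ.
have fM2 : filt val true x x 0 M2 by apply: para_filt_conj.
have pM2 : prod_sub es M2 = 0 by rewrite prod_sub_conj // pM1 mulmx0 mul0mx.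
have qdi : q *m delta_mx i 0 = (delta_mx i 0 : 'cV[k]_d).
  by rewrite -colE; apply/colP => b; rewrite !mxE qi eqxx andbT.
have new : eigen_coord M2 i.
  have h1 : M2 *m delta_mx i 0 = al *: (delta_mx i 0 : 'cV[k]_d).
    by rewrite /M2 -!mulmxA qdi M1i -scalemxAr -{1}qdi mulKmx.
  have h2 : delta_mx 0 i *m M2 = al *: (delta_mx 0 i : 'rV[k]_d).
    have -> : (delta_mx 0 i : 'rV[k]_d) = c^-1 *: (f *m q) by rewrite qv scalerA mulVf //
      scale1r.
    by rewrite -scalemxAl /M2 -!mulmxA mulKVmx // mulmxA fM1' -scalemxAl scalerA mulrC
      -scalerA.
  move=> b bi; split.
    by have /rowP/(_ b) := h2; rewrite -rowE !mxE (negPf bi) mulr0.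
  by have /colP/(_ b) := h1; rewrite -colE !mxE (negPf bi) mulr0.
have done2 a : eigen_coord M a -> eigen_coord M2 a.
  move=> ha; have [n1 n2 n3] := ndone a ha; have ha1 := done1 a ha.
  have hsa1 : eigen_coord M1 (star a) by apply: eigen_coord_star.
  have ta : trivial_at q a.
    apply: qt => //; [exact: fdone|exact: fdone|].
    by apply: contra_neq n2 => ->; rewrite starK.
  by apply: eigen_coordM; [apply: eigen_coordM => //;
    exact: trivial_eigen_coordV|exact: trivial_eigen_coord].
have [||//|//|u pu' hu] := IH M2.
- rewrite ltnS in hm; apply: leq_trans hm; apply: proper_card; apply/properP; split.
    apply/fintype.subsetP => b; rewrite !inE => /asboolPn h; apply/asboolPn.
    by apply: contra_not h; exact: done2.
  exists i; rewrite !inE; last by rewrite negbK; apply/asboolP.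
  by apply/asboolPn => /vdone e; rewrite e eqxx in vi.
- exact: gM2.
exists (invmx p *m q *m u); first by apply: paraM => //; apply: paraM => //; exact: paraV.
have uu := in_group_unit (para_group hk pu').
rewrite !invmx_mul ?unitmx_mul ?unitmx_inv ?pu ?qu // invmxK.
by move: hu; rewrite /M2 M1E invmxK !mulmxA.
Qed.

End Diagonalize.

(** * Lifting the eigenvalues of H *)

Section Steps.
Context (T : comNzRingType) (d : nat) (c : 'I_d -> T).
Hypothesis hT : forall m, (0 < m <= d)%N -> (2 * m)%:R != 0 :> T.

(** The [d.+1] elements obtained by subtracting 2, 4, ... from [z] are distinct, so
    they are not all among the [d] values of [c]. *)
Lemma steps_ex z : exists l, z - (2 * l.+1)%:R \notin codom c.
Proof.
apply: contrapT => hn.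
have h l : z - (2 * l.+1)%:R \in codom c by apply/negPn/negP => hl; apply: hn; exists l.
pose s := [seq z - (2 * l.+1)%:R | l <- iota 0 d.+1].
have us : uniq s.
  rewrite map_inj_in_uniq ?iota_uniq // => l l'; rewrite !mem_iota !add0n /= => hl hl' e.
  have key a b : (a < b < d.+1)%N -> z - (2 * a.+1)%:R = z - (2 * b.+1)%:R -> False.
    rewrite ltnS => /andP[ab bd] /addrI/oppr_inj eab; have := hT (m := b - a).
    rewrite subn_gt0 ab /= => /(_ (leq_trans (leq_subr _ _) bd)).
    have -> : (2 * (b - a))%:R = (2 * b.+1)%:R - (2 * a.+1)%:R :> T.
      by rewrite -natrB; [congr _%:R; lia | lia].
    by rewrite eab subrr eqxx.
  case: (ltngtP l l') => // hll; first by case: (key l l'); rewrite ?hll.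
  by case: (key l' l); rewrite ?hll.
have : (size s <= size (codom c))%N by apply: uniq_leq_size => // _ /mapP[l _ ->].
by rewrite size_map size_iota size_codom card_ord ltnn.
Qed.

(** The number of consecutive values z - 2, z - 4, ... taken by [c]. *)
Definition steps z : nat := ex_minn (steps_ex z).

Lemma steps_in z t : (t < steps z)%N -> z - (2 * t.+1)%:R \in codom c.
Proof.
rewrite /steps; case: ex_minnP => l _ hmin tl; apply/negPn/negP => h.
by have := hmin _ h; rewrite leqNgt tl.
Qed.

Lemma steps_succ z : z \in codom c -> steps (z + 2) = (steps z).+1.
Proof.
move=> hz; rewrite {1}/steps; case: ex_minnP => l hl hmin.
case: l hl hmin => [|l] hl hmin; first by rewrite muln1 addrK hz in hl.
have E t : z + 2 - (2 * t.+2)%:R = z - (2 * t.+1)%:R.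
  by rewrite mulnS natrD; ring.
rewrite E in hl; congr _.+1; rewrite /steps; case: ex_minnP => l' hl' hmin'.
apply/eqP; rewrite eqn_leq hmin' // andbT -ltnS; apply: hmin.
by rewrite E.
Qed.

End Steps.

Section Potential.
Context (gt : group_type) (n : nat) (k : fieldType) (R : realType).
Local Notation d := (dimG gt n).

(** The position of an eigenvalue in its chain of step 2 rises by 1 when the
    eigenvalue rises by 2, so its double is a lift for SL, once its mean has been
    subtracted.  For Sp the difference between the positions of an eigenvalue and of
    its opposite is a lift, and it is antisymmetric. *)
Lemma potential (c : 'I_d -> k) : (0 < n)%N ->
  (forall m, (0 < m <= d)%N -> (2 * m)%:R != 0 :> k) ->
  (gt = Sp -> forall i, c (star i) = - c i) ->
  exists2 b : 'rV[R]_n, in_cochar gt n R b &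
    forall i j, c i - c j = 2 -> wt i b - wt j b = 2.
Proof.
move=> n0 hT hc.
pose l z : R := (steps c hT z)%:R.
have lS i j : c i - c j = 2 -> l (c i) = l (c j) + 1.
  move=> e; rewrite /l (_ : c i = c j + 2); last by rewrite -e addrC subrK.
  by rewrite (steps_succ hT) ?codom_f // -natr1.
clearbody l.
move: c hT hc lS; rewrite /in_cochar; case: gt => c hT hc lS.
  pose mean := (\sum_(i < n) 2 * l (c i)) / n%:R.
  exists (\row_i (2 * l (c i) - mean)).
    under eq_bigr do rewrite mxE.
    rewrite sumrB sumr_const card_ord -[mean *+ _]mulr_natr /mean mulfVK ?subrr //.
    by rewrite pnatr_eq0 -lt0n.
  by move=> i j /lS e; rewrite !wtSL !mxE e; ring.
exists (\row_i (l (c (lshift n i : 'I_(dimG Sp n))) - l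
  (- c (lshift n i : 'I_(dimG Sp n))))) => //.
have wE (i : 'I_(dimG Sp n)) : wt i
  (\row_i (l (c (lshift n i : 'I_(dimG Sp n))) - l (- c (lshift n i : 'I_(dimG Sp n)))))
  = l (c i) - l (- c i).
  move: i; apply: lr_case => i; first by rewrite wtSp_l mxE.
  rewrite wtSp_r mxE.
  have -> : c (rshift n i) = - c (lshift n i) by rewrite -(hc erefl) star_l.
  by rewrite opprK opprB.
move=> i j e; rewrite !wE (lS _ _ e).
have e' : c (star j) - c (star i) = 2 by rewrite !(hc erefl) opprK addrC.
by have := lS _ _ e'; rewrite !(hc erefl) => ->; ring.
Qed.

End Potential.

(** If no entry of [X] or [Y] links [S] to its complement, the bracket of [X] and [Y]
    restricted to [S] is a commutator and has trace 0. *)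
Lemma trace_closed (k : comNzRingType) d (X Y : 'M[k]_d) (S : pred 'I_d) :
  (forall i j, X i j != 0 -> S i = S j) -> (forall i j, Y i j != 0 -> S i = S j) ->
  \sum_(i | S i) (X *m Y - Y *m X) i i = 0.
Proof.
move=> hX hY.
have E (U V : 'M[k]_d) : (forall i j, U i j != 0 -> S i = S j) ->
    \sum_(i | S i) (U *m V) i i = \sum_(i | S i) \sum_(j | S j) U i j * V j i.
  move=> hU; apply: eq_bigr => i Si; rewrite mxE [RHS]big_mkcond /=; apply: eq_bigr => j _.
  have [->|/hU <-] := eqVneq (U i j) 0; first by rewrite mul0r if_same.
  by rewrite Si.
have -> : \sum_(i | S i) (X *m Y - Y *m X) i i = \sum_(i | S i) (X *m Y) i i -
  \sum_(i | S i) (Y *m X) i i.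
  by rewrite -sumrB; apply: eq_bigr => i _; rewrite !mxE.
rewrite !E // [X in _ - X]exchange_big /=; apply/eqP; rewrite subr_eq0; apply/eqP.
by apply: eq_bigr => i _; apply: eq_bigr => j _; rewrite mulrC.
Qed.

Section Bounds.
Context (k : fieldType) (d : nat) (X Y : 'M[k]_d) (a : 'I_d -> int).
Hypothesis hX : forall i j, X i j != 0 -> a i = a j + 2.
Hypothesis hY : forall i j, Y i j != 0 -> a i = a j - 2.
Hypothesis hH : forall i, (X *m Y - Y *m X) i i = (a i)%:~R.
Hypothesis char0 : forall m : int, m%:~R = 0 :> k -> m = 0.

Let hT m : (0 < m <= d)%N -> (2 * m)%:R != 0 :> int.
Proof. by move=> /andP[m0 _]; rewrite natz; lia. Qed.

Let st i := steps a hT (a i).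
Let e i : int := a i - (2 * st i)%:R.
Let N i := #|[pred j | e j == e i]|.

Let stS i j : a i = a j + 2 -> st i = (st j).+1 /\ e i = e j.
Proof.
move=> h; have hs : st i = (st j).+1 by rewrite /st h (steps_succ hT) ?codom_f.
by split=> //; rewrite /e hs h mulnS natrD; ring.
Qed.

Let st_lt i j : e j == e i -> (st j < N i)%N.
Proof.
have sub m j' : st j' = m -> e j' == e i -> forall t, (t <= m)%N ->
  exists2 j, e j == e i & st j = t.
  elim: m j' => [|m IH] j' sj ej t.
    by rewrite leqn0 => /eqP ->; exists j'.
  rewrite leq_eqVlt => /predU1P[->|]; first by exists j'.
  have : a j' - (2 * 1)%:R \in codom a by apply: (steps_in (hT := hT));
    rewrite -/(st j') sj.
  move=> /codomP[l hl]; have [h1 h2] : st j' = (st l).+1 /\ e j' = e l.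
    by apply: stS; rewrite -hl subrK.
  rewrite ltnS => tm; apply: (IH l) => //; last by rewrite -h2.
  by move: sj; rewrite h1 => -[].
move=> ej; rewrite /N cardE -(size_map st) -(size_iota 0 (st j).+1).
apply: uniq_leq_size; first exact: iota_uniq.
move=> t; rewrite mem_iota add0n /= ltnS => /(sub _ _ erefl ej)[l el <-].
by apply: map_f; rewrite mem_enum inE.
Qed.

Let N_le i : (N i <= d)%N.
Proof. by rewrite -[X in (_ <= X)%N]card_ord; apply: max_card. Qed.

Let sum0 i : \sum_(j | e j == e i) a j = 0.
Proof.
apply: char0; rewrite rmorph_sum /=; under eq_bigr do rewrite -hH.
apply: trace_closed => b c.
  by move=> /hX/stS[_ ->].
by move=> /hY h; have [|_ ->//] := @stS c b; rewrite h; ring.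
Qed.

Let e_bound i : - (2 * (N i).-1)%:R <= e i <= 0.
Proof.
have Ni : (0 < N i)%N by apply: leq_ltn_trans (@st_lt i i (eqxx _)).
have h : (N i)%:R * e i + (2 * \sum_(j | e j == e i) st j)%:R = 0.
  rewrite -(sum0 i) -[RHS](@eq_bigr _ _ _ _ _ _ (fun j => e i + (2 * st j)%:R)); last first.
    by move=> j /eqP <-; rewrite /e subrK.
  by rewrite big_split /= sumr_const mulr_natl big_distrr /= natr_sum.
have : (\sum_(j | e j == e i) st j <= N i * (N i).-1)%N.
  rewrite -sum_nat_const; apply: leq_sum => j ej.
  by rewrite -ltnS prednK //; apply: st_lt.
move: h Ni; set s := (\sum_(j | _) st j)%N; move: (N i) (e i) => m z.
rewrite !natz; case: m => // m h _ /= hs; apply/andP; split; nia.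
Qed.

(** The weights in a chain of step 2 add up to 0, being the trace of a commutator.
    So 0 lies between the ends of every chain, which bounds the weights by the
    length of their chain; the lengths of two different chains add up to at most [d]. *)
Lemma weight_diff_bound i j : `|a i - a j| <= (2 * d.-1)%:R.
Proof.
have ae l : a l = e l + (2 * st l)%:R by rewrite /e subrK.
have si := @st_lt i i (eqxx _); have sj := @st_lt j j (eqxx _).
have ei := e_bound i; have ej := e_bound j.
have ni := N_le i; have nj := N_le j.
have [eij|eij] := eqVneq (e i) (e j).
  have sj' : (st j < N i)%N by apply: st_lt; rewrite eij.
  rewrite !ae eij !natz; move: si sj' ni; move: (st i) (st j) (N i) (e j) => *; lia.
have nij : (N i + N j <= d)%N.
  rewrite -[X in (_ <= X)%N]card_ord -cardUI [X in (_ + X)%N](_ : _ = 0)%N ?addn0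
    ?max_card //.
  by apply: eq_card0 => l; rewrite !inE; apply/negP => /andP[/eqP -> /eqP h];
    rewrite h eqxx in eij.
rewrite !ae !natz; rewrite !natz in ei ej; move: si sj ei ej nij;
  move: (st i) (st j) (N i) (N j) (e i) (e j) => *; lia.
Qed.

End Bounds.

Section Residue.
Context (k : fieldType) (val : k -> int) (p : nat).
Hypothesis hk : is_local_field val.
Hypothesis hp : residue_char val p.

(** Bezout: an integer prime to p generates the unit ideal together with p. *)
Lemma int_val0 (R : realType) (m : int) : ~~ (p %| `|m|)%N ->
  m%:~R != 0 :> k /\ val (m%:~R) = 0.
Proof.
move=> pm; have [pp vp] := hp.
have cop : coprime `|m| p by rewrite coprime_sym prime_coprime.
have [u [v e]] : exists u v : int, u * m + v * p%:Z = 1.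
  have /coprimezP[[u v] /= huv] : coprimez m p by rewrite /coprimez /gcdz /=
    -[X in X == _]/(gcdn _ _ : int) (eqP cop).
  by exists u, v.
have ek : u%:~R * m%:~R + v%:~R * p%:R = 1 :> k.
  by rewrite -[p%:R]/((p : int)%:~R) -!intrM -intrD e.
have V (x : k) : vb val true (1 : R) (x) -> forall z : int, vb val true (1 : R) (z%:~R * x).
  by move=> hx z; rewrite -[1 : R]add0r; apply: vbM => //; exact: vb_int.
have vp' : vb val true (1 : R) (p%:R : k) by have /(vgeP _ R) := vp.
have n1 : ~ vb val true (1 : R) (1 : k).
  by move=> [/eqP|]; rewrite ?oner_eq0 // (val1 hk) /= ler10.
have nm : ~ vb val true (1 : R) (m%:~R : k).
  by move=> hm; apply: n1; rewrite -ek; apply: vbD => //; apply: V.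
have m0 : m%:~R != 0 :> k by apply: contra_notN nm => /eqP ->; left.
split=> //; have : vb val true (0 : R) (m%:~R : k) by apply: vb_int.
rewrite vb_neq0 //= => h0.
have h1 : ~ (1 : R) <= (val (m%:~R))%:~R by move=> h; apply: nm; right.
move: h0 h1; rewrite -[0 : R]/(0%:~R) -[1 : R]/(1%:~R) !ler_int => h0 /negP; lia.
Qed.

Lemma char0_int (R : realType) : p%:R != 0 :> k -> forall m : int, m%:~R = 0 :> k -> m = 0.
Proof.
move=> p0; have [pp _] := hp.
have N (m : nat) : m%:R = 0 :> k -> m = 0%N.
  have [b] := ubnP m; elim: b m => // b IH m mb m0.
  have [pm|pm] := boolP (p %| m)%N; last first.
    by have [] := int_val0 R (m := m) pm; rewrite -[_%:~R]/(m%:R) m0 eqxx.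
  move: pm mb m0 => /dvdnP[q ->] mb; rewrite natrM => /eqP;
    rewrite mulf_eq0 (negPf p0) orbF => /eqP q0.
  have [->//|qn] := eqVneq q 0%N.
  by rewrite (IH q) //; have := prime_gt1 pp; move: qn mb; rewrite -lt0n; nia.
case=> m; first by move=> /N ->.
by rewrite NegzE mulrNz => /eqP; rewrite oppr_eq0 => /eqP/N.
Qed.

(** If p vanishes in k, every integer is 0 or a unit.  Otherwise k has
    characteristic 0 and the difference is smaller than p in absolute value. *)
Lemma eigen_unit (R : realType) d (X Y : 'M[k]_d) (a : 'I_d -> int) :
  (2 * d.-1 < p)%N ->
  (forall i j, X i j != 0 -> a i = a j + 2) ->
  (forall i j, Y i j != 0 -> a i = a j - 2) ->
  (forall i, (X *m Y - Y *m X) i i = (a i)%:~R) ->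
  forall i j, (a i)%:~R != (a j)%:~R :> k -> val ((a i)%:~R - (a j)%:~R) = 0.
Proof.
move=> dp hX hY hH i j ne; rewrite -intrB.
have n0 : (a i - a j)%:~R != 0 :> k by rewrite intrB subr_eq0.
suff pn : ~~ (p %| `|a i - a j|)%N by have [] := int_val0 R pn.
have [p0|p0] := eqVneq (p%:R : k) 0.
  apply: contraNN n0 => /dvdnP[q e].
  have [->|->] : a i - a j = `|a i - a j|%N :> int \/ a i - a j = -
    (`|a i - a j|%N : int) by lia.
    by rewrite e -[_%:~R]/((_ : nat)%:R) natrM p0 mulr0.
  by rewrite mulrNz e -[X in - X]/((_ : nat)%:R) natrM p0 mulr0 oppr0.
have := weight_diff_bound hX hY hH (char0_int R p0) i j => hb.
apply/negP => /dvdn_leq; have : a i - a j != 0 by apply: contraNneq n0 => ->.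
rewrite natz in hb; lia.
Qed.

End Residue.

(** * Translation of generalised facets *)

Section Geometry.
Context (gt : group_type) (n : nat) (k : fieldType) (val : k -> int) (R : realType).
Hypothesis hk : is_local_field val.
Local Notation d := (dimG gt n).
Local Notation w := (std_weight gt n).
Local Notation G := (in_group gt n k).
Local Notation g_ := (in_lie gt n k).
Local Notation C := (in_cochar gt n R).
Local Notation pt := (@pt gt n k val R).
Local Notation building := (@building gt n k val R).
Local Notation pt_filt := (@pt_filt gt n k val R).
Local Notation lie_filt := (@lie_filt gt n k val R).
Local Notation same_gen_facet := (@same_gen_facet gt n k val R).
Local Notation B_set := (@B_set gt n k val R).
Implicit Types (x y : 'rV[R]_n) (r s : R).

Lemma buildingP g x : G g -> C x -> building (pt g x).
Proof. by move=> gG Cx; exists g, x. Qed.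

Lemma same_side_sym r x y : same_side gt r x y -> same_side gt r y x.
Proof. by move=> h psi /h[-> ->]. Qed.

Lemma same_side_lie_filt cl r x y : same_side gt r x y ->
  lie_filt cl x r `<=` lie_filt cl y r.
Proof.
move=> h M /(lie_filtP hk)[gM fM]; apply/(lie_filtP hk); split=> // i j.
have [->|nz] := eqVneq (M i j) 0; first by left.
have := fM i j; rewrite !vb_neq0 //.
have [->|ij] := eqVneq i j; first by rewrite !addrK.
have hp : affine_roots gt n (w i - w j, val (M i j)) by exists i, j.
have := same_side_lteif cl h hp; rewrite /aff_eval /= !pairingBl -!/(wt _ _) => e h1.
have h2 : r < wt i x - wt j x + (val (M i j))%:~R ?<= if cl by case: (cl) h1 => /=; lra.
by rewrite -e in h2; case: (cl) h2 => /=; lra.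
Qed.

(** The opposite of an affine root is an affine root, so r-facets also determine the
    lattices of depth -r. *)
Lemma same_side_lie_filtN r x y : same_side gt r x y ->
  lie_filt true x (- r) `<=` lie_filt true y (- r).
Proof.
move=> h M /(lie_filtP hk)[gM fM]; apply/(lie_filtP hk); split=> // i j.
have [->|nz] := eqVneq (M i j) 0; first by left.
have := fM i j; rewrite !vb_neq0 //.
have [->|ij] := eqVneq i j; first by rewrite !addrK.
have hp : affine_roots gt n (w j - w i, - val (M i j)) by exists j, i; rewrite eq_sym.
have [_] := h _ hp; rewrite /aff_eval /= !pairingBl -!/(wt _ _) intrN => e /= h1.
have /negbTE h2 : ~~ (r < wt j x - wt i x + - (val (M i j))%:~R) by rewrite -leNgt; lra.
by move: e; rewrite h2 => /negbT; rewrite -leNgt; lra.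
Qed.

(** Test the lattices on multiples of root vectors of all valuations. *)
Lemma lie_filt_same_side r x y : (forall cl, lie_filt cl x r = lie_filt cl y r) ->
  same_side gt r x y.
Proof.
move=> h [phi m] [l [i [li /= ->]]].
have [c [c0 vc]] := vb_cst hk m.
have key cl z : lie_filt cl z r (c *: rvec k l i) <-> (r < aff_eval (w l - w i,
  m) z ?<= if cl).
  have [gr hr] := rvec_root_space k li.
  have E (a b : 'I_d) : rvec k l i a b != 0 -> wt a z - wt b z = wt l z - wt i z.
    by move=> /hr e; rewrite /wt -!pairingBl e.
  split=> [/(lie_filtP hk)[_ /(_ l i)]|hz].
    rewrite mxE rvec_id mulr1 vb_neq0 // vc /aff_eval /= pairingBl -!/(wt _ _).
    by case: (cl) => /=; lra.
  apply/(lie_filtP hk); split; first exact: in_lieZ.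
  move=> a b; rewrite mxE; have [->|nz] := eqVneq (rvec k l i a b) 0;
    first by rewrite mulr0; left.
  move: hz (E _ _ nz); rewrite /aff_eval /= pairingBl -!/(wt _ _) => hz e.
  have hc : vb val cl (r + wt b z - wt a z) c by right; rewrite vc; case: (cl) hz => /=;
    lra.
  by have [->|->|->] := rvec_entry k l i a b; rewrite ?mulr0 ?mulr1 ?mulrN1;
    [left| |exact: vbN].
have kt := key true; have kf := key false.
have e1 : (r <= aff_eval (w l - w i, m) y) = (r <= aff_eval (w l - w i, m) x).
  by apply/idP/idP => /kt h1; apply/kt; rewrite ?h // -h.
have e2 : (r < aff_eval (w l - w i, m) y) = (r < aff_eval (w l - w i, m) x).
  by apply/idP/idP => /kf h1; apply/kf; rewrite ?h // -h.
by split=> //; rewrite !ltNge e1.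
Qed.

Lemma pt_filt_lie_filt cl g x y r : G g -> C x -> C y ->
  pt_filt cl (pt g x) r = pt_filt cl (pt g y) r <-> lie_filt cl x r = lie_filt cl y r.
Proof.
move=> gG Cx Cy; have gu := in_group_unit gG.
have K M : invmx g *m (g *m M *m invmx g) *m g = M by rewrite !mulmxA mulVmx // mul1mx
  mulmxKV.
split=> e.
  apply/seteqP; split=> M hM.
    by rewrite -(K M); apply/(pt_filtP hk) => //; rewrite -e; apply/(pt_filtP hk) => //;
      rewrite K.
  by rewrite -(K M); apply/(pt_filtP hk) => //; rewrite e; apply/(pt_filtP hk) => //;
    rewrite K.
by apply/seteqP; split=> M /(pt_filtP hk) h; apply/(pt_filtP hk) => //;
  [rewrite -e|rewrite e]; apply: h.
Qed.

Lemma same_gen_facetP g x y r : G g -> C x -> C y ->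
  same_gen_facet r (pt g x) (pt g y) <-> same_side gt r x y.
Proof.
move=> gG Cx Cy; split=> [[h1 h2]|h].
  by apply: lie_filt_same_side => -[]; apply/(pt_filt_lie_filt _ _ gG).
by split; apply/(pt_filt_lie_filt _ _ gG) => //; apply/seteqP; split;
  apply: same_side_lie_filt => //; exact: same_side_sym.
Qed.

(** In a common apartment the two points lie in one r-facet. *)
Lemma same_gen_facetN P Q r : building P -> building Q -> same_gen_facet r P Q ->
  pt_filt true P (- r) = pt_filt true Q (- r).
Proof.
move=> [g1 [x1 [G1 C1 ->]]] [g2 [x2 [G2 C2 ->]]].
have [g3 [y2 [G3 C3 -> ->]]] := common_apartment hk G1 G2 C1 C2.
move=> /(same_gen_facetP _ G3 C1 C3) h; apply/(pt_filt_lie_filt _ _ G3) => //.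
by apply/seteqP; split; apply: same_side_lie_filtN => //; exact: same_side_sym.
Qed.

Definition gen_facet r (P : set ('M[k]_d * 'rV[R]_n)) :=
  [set Q | building Q /\ same_gen_facet r P Q].

Lemma gen_facet_B Y X r P : building P -> B_set Y X r P -> gen_facet r P `<=` B_set Y X r.
Proof.
move=> bP [_ hY hX] Q [bQ h]; split=> //; first by rewrite -(same_gen_facetN bP bQ h).
by case: h => <- _.
Qed.

Lemma gen_facet_apartment g x r : G g -> C x ->
  [set y | C y /\ gen_facet r (pt g x) (pt g y)] = cell gt r x.
Proof.
move=> gG Cx; apply/seteqP; split=> y [Cy h]; split=> //.
  by case: h => _ /(same_gen_facetP _ gG Cx Cy).
by split; [exact: buildingP | apply/same_gen_facetP].
Qed.

Lemma gen_facet_eq r P Q : gen_facet r P Q -> gen_facet r P = gen_facet r Q.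
Proof.
move=> [bQ [h1 h2]]; apply/seteqP; split=> S [bS [h3 h4]]; split=> //; split.
- by rewrite -h1.
- by rewrite -h2.
- by rewrite h1.
- by rewrite h2.
Qed.

Lemma gen_facet_dim_pt g x r : G g -> C x ->
  gen_facet_dim val (gen_facet r (pt g x)) (\dim (dirspace gt r x)).
Proof.
move=> gG Cx; exists g; split=> //=; rewrite gen_facet_apartment //; split;
  first by exists x.
exact: affine_dim_cell.
Qed.

(** The linear part of the affine map by which [m] acts on the apartment. *)
Lemma weyl_linear (m : 'M[k]_d) (s : 'S_d) : G m ->
  (forall i j, (m i j != 0) = (i == s j)) ->
  exists A : 'M[R]_n, forall v, C v -> C (v *m A) /\ forall i, wt (s i) (v *m A) = wt i v.
Proof.
have E (u : 'rV[int]_n) (v : 'rV[R]_n) : \sum_l v 0 l * pairing u (delta_mx 0 l) =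
  pairing u v.
  rewrite /pairing; apply: eq_bigr => l _; rewrite (bigD1 l) //= big1 ?addr0.
    by rewrite mxE !eqxx mulr1 mulrC.
  by move=> j jl; rewrite mxE (negPf jl) andbF mulr0.
move: m s; rewrite /in_cochar; case: gt => m s mG hs.
  exists (\matrix_(l, i) @wt SL n R ((s^-1)%g i) (delta_mx 0 l)) => v Cv.
  have vE i : (v *m \matrix_(l, i) @wt SL n R ((s^-1)%g i) (delta_mx 0 l)) 0 i = v 0
    ((s^-1)%g i).
    rewrite mxE -(@wtSL n R ((s^-1)%g i) v) -[RHS]E; by apply: eq_bigr => l _; rewrite mxE.
  split; last by move=> i; rewrite !wtSL vE permK.
  transitivity (\sum_(i < n) v 0 i) => //;
    rewrite [RHS](reindex_inj (@perm_inj _ (s^-1)%g)).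
  by apply: eq_bigr => i _; rewrite vE.
exists (\matrix_(l, i) @wt Sp n R ((s^-1)%g (lshift n i)) (delta_mx 0 l)) => v _;
  split=> // i.
have vE l : (v *m \matrix_(l, i) @wt Sp n R ((s^-1)%g (lshift n i)) (delta_mx 0 l)) 0 l =
  @wt Sp n R ((s^-1)%g (lshift n l)) v.
  by rewrite mxE -[RHS]E; apply: eq_bigr => l' _; rewrite mxE.
have key l : s i = l -> wt l (v *m \matrix_(l,
  i) @wt Sp n R ((s^-1)%g (lshift n i)) (delta_mx 0 l)) = wt i v.
  move: l; apply: lr_case => l e; first by rewrite wtSp_l vE -e permK.
  rewrite wtSp_r vE (_ : lshift n l = s (star i));
    last by rewrite (mono_star mG hs) e star_r.
  by rewrite permK wt_star opprK.
exact: key.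
Qed.

Lemma wt_eq0 v : C v -> (forall i : 'I_d, wt i v = 0) -> v = 0.
Proof.
rewrite /in_cochar; case: gt => _ h; apply/rowP => i; rewrite mxE.
  by rewrite -(h i) wtSL.
by rewrite -(h (lshift n i : 'I_(dimG Sp n))) wtSp_l.
Qed.

(** The two coordinates of a point differ by a monomial matrix, whose linear part
    sends walls through one to walls through the other. *)
Lemma dim_dirs_le g h x y r : G g -> G h -> C x -> C y -> pt g x = pt h y ->
  (\dim (dirspace gt r x) <= \dim (dirspace gt r y))%N.
Proof.
move=> gG hG Cx Cy e.
have [m [[mG [s hs]] hnu _]] : building_rel val g x h y.
  by apply/(building_relP hk) => //; apply/(pt_eqP hk).
have [A hA] := weyl_linear mG hs.
have lin : linear (fun v : 'rV[R]_n => v *m A) by move=> c u v; rewrite mulmxDl scalemxAl.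
pose f := linfun (mulmxr A : {linear 'rV[R]_n -> 'rV[R]_n}).
have fE v : f v = v *m A by rewrite lfunE.
have inj : (dirspace gt r x :&: lker f = 0)%VS.
  apply/eqP; rewrite -subv0; apply/subvP => v;
    rewrite memv_cap memv_ker fE memv0 => /andP[/dirspaceP[Cv _] /eqP v0].
  apply/eqP/wt_eq0 => // i; have [_ <-] := hA v Cv; rewrite v0.
  by rewrite /wt /pairing big1 // => l _; rewrite mxE mulr0.
rewrite -(limg_dim_eq inj); apply: dimvS;
  apply/subvP => _ /memv_imgP[v /dirspaceP[Cv hv] ->].
rewrite fE; have [CA wA] := hA v Cv; apply/dirspaceP;
  split=> // phi [a [b [ab ->]]] [m' hm'].
have ha : a = s ((s^-1)%g a) by rewrite permKV.
have hb : b = s ((s^-1)%g b) by rewrite permKV.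
rewrite pairingBl -!/(wt _ _) ha hb !wA; apply/eqP;
  rewrite subr_eq0 -subr_eq0 /wt -pairingBl; apply/eqP.
apply: hv; first by exists ((s^-1)%g a), ((s^-1)%g b); rewrite (inj_eq perm_inj).
have n1 := hnu a ((s^-1)%g a); have n2 := hnu b ((s^-1)%g b).
rewrite !hs !permKV !eqxx in n1 n2; move: hm'; rewrite pairingBl (n1 isT) (n2 isT) => hm'.
exists (m' - val (m a ((s^-1)%g a)) + val (m b ((s^-1)%g b))).
by rewrite pairingBl intrD intrB -hm'; ring.
Qed.

(** Two points of the generalised facet lie in one cell of a common apartment, and
    the dimension at a point does not depend on the coordinates of that point. *)
Lemma gen_facet_dim_uniq r P e g x : building P -> gen_facet_dim val (gen_facet r P) e ->
  G g -> C x -> gen_facet r P (pt g x) -> e = \dim (dirspace gt r x).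
Proof.
move=> bP [g1 [G1 [[x1 [C1 h1]] hdim]]] gG Cx hx.
move: hdim; rewrite (gen_facet_eq h1) gen_facet_apartment // => hdim.
rewrite (cell_dim C1 hdim).
have [g3 [y2 [G3 C3 e1 e2]]] := common_apartment hk G1 gG C1 Cx.
have h3 : same_side gt r x1 y2.
  apply/(same_gen_facetP _ G3) => //; rewrite -e1 -e2.
  by move: hx; rewrite (gen_facet_eq h1) => -[].
rewrite (dirs_cell (conj C3 h3 : cell gt r x1 y2)).
by apply/eqP; rewrite eqn_leq (dim_dirs_le _ G3 gG) // (dim_dirs_le _ gG G3).
Qed.

(** What the translation argument uses of a one-parameter subgroup of the torus of
    [g] adapted to the triple. *)
Definition adapted_coweight (Y X g : 'M[k]_d) (b : 'rV[R]_n) :=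
  [/\ C b, forall i j, (invmx g *m X *m g) i j != 0 -> wt i b - wt j b = 2 &
      forall i j, (invmx g *m Y *m g) i j != 0 -> wt j b - wt i b = 2].

(** With c = (s - r) / 2, translation by c [b] adds 2 c to the depth of
    X and subtracts 2 c from that of Y. *)
Lemma translate_B Y X g b x r s : G g -> C x -> adapted_coweight Y X g b ->
  B_set Y X r (pt g x) -> B_set Y X s (pt g (x + ((s - r) / 2) *: b)).
Proof.
move=> gG Cx [Cb hX hY] [_ /(pt_filtP hk)-/(_ gG Cx)/(lie_filtP hk)[gY fY]
  /(pt_filtP hk)-/(_ gG Cx)/(lie_filtP hk)[gX fX]].
have Cz : C (x + ((s - r) / 2) *: b) by apply: in_cocharDZ.
split; first exact: buildingP.
  apply/(pt_filtP hk) => //; apply/(lie_filtP hk); split=> // i j.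
  have [->|nz] := eqVneq ((invmx g *m Y *m g) i j) 0; first by left.
  move: (fY i j) (hY _ _ nz); rewrite !wtD !wtZ => h e; apply: vbW h => /=.
  have -> : wt j b = wt i b + 2 by rewrite -e; ring.
  by lra.
apply/(pt_filtP hk) => //; apply/(lie_filtP hk); split=> // i j.
have [->|nz] := eqVneq ((invmx g *m X *m g) i j) 0; first by left.
move: (fX i j) (hX _ _ nz); rewrite !wtD !wtZ => h e; apply: vbW h => /=.
have -> : wt i b = wt j b + 2 by rewrite -e; ring.
by lra.
Qed.

Lemma translate_facet Y X g b x0 r s : G g -> C x0 -> adapted_coweight Y X g b ->
  B_set Y X r (pt g x0) ->
  exists x, let z := x + ((s - r) / 2) *: b in
    [/\ cell gt r x0 x, C z, B_set Y X s (pt g z) &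
        (\dim (dirspace gt r x0) <= \dim (dirspace gt s z))%N].
Proof.
move=> gG Cx hb hB; have [Cb _ _] := hb.
have Cc : C (((s - r) / 2) *: b) by rewrite -[_ *: b]add0r; apply: in_cocharDZ => //;
  exact: in_cochar0.
have [x [h1 h2 h3]] := translate_cell r s Cx Cc.
exists x; split=> //; apply: translate_B => //; first by case: h1.
apply: (gen_facet_B (buildingP gG Cx) hB).
by split; [apply: buildingP => //; case: h1 | apply/same_gen_facetP => //; case: h1].
Qed.

End Geometry.

Lemma prod_sub_diag (k : fieldType) d es (r : 'rV[k]_d) : (forall i, r 0 i \in es) ->
  prod_sub es (diag_mx r) = 0.
Proof.
move=> h; apply/matrixP => i j; rewrite [RHS]mxE.
have /(prod_sub_col es)/colP/(_ i) : diag_mx r *m delta_mx j 0 = r 0 j *: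
  (delta_mx j 0 : 'cV[k]_d).
  by rewrite -colE; apply/colP => l; rewrite !mxE eqxx andbT; case: eqVneq => [->|_];
    rewrite ?mulr1n ?mulr1 // mulr0n mulr0.
by rewrite -colE ![in LHS]mxE => ->; rewrite (big_rem _ (h j)) /= subrr mul0r scale0r mxE.
Qed.

Section Adapt.
Context (gt : group_type) (n : nat) (k : fieldType) (val : k ->
  int) (p : nat) (R : realType).
Hypotheses (hk : is_local_field val) (hres : residue_char val p).
Hypotheses (hn : (2 <= n)%N) (hp : (3 * (coxeter_number gt n - 1) < p)%N).
Local Notation d := (dimG gt n).
Local Notation w := (std_weight gt n).
Local Notation G := (in_group gt n k).
Local Notation C := (in_cochar gt n R).

Let dp : (3 * (d - 1) < p)%N.
Proof. by move: hp; rewrite /coxeter_number /dimG; case: gt => //; rewrite addnn mul2n. Qed.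

Let d2 : (2 <= d)%N.
Proof. by rewrite /dimG; case: gt => //; rewrite -[2%N]addn0; apply: leq_add. Qed.

Let two_neq0 m : (0 < m <= d)%N -> (2 * m)%:R != 0 :> k.
Proof.
move=> /andP[m0 md]; have [pp _] := hres.
have [] // := int_val0 hk hres R (m := (2 * m)%N) => /=.
rewrite Euclid_dvdM // negb_or; apply/andP; split; apply/negP => /dvdn_leq; lia.
Qed.

Variables (Y H X : 'M[k]_d) (g : 'M[k]_d) (a : 'rV[int]_n).
Hypothesis hYHX : lie_triple Y H X.
Hypothesis gG : G g.
Hypothesis hX : forall i j, (invmx g *m X *m g) i j != 0 -> wt i a = wt j a + 2.
Hypothesis hY : forall i j, (invmx g *m Y *m g) i j != 0 -> wt i a = wt j a - 2.
Hypothesis hH : invmx g *m H *m g = diag_mx (\row_i (wt i a)%:~R).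

Let conj_bracket (h A B : 'M[k]_d) : h \in unitmx ->
  invmx h *m lie_bracket A B *m h = lie_bracket (invmx h *m A *m h) (invmx h *m B *m h).
Proof.
by move=> hu; rewrite /lie_bracket mulmxBr mulmxBl -!mulmxA !(mulKVmx hu) !mulmxA.
Qed.

(** H has depth 0 at the point because it is the bracket of X and Y, whose depths
    are s and -s; so it can be diagonalised without moving the point, and the
    coweight is a lift of its eigenvalues. *)
Lemma adapt_apartment h y s : G h -> C y -> @B_set gt n k val R Y X s (pt val h y) ->
  exists h' b, [/\ G h', pt val h y = pt val h' y & @adapted_coweight gt n k R Y X h' b].
Proof.
move=> hG Cy [_ /(pt_filtP hk)-/(_ hG Cy)/(lie_filtP hk)[gY' fY]
  /(pt_filtP hk)-/(_ hG Cy)/(lie_filtP hk)[gX' fX]].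
have hu := in_group_unit hG; have gu := in_group_unit gG.
pose H' := invmx h *m H *m h.
have HXY : H' = lie_bracket (invmx h *m X *m h) (invmx h *m Y *m h).
  by rewrite /H' -(lie_triple_XY hYHX) conj_bracket.
have gH' : in_lie gt n k H' by apply: in_lieJ => //; exact: lie_triple_H hYHX.
have fH' : filt val true y y 0 H'.
  rewrite HXY; apply: filtD => //; last first.
    by apply: filtN => //; rewrite -[0](addNr s); apply: filtM fX.
  by rewrite -[0](addrN s); apply: filtM fY.
pose es := undup (codom (fun i : 'I_d => (wt i a)%:~R : k)).
have esP al : al \in es -> exists i : 'I_d, al = (wt i a)%:~R.
  by rewrite mem_undup => /codomP.
have ves al : al \in es -> vb val true (0 : R) al by move=> /esP[i ->]; exact: vb_int.
have des al be : al \in es -> be \in es -> al != be -> val (al - be) = 0.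
  move=> /esP[i ->] /esP[j ->].
  apply: (@eigen_unit _ _ _ hk hres R _ _ _ (fun i => wt i a) _ hX hY); first by lia.
  move=> l; have := lie_triple_XY hYHX => /(congr1 (fun M => invmx g *m M *m g)).
  by rewrite conj_bracket // hH /lie_bracket => ->; rewrite !mxE eqxx mulr1n.
have pH' : prod_sub es H' = 0.
  have -> : H' = invmx (invmx g *m h) *m (invmx g *m H *m g) *m (invmx g *m h).
    by rewrite /H' invmx_mul ?unitmx_inv // invmxK -!mulmxA !(mulKVmx gu).
  rewrite prod_sub_conj ?unitmx_mul ?unitmx_inv ?gu // hH prod_sub_diag ?mulmx0 ?mul0mx //.
  by move=> i; rewrite mxE mem_undup; apply: codom_f.
have [u pu /is_diag_mxP hdiag] := diagonalize hk gH' fH' (undup_uniq _) ves des pH'.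
have uG := para_group hk pu; have uu := in_group_unit uG.
pose h' := h *m u.
have h'G : G h' by apply: in_groupM.
have h'u := in_group_unit h'G.
pose D := invmx h' *m H *m h'.
have DE : D = invmx u *m H' *m u by rewrite /D /H' /h' invmx_mul // !mulmxA.
pose c i := D i i.
have Dij i j : i != j -> D i j = 0 by rewrite -(inj_eq val_inj) DE; exact: hdiag.
have gD : in_lie gt n k D by apply: in_lieJ => //; exact: lie_triple_H hYHX.
have cstar : gt = Sp -> forall i, c (star i) = - c i.
  move: gD; rewrite /c; move: (D); case: gt => // D' /in_lieSpP gD' _ i.
  by rewrite gD' !starK sg_star mulrNN sg_sq mul1r.
have n0 : (0 < n)%N by apply: leq_trans hn.
have [b Cb hb] := potential R n0 two_neq0 cstar.
have Dl (M : 'M[k]_d) i j : (lie_bracket D M) i j = (c i - c j) * M i j.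
  rewrite !mxE (bigD1 i) //= big1 => [|l li]; last by rewrite Dij ?mul0r // eq_sym.
  rewrite (bigD1 j) //= big1 => [|l lj]; last by rewrite Dij ?mulr0.
  by rewrite !addr0 mulrBl [M i j * _]mulrC.
exists h', b; split=> //.
  by apply/(pt_eqP hk) => //; rewrite mulKmx //; exact: para_norm_iso.
split=> // i j nz; apply: hb.
  have := congr1 (fun M : 'M[k]_d => (invmx h' *m M *m h') i j) (lie_triple_HX hYHX).
  rewrite conj_bracket // -/D Dl -scalemxAr -scalemxAl [in RHS]mxE => /(mulIf nz). by [].
have := congr1 (fun M : 'M[k]_d => (invmx h' *m M *m h') i j) (lie_triple_HY hYHX).
rewrite conj_bracket // -/D Dl mulmxN mulNmx -scalemxAr -scalemxAl -scaleNr [in RHS]mxE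
  => /(mulIf nz) e.
by rewrite -opprB e opprK.
Qed.

End Adapt.

Theorem corollary3p7 (R : realType) (k : fieldType) (val : k -> int) (p : nat)
    (gt : group_type) (n : nat)
    (hk : is_local_field val) (hres : residue_char val p)
    (hn : (2 <= n)%N) (hp : (3 * (coxeter_number gt n - 1) < p)%N)
    (r s : R)
    (Y H X : 'M[k]_(dimG gt n)) (hYHX : lie_triple Y H X)
    (lambda : forall A : comUnitAlgType k, A -> 'M[A]_(dimG gt n))
    (hlambda : adapted lambda Y H X)
    (g : 'M[k]_(dimG gt n)) (hg : in_group gt n k g)
    (a : 'rV[int]_n) (ha : cochar_in_torus lambda g a)
    (F : set 'rV[R]_n) (hF : is_facet gt r F)
    (hmax : corresponds_max val Y X g r F) :
  exists x F', [/\ F x, is_facet gt s F',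
    F' (x + ((s - r) / 2) *: map_mx intr a) &
    corresponds_max val Y X g s F'].
Proof.
have [phi [hphi [dY dH dX] hlam]] := hlambda.
have aX := adapted_X hk hg ha hphi hlam dX.
have aY := adapted_Y hk hg ha hphi hlam dY.
have aH := adapted_H hg ha hlam dH.
have [x0 C0 FE] := facet_cell hF.
have [GF [[P bP GFE] GFB [e hdim hmaxe]] hsub] := hmax.
have G0 : GF (pt val g x0) by apply: hsub; exists x0 => //; rewrite FE.
have wta i : wt i (map_mx intr a : 'rV[R]_n) = (wt i a)%:~R by exact: pairing_intr.
have hb : @adapted_coweight gt n k R Y X g (map_mx intr a).
  split.
  - have [ca _] := ha; move: ca; rewrite /in_cochar; case: (gt) => // ca.
    transitivity ((\sum_(i < n) a 0 i)%:~R : R); last by rewrite ca.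
    by rewrite rmorph_sum; apply: eq_bigr => i _; rewrite mxE.
  - by move=> i j /aX h; rewrite !wta h intrD; ring.
  - by move=> i j /aY h; rewrite !wta h intrB; ring.
have [x [h1 Cz hz dimz]] := translate_facet hk s hg C0 hb (GFB _ G0).
have bz := buildingP val hg Cz.
exists x, (cell gt s (x + ((s - r) / 2) *: map_mx intr a)); split.
- by rewrite FE.
- exact: cell_facet.
- exact: cell_refl.
exists (gen_facet val s (pt val g (x + ((s - r) / 2) *: map_mx intr a))); last first.
  move=> _ [y [Cy hy] <-]; split; first exact: buildingP.
  by apply/same_gen_facetP.
split.
- by exists (pt val g (x + ((s - r) / 2) *: map_mx intr a)).
- exact: gen_facet_B.
exists (\dim (dirspace gt s (x + ((s - r) / 2) *: map_mx intr a)));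
  first exact: gen_facet_dim_pt.
move=> GF' e' [P' bP' GFE'] GFB' hdim'; apply: leq_trans dimz.
have [h [hG [[y [Cy hy]] _]]] := hdim'.
have e'E : e' = \dim (dirspace gt s y).
  by rewrite GFE' in hdim' hy; exact: gen_facet_dim_uniq hdim' hG Cy hy.
(* A larger s-facet would give a larger r-facet by translating back. *)
have [h' [b [h'G ptE hb']]] := adapt_apartment hk hres hn hp hYHX hg aX aY aH hG Cy
  (GFB' _ hy).
have hy' := GFB' _ hy; rewrite ptE in hy'.
have [x' [k1 k2 k3 k4]] := translate_facet hk r h'G Cy hb' hy'.
have eE : e = \dim (dirspace gt r x0).
  by rewrite GFE in hdim G0; exact: gen_facet_dim_uniq hdim hg C0 G0.
rewrite e'E -eE; apply: leq_trans k4 _.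
apply: hmaxe (gen_facet_dim_pt hk _ h'G k2).
- by exists (pt val h' (x' + ((r - s) / 2) *: b)); [exact: buildingP|].
- by apply: gen_facet_B k3 => //; exact: buildingP.
Qed.
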